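(* Let $R\in\mathbb{C}_p(z)$ be a rational function of degree at least $2$ and let $n\ge 1$. Suppose that $R$ has an $n$-cycle of Siegel disks $D_0,D_1,\ldots,D_{n-1}\subset\mathcal{E}(R)$, each of which is a disk in $\mathbb{C}_p$, labeled in such a way that $D_j=R^j(D_0)$ for $0\le j\le n-1$ and such that, if $\rho_j$ denotes the radius of $D_j$, then $\rho_0\leq\rho_j$ for $1\leq j\leq n-1$. Suppose moreover that $$\operatorname{dist}(D_0,D_j)=\operatorname{dist}(D_1,D_{j+1})\quad\text{for each } j\geq 1,$$ where the indices of the disks are taken modulo $n$. Then there exists a rational function $Q\in\mathbb{C}_p(z)$ with $\deg(Q)=\deg(R)+1$ such that $Q$ has an $n$-cycle of $1$-Herman rings.
   Context: Let $p$ be a fixed prime, $\mathbb{C}_p$ the completion of an algebraic closure of $\mathbb{Q}_p$, with $p$-adic norm $|\cdot|$, and $|\mathbb{C}_p|=\{|z| : z\in\mathbb{C}_p\setminus\{0\}\}$. $\mathbb{P}(\mathbb{C}_p)=\mathbb{C}_p\cup\{\infty\}$ is the projective line, endowed with the chordal metric $$\rho([X_1,Y_1],[X_2,Y_2])=\frac{|X_1Y_2-X_2Y_1|}{\max\{|X_1|,|Y_1|\}\max\{|X_2|,|Y_2|\}}.$$ A rational function $R\in\mathbb{C}_p(z)$ is regarded as a map $\mathbb{P}(\mathbb{C}_p)\to\mathbb{P}(\mathbb{C}_p)$, and $R^k$ denotes its $k$-fold iterate. Balls and disks. For $r\in|\mathbb{C}_p|$ and $z_0\in\mathbb{C}_p$,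 a ball in $\mathbb{C}_p$ is a set $B_r(z_0)=\{z\in\mathbb{C}_p : |z-z_0|\le r\}$ and a disk in $\mathbb{C}_p$ is a set $D_r(z_0)=\{z\in\mathbb{C}_p : |z-z_0|<r\}$; $r$ is its radius. A ball in $\mathbb{P}(\mathbb{C}_p)$ is a ball in $\mathbb{C}_p$ or the complement in $\mathbb{P}(\mathbb{C}_p)$ of a disk in $\mathbb{C}_p$; a disk in $\mathbb{P}(\mathbb{C}_p)$ is a disk in $\mathbb{C}_p$ or the complement in $\mathbb{P}(\mathbb{C}_p)$ of a ball in $\mathbb{C}_p$. For subsets $A,B\subset\mathbb{C}_p$, $\operatorname{dist}(A,B)=\inf\{|a-b| : a\in A,\ b\in B\}$. Analytic components. A closed (respectively open) connected affinoid is a nonempty intersection of finitely many balls (respectively disks) in $\mathbb{P}(\mathbb{C}_p)$. For $U\subset\mathbb{P}(\mathbb{C}_p)$ and $x\in U$, the analytic component of $U$ containing $x$ is the union of all (closed or open) connected affinoids that contain $x$ and are contained in $U$. Domain of quasiperiodicity. $\mathcal{E}(R)$ is the set of $z\in\mathbb{P}(\mathbb{C}_p)$ for which there are integers $n_j\to\infty$ and a neighborhood $V$ of $z$ such that $\rho(R^{n_j}(w),w)\to 0$ uniformly for $w\in V$. Siegel disks and Herman rings. An analytic component $C$ of $\mathcal{E}(R)$, where $\deg R\ge2$, is a Siegel disk of $R$ if $C=\mathbb{P}(\mathbb{C}_p)\setminus B_0$ for some ball $B_0$ in $\mathbb{P}(\mathbb{C}_p)$ (that is, $C$ is a disk in $\mathbb{P}(\mathbb{C}_p)$).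 It is a $1$-Herman ring of $R$ if $C=\mathbb{P}(\mathbb{C}_p)\setminus(B_0\cup B_1)$ for two disjoint balls $B_0,B_1$ in $\mathbb{P}(\mathbb{C}_p)$. An $n$-cycle of Siegel disks (respectively, of $1$-Herman rings) of $R$ is a collection of $n$ distinct Siegel disks (respectively, $1$-Herman rings) $C_0,\dots,C_{n-1}$ of $R$ such that $R(C_j)=C_{j+1}$ for all $j$, with indices taken modulo $n$. *)

(* Defs.v *)
From HB Require Import structures.
From mathcomp Require Import all_boot all_order all_algebra.
From mathcomp Require Import all_classical all_reals all_analysis.

Set Implicit Arguments.
Unset Strict Implicit.
Unset Printing Implicit Defensive.

Import Order.TTheory GRing.Theory Num.Theory.
Import numFieldNormedType.Exports.

Local Open Scope classical_set_scope.
Local Open Scope ring_scope.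
Local Open Scope quotient_scope.

(** * The field C_p *)

Record is_nonarch_abs (RR : realType) (F : fieldType) (abs : F -> RR) : Prop :=
  IsNonarchAbs {
    nonarch_abs_ge0 : forall x, 0 <= abs x;
    nonarch_abs_eq0 : forall x, abs x = 0 <-> x = 0;
    nonarch_absM : forall x y, abs (x * y) = abs x * abs y;
    nonarch_absD : forall x y, abs (x + y) <= Num.max (abs x) (abs y) }.

Definition abs_complete (RR : realType) (F : fieldType) (abs : F -> RR) :=
  forall u : nat -> F,
    (forall e, 0 < e ->
       exists N, forall m n, (N <= m)%N -> (N <= n)%N -> abs (u m - u n) < e) ->
    exists l, abs (u n - l) @[n --> \oo] --> (0 : RR).

Record is_completion (RR : realType) (F K : fieldType)
    (absF : F -> RR) (absK : K -> RR) (i : {rmorphism F -> K}) : Prop :=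
  IsCompletion {
    completion_abs : is_nonarch_abs absK;
    completion_isometry : forall x, absK (i x) = absF x;
    completion_dense : forall y e, 0 < e -> exists x, absK (y - i x) < e;
    completion_complete : abs_complete absK }.

Record is_algebraic_closure (RR : realType) (F : fieldType) (L : closedFieldType)
    (absF : F -> RR) (absL : L -> RR) (i : {rmorphism F -> L}) : Prop :=
  IsAlgebraicClosure {
    algclosure_algebraic : forall x, algebraicOver i x;
    algclosure_abs : is_nonarch_abs absL;
    algclosure_extends : forall x, absL (i x) = absF x }.

(* p ^ (- v_p(x)); [logn p 0 = 0] forces the separate case. *)
Definition padic_abs (RR : realType) (p : nat) (x : rat) : RR :=
  if x == 0 then 0
  else (p%:R ^+ logn p `|denq x|%N) / (p%:R ^+ logn p `|numq x|%N).

(* [Cp] with [abs] is the completion of an algebraic closure [L] of [Qp], where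
   [Qp] is the completion of the rationals for the p-adic absolute value.
   This determines [(Cp, abs)] up to isometric isomorphism. *)
Definition is_Cp (RR : realType) (p : nat) (Cp : fieldType) (abs : Cp -> RR) : Prop :=
  exists (Qp : fieldType) (absQ : Qp -> RR) (i : {rmorphism rat -> Qp})
         (L : closedFieldType) (absL : L -> RR) (j : {rmorphism Qp -> L})
         (k : {rmorphism L -> Cp}),
    [/\ is_completion (padic_abs RR p) absQ i,
        is_algebraic_closure absQ absL j
      & is_completion absL abs k].

(** * The projective line *)

(* [Some z] is the finite point [z : 1]; [None] is infinity, [1 : 0]. *)
Definition proj_line (K : fieldType) := option K.

Definition hcoord (K : fieldType) (z : proj_line K) : K * K :=
  if z is Some x then (x, 1) else (1, 0).

Definition chordal (RR : realType) (K : fieldType) (abs : K -> RR)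
    (z w : proj_line K) : RR :=
  let: (x1, y1) := hcoord z in
  let: (x2, y2) := hcoord w in
  abs (x1 * y2 - x2 * y1)
    / (Num.max (abs x1) (abs y1) * Num.max (abs x2) (abs y2)).

Definition chordal_nbhs (RR : realType) (K : fieldType) (abs : K -> RR)
    (z : proj_line K) (V : set (proj_line K)) : Prop :=
  exists2 e, 0 < e & [set w | chordal abs z w < e] `<=` V.

(** * Rational functions *)

(* [ratnum R] / [ratden R] is a representation of [R] in lowest terms, unique
   up to a common nonzero scalar: see [ratfun_repr] and [ratfun_coprime]. *)
Definition ratnum (K : fieldType) (R : {fraction {poly K}}) : {poly K} :=
  let f : {ratio {poly K}} := repr R in f.1 %/ gcdp f.1 f.2.

Definition ratden (K : fieldType) (R : {fraction {poly K}}) : {poly K} :=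
  let f : {ratio {poly K}} := repr R in f.2 %/ gcdp f.1 f.2.

Lemma ratden_neq0 (K : fieldType) (R : {fraction {poly K}}) : ratden R != 0.
Proof.
have d0 := denom_ratioP (repr R).
by rewrite /ratden divp_eq0 (negPf d0) gcdp_eq0 (negPf d0) andbF /= -leqNgt
  leq_gcdpr.
Qed.

Lemma ratfun_coprime (K : fieldType) (R : {fraction {poly K}}) :
  coprimep (ratnum R) (ratden R).
Proof.
by apply: coprimep_div_gcd; rewrite (denom_ratioP (repr R)) orbT.
Qed.

Lemma ratfun_repr (K : fieldType) (R : {fraction {poly K}}) :
  R = tofrac (ratnum R) / tofrac (ratden R).
Proof.
have frac_ratio (f : {ratio {poly K}}) :
    \pi_({fraction {poly K}}) f = tofrac f.1 / tofrac f.2.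
  apply: (canRL (mulfK _)); first by rewrite tofrac_eq0 denom_ratioP.
  unlock tofrac; rewrite -[LHS]FracField.pi_mul; apply/eqP.
  rewrite FracField.equivf_def /FracField.mulf.
  rewrite !numden_Ratio ?mulf_neq0 ?denom_ratioP ?oner_eq0 //.
  by rewrite !mulr1 mulrC.
rewrite -[LHS]reprK frac_ratio; apply/eqP.
rewrite eqr_div ?tofrac_eq0 ?ratden_neq0 ?denom_ratioP // -!tofracM tofrac_eq.
have En := divpK (dvdp_gcdl (repr R).1 (repr R).2).
have Ed := divpK (dvdp_gcdr (repr R).1 (repr R).2).
rewrite -[X in X * _ == _]En -[X in _ == _ * X]Ed.
by rewrite -/(ratnum R) -/(ratden R) mulrAC mulrA.
Qed.

Definition ratdeg (K : fieldType) (R : {fraction {poly K}}) : nat :=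
  (maxn (size (ratnum R)) (size (ratden R))).-1.

(* The induced map on the projective line; with d = deg R, the image of infinity
   is [a_d : b_d], where a_d, b_d are the coefficients of degree d of the
   numerator and denominator. *)
Definition ratmap (K : fieldType) (R : {fraction {poly K}})
    (z : proj_line K) : proj_line K :=
  let: (x, y) :=
    if z is Some t then ((ratnum R).[t], (ratden R).[t])
    else ((ratnum R)`_(ratdeg R), (ratden R)`_(ratdeg R)) in
  if y == 0 then None else Some (x / y).

(** * Balls, disks, affinoids *)

Definition value_group (RR : realType) (K : fieldType) (abs : K -> RR) : set RR :=
  [set abs z | z in [set z | z != 0]].

Definition ballC (RR : realType) (K : fieldType) (abs : K -> RR) (r : RR) (z0 : K)
    : set K := [set z | abs (z - z0) <= r].

Definition diskC (RR : realType) (K : fieldType) (abs : K -> RR) (r : RR) (z0 : K)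
    : set K := [set z | abs (z - z0) < r].

Definition is_diskC (RR : realType) (K : fieldType) (abs : K -> RR) (r : RR)
    (D : set K) : Prop :=
  value_group abs r /\ exists z0, D = diskC abs r z0.

Definition is_ballC (RR : realType) (K : fieldType) (abs : K -> RR) (r : RR)
    (B : set K) : Prop :=
  value_group abs r /\ exists z0, B = ballC abs r z0.

Definition is_ballP (RR : realType) (K : fieldType) (abs : K -> RR)
    (B : set (proj_line K)) : Prop :=
  exists (r : RR) (A : set K),
    (is_ballC abs r A /\ B = Some @` A) \/ (is_diskC abs r A /\ B = ~` (Some @` A)).

Definition is_diskP (RR : realType) (K : fieldType) (abs : K -> RR)
    (D : set (proj_line K)) : Prop :=
  exists (r : RR) (A : set K),
    (is_diskC abs r A /\ D = Some @` A) \/ (is_ballC abs r A /\ D = ~` (Some @` A)).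

Definition set_dist (RR : realType) (K : fieldType) (abs : K -> RR) (A B : set K) : RR :=
  inf [set abs (a - b) | a in A & b in B].

Definition finite_inter (T : Type) (P : set (set T)) (A : set T) : Prop :=
  exists F : set (set T), [/\ finite_set F, F `<=` P & A = \bigcap_(B in F) B].

Definition connected_affinoid (RR : realType) (K : fieldType) (abs : K -> RR)
    (A : set (proj_line K)) : Prop :=
  A !=set0 /\
  (finite_inter (is_ballP abs) A \/ finite_inter (is_diskP abs) A).

Definition analytic_component_at (RR : realType) (K : fieldType) (abs : K -> RR)
    (U : set (proj_line K)) (x : proj_line K) : set (proj_line K) :=
  \bigcup_(A in [set A | [/\ connected_affinoid abs A, A x & A `<=` U]]) A.

Definition analytic_component (RR : realType) (K : fieldType) (abs : K -> RR)
    (U C : set (proj_line K)) : Prop :=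
  exists2 x, U x & C = analytic_component_at abs U x.

(** * Quasiperiodicity, Siegel disks, Herman rings *)

Definition quasiperiodicity (RR : realType) (K : fieldType) (abs : K -> RR)
    (R : {fraction {poly K}}) : set (proj_line K) :=
  [set z | exists (n : nat -> nat) (V : set (proj_line K)),
     [/\ n j @[j --> \oo] --> \oo,
         chordal_nbhs abs z V
       & forall e : RR, 0 < e ->
           \forall j \near \oo,
             forall w, V w -> chordal abs (iter (n j) (ratmap R) w) w < e]].

Definition siegel_disk (RR : realType) (K : fieldType) (abs : K -> RR)
    (R : {fraction {poly K}}) (C : set (proj_line K)) : Prop :=
  [/\ (2 <= ratdeg R)%N,
      analytic_component abs (quasiperiodicity abs R) C
    & exists2 B0, is_ballP abs B0 & C = ~` B0].

Definition herman_ring1 (RR : realType) (K : fieldType) (abs : K -> RR)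
    (R : {fraction {poly K}}) (C : set (proj_line K)) : Prop :=
  [/\ (2 <= ratdeg R)%N,
      analytic_component abs (quasiperiodicity abs R) C
    & exists B0 B1, [/\ is_ballP abs B0, is_ballP abs B1, B0 `&` B1 = set0
                      & C = ~` (B0 `|` B1)]].

(* Only the sets [C j] with [j < n] are relevant. *)
Definition is_cycle (K : fieldType) (n : nat) (R : {fraction {poly K}})
    (T : set (proj_line K) -> Prop) (C : nat -> set (proj_line K)) : Prop :=
  [/\ forall j, (j < n)%N -> T (C j),
      forall i j, (i < n)%N -> (j < n)%N -> C i = C j -> i = j
    & forall j, (j < n)%N -> ratmap R @` C j = C (j.+1 %% n)%N].

(* Main.v *)
Require Import Defs.
From mathcomp Require Import all_boot all_order all_algebra.
From mathcomp Require Import all_classical all_reals all_analysis.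
From mathcomp Require Import ring lra.

(* Let [a] be a point of [D 0], let [a m] be its image under [R ^ m], [m] being
   reduced modulo [n], and let [Q = R + eps / (z - a)].  As [R] is injective on
   the discs of the cycle, it is a similarity there.  On a circle [abs w = s]
   around [a], the map [Q] is to first order [c w + eps / w]: for
   [s ^ 2 > abs eps / abs c] the linear term dominates and [Q] is a similarity,
   while for [s ^ 2 = abs eps / abs c] it has degree two.  The hypotheses on
   distances and radii make the perturbation small on the other discs, so that
   [Q] permutes the annuli [sigma * rho m < abs (z - a m) < rho m], and [Q ^ n]
   is close enough to a rotation on their circles to be quasiperiodic.

   It remains to see that these annuli are full components.  The iterates of a
   map are injective on its domain of quasiperiodicity, because two points of
   this domain have disjoint neighbourhoods preserved by a common iterate.  A
   connected affinoid in the domain of [Q] that leaves an annulus contains all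
   but finitely many residue classes of one of the two bounding balls, and an
   injective rational function that is a similarity on the annulus is then a
   similarity on these classes too (Newton polygons).  On the inner ball this
   contradicts the degree two behaviour.  On the outer ball, in the coordinate
   [1 / (z - a m)], all iterates of [Q] are similarities between residue classes,
   recurrence makes every class periodic, and the classes whose orbit avoids
   infinity and the disc [D 0] are moved by [R] exactly as by [Q]; so they are in
   the domain of [R], against the maximality of the Siegel disk. *)

Set Implicit Arguments.
Unset Strict Implicit.
Unset Printing Implicit Defensive.

Import Order.TTheory GRing.Theory Num.Theory.

Local Open Scope classical_set_scope.
Local Open Scope ring_scope.

(** * Non-archimedean absolute values *)

(** The constant [sigma] is dictated by [R]. The centres follow the orbit of [a], so only the
    closing step of a period misses the next centre, and [sigma * rho 0] bounds the distance from
    [a] to [R ^ n (a)]; on smaller circles around [a] the displacement may dominate. Then [eps] is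
    fixed by letting the linear and the polar term balance on the circle of radius [sigma * rho 0]:
    the derivative of [R] on [D 0] has absolute value [rho 1 / rho 0], whence
    [abs eps = sigma ^ 2 * rho 0 * rho 1]. On the other discs [z - a] has absolute value at least
    [rho 1] by the hypothesis on distances, so the perturbation is at most [sigma ^ 2 * rho 0],
    which the minimality of [rho 0] compares with every radius. The obstacle is that a component is
    a union over all affinoids, while [Q] is known explicitly only near the annuli. Injectivity of
    the iterates supplies the missing control: the denominator and the secant quotient of an iterate
    are compared on the annulus, and the comparison is carried across its boundary. Recurrence
    cannot come from compactness; it comes from units having powers close to [1] and from [p]-th
    iterates contracting small displacements. *)

Record nonarchAbs (RR : realType) (K : fieldType) := NonarchAbs {
  nonarch_fun :> K -> RR;
  nonarchP : is_nonarch_abs nonarch_fun }.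

Section NonarchAbs.
Context (RR : realType) (K : fieldType) (abs : nonarchAbs RR K).
Let na := nonarchP abs.
Implicit Types x y z : K.

Lemma abs_ge0 x : 0 <= abs x. Proof. exact: nonarch_abs_ge0. Qed.

Lemma absM x y : abs (x * y) = abs x * abs y. Proof. exact: nonarch_absM. Qed.

Lemma abs0 : abs 0 = 0. Proof. by apply/(nonarch_abs_eq0 na). Qed.

Lemma abs_eq0 x : (abs x == 0) = (x == 0).
Proof. by apply/eqP/eqP => /(nonarch_abs_eq0 na). Qed.

Lemma abs_gt0 x : (0 < abs x) = (x != 0).
Proof. by rewrite lt0r abs_eq0 abs_ge0 andbT. Qed.

Lemma abs1 : abs 1 = 1.
Proof.
have h : abs 1 != 0 by rewrite abs_eq0 oner_eq0.
by apply: (mulfI h); rewrite -absM !mulr1.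
Qed.

Lemma absN x : abs (- x) = abs x.
Proof.
have h : abs (-1) = 1.
  apply/eqP; rewrite -(@eqrXn2 _ 2) ?abs_ge0 ?ler01 //.
  by rewrite expr1n expr2 -absM mulrNN mulr1 abs1.
by rewrite -mulN1r absM h mul1r.
Qed.

Lemma absV x : abs x^-1 = (abs x)^-1.
Proof.
have [->|x0] := eqVneq x 0; first by rewrite invr0 abs0 invr0.
have h : abs x != 0 by rewrite abs_eq0.
by apply: (mulfI h); rewrite -absM !divff ?abs1.
Qed.

Lemma absX x n : abs (x ^+ n) = abs x ^+ n.
Proof. by elim: n => [|n IH]; rewrite ?expr0 ?abs1 // !exprS absM IH. Qed.

Lemma abs_distC x y : abs (x - y) = abs (y - x).
Proof. by rewrite -absN opprB. Qed.

Lemma absD_le x y e : abs x <= e -> abs y <= e -> abs (x + y) <= e.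
Proof. by move=> hx hy; apply: (le_trans (nonarch_absD na _ _)); rewrite ge_max hx. Qed.

Lemma absD_lt x y e : abs x < e -> abs y < e -> abs (x + y) < e.
Proof. by move=> hx hy; apply: (le_lt_trans (nonarch_absD na _ _)); rewrite gt_max hx. Qed.

Lemma absB_le x y e : abs x <= e -> abs y <= e -> abs (x - y) <= e.
Proof. by move=> hx hy; apply: absD_le; rewrite ?absN. Qed.

Lemma absB_lt x y e : abs x < e -> abs y < e -> abs (x - y) < e.
Proof. by move=> hx hy; apply: absD_lt; rewrite ?absN. Qed.

Lemma abs_dist_le y x z e : abs (x - y) <= e -> abs (y - z) <= e -> abs (x - z) <= e.
Proof. by move=> hx hy; rewrite -(subrKA y); exact: absD_le. Qed.

Lemma abs_dist_lt y x z e : abs (x - y) < e -> abs (y - z) < e -> abs (x - z) < e.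
Proof. by move=> hx hy; rewrite -(subrKA y); exact: absD_lt. Qed.

Lemma abs_domD x y : abs y < abs x -> abs (x + y) = abs x.
Proof.
move=> h; apply/eqP; rewrite eq_le absD_le ?(ltW h) //= leNgt; apply/negP => h1.
by have := absB_lt h1 h; rewrite addrK ltxx.
Qed.

Lemma abs_domB x y : abs y < abs x -> abs (x - y) = abs x.
Proof. by move=> h; rewrite abs_domD ?absN. Qed.

Lemma abs_eq_close x y : abs (x - y) < abs x -> abs y = abs x.
Proof. by move=> h; rewrite -[y](subKr x) abs_domB. Qed.

Lemma abs_dist_dom y x z : abs (x - y) < abs (y - z) -> abs (x - z) = abs (y - z).
Proof. by move=> h; rewrite -(subrKA y x) [X in abs X]addrC; exact: abs_domD. Qed.

Lemma abs_dist_domr y x z : abs (y - z) < abs (x - y) -> abs (x - z) = abs (x - y).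
Proof. by move=> h; rewrite -(subrKA y x); exact: abs_domD. Qed.

Lemma abs_prod_seq (I : Type) (s : seq I) (F : I -> K) :
  abs (\prod_(h <- s) F h) = \prod_(h <- s) abs (F h).
Proof. by elim: s => [|h s IH]; rewrite ?big_nil ?abs1 // !big_cons absM IH. Qed.

Lemma abs_nat n : abs n%:R <= 1.
Proof.
elim: n => [|n IH]; first by rewrite abs0 ler01.
by rewrite -addn1 natrD absD_le ?abs1.
Qed.

End NonarchAbs.

Ltac positivity := repeat match goal with
  | |- is_true (0 <= _ * _) => apply: mulr_ge0
  | |- is_true (0 <= _ ^-1) => rewrite invr_ge0
  | |- is_true (0 <= _ ^+ _) => apply: exprn_ge0
  | |- is_true (0 <= _) => first [done | exact: abs_ge0 | apply: ltW]
  | |- is_true (0 < _ * _) => apply: mulr_gt0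
  | |- is_true (0 < _ ^-1) => rewrite invr_gt0
  | |- is_true (0 < _ ^+ _) => apply: exprn_gt0
  | |- is_true (0 < _) => done
  end.

(** * Polynomials and their Newton polygons *)

(** What the construction takes from [Cp]. The field [padic_torsion] expresses that the nonzero
    residues form a torsion group, the residue field being algebraic over the field with [p]
    elements. *)
Record padicAbs (RR : realType) (p : nat) (K : fieldType) := PadicAbs {
  padic_nonarch :> nonarchAbs RR K;
  padic_root : forall P : {poly K}, (1 < size P)%N -> exists x, root P x;
  padic_char0 : forall n, n.+1%:R != 0 :> K;
  padic_p_gt0 : (0 < p)%N;
  padic_p_lt1 : padic_nonarch p%:R < 1;
  padic_torsion : forall c, padic_nonarch c = 1 ->
    exists2 M, (0 < M)%N & padic_nonarch (c ^+ M - 1) < 1 }.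

Lemma expr_small (RR : realType) (x e : RR) : 0 <= x < 1 -> 0 < e ->
  exists n, x ^+ n < e.
Proof.
move=> /andP[x0 x1] e0; have := @cvg_expr RR x.
rewrite ger0_norm // => /(_ x1) /cvgr0Pnorm_lt /(_ e e0) [N _ /(_ N (leqnn N))].
by rewrite /= ger0_norm ?exprn_ge0 // => h; exists N.
Qed.

Section Polynomials.
Context (RR : realType) (p : nat) (K : fieldType) (abs : padicAbs RR p K).
Implicit Types (x y z u a : K) (P S : {poly K}) (s t : RR).

(** The field is algebraically closed, so estimates of [abs P.[z]] can be proved one linear factor
    at a time, and no polygon of coefficients is ever formed. *)
Lemma poly_linear_ind (T : {poly K} -> Prop) :
  (forall c, c != 0 -> T c%:P) ->
  (forall h P, P != 0 -> T P -> T (P * ('X - h%:P))) ->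
  forall P, P != 0 -> T P.
Proof.
move=> Tc TX P; have [n] := ubnP (size P); elim: n P => // n IH P sP P0.
have [/size_poly1P[c c0 ->]|sP1] := boolP (size P == 1); first exact: Tc.
have [h /factor_theorem[Q defP]] : exists x, root P x.
  by apply: (padic_root abs); rewrite ltn_neqAle eq_sym sP1 size_poly_gt0.
have Q0 : Q != 0 by apply: contraNneq P0 => Q0; rewrite defP Q0 mul0r.
rewrite defP; apply: (TX) => //; apply: IH => //.
by rewrite defP size_Mmonic ?monicXsubC // size_XsubC addn2 /= in sP.
Qed.

Lemma abs_p_gt0 : 0 < abs p%:R.
Proof. by rewrite abs_gt0; case: p (padic_p_gt0 abs) => // m _;
  exact: padic_char0 abs m. Qed.

Lemma padic_nth_root k c : (0 < k)%N -> exists z, z ^+ k = c.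
Proof.
move=> k0; have [|z] := padic_root abs (P := 'X^k - c%:P).
  by rewrite size_XnsubC.
by move=> /rootP; rewrite !hornerE => /subr0_eq; exists z.
Qed.

(** Roots of [p] have absolute values arbitrarily close to [1], and the integral powers of one such
    root cannot all miss the interval. *)
Lemma abs_dense s t : 0 <= s -> s < t -> exists2 z, s < abs z & abs z < t.
Proof.
wlog s0 : s / 0 < s => [H|_ st].
  rewrite le0r => /orP[/eqP ->|s0]; last exact: H (ltW _).
  move=> t0; have t2 : 0 < t / 2 by rewrite divr_gt0.
  have [//||z z1 z2] := H (t / 2) _ (ltW t2).
    by rewrite ltr_pdivrMr // mulr_natr mulr2n ltrDl.
  by exists z => //; apply: lt_trans z1.
have t0 := lt_trans s0 st.
(* With this exponent a root [y] of [p] satisfies [s / t < abs y < 1], so consecutive powers of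
   [abs y] cannot jump over the interval from [s] to [t]. *)
have [k] : exists k, (s / t) ^+ k < abs p%:R.
  apply: expr_small abs_p_gt0.
  by rewrite divr_ge0 ?(ltW s0) ?(ltW t0) //= ltr_pdivrMr // mul1r.
case: k => [|k sk]; first by rewrite expr0 ltNge ltW ?padic_p_lt1.
have [y yk] := @padic_nth_root k.+1 p%:R isT.
have yp : abs y ^+ k.+1 = abs p%:R by rewrite -absX yk.
have y1 : abs y < 1.
  by rewrite -(@expr_lt1 _ k.+1) ?abs_ge0 // yp padic_p_lt1.
have uy : s / t < abs y.
  rewrite ltNge; apply/negP => h; move: sk; rewrite ltNge -yp => /negP; apply.
  by rewrite lerXn2r // ?nnegrE ?abs_ge0 // divr_ge0 // ltW.
have y0 : 0 < abs y by apply: le_lt_trans uy; rewrite divr_ge0 // ltW.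
have [m ym] : exists m, abs y ^+ m < t^-1.
  by apply: expr_small; rewrite ?invr_gt0 // y1 abs_ge0.
have ex : exists i, abs y ^- m * abs y ^+ i < t.
  have [i yi] : exists i, abs y ^+ i < abs y ^+ m * t.
    by apply: expr_small; rewrite ?mulr_gt0 ?exprn_gt0 // y1 abs_ge0.
  by exists i; rewrite mulrC ltr_pdivrMr ?exprn_gt0 // mulrC.
case: (ex_minnP ex) => -[|i] hi mini.
  move: hi; rewrite mulr1 ltNge => /negP[].
  by rewrite -[t]invrK lef_pV2 ?posrE ?exprn_gt0 ?invr_gt0 // ltW.
exists (y ^- m * y ^+ i.+1); rewrite absM absV !absX //.
have hi' : t <= abs y ^- m * abs y ^+ i.
  by rewrite leNgt; apply/negP => /mini; rewrite ltnn.
rewrite exprSr mulrA; apply: lt_le_trans (ler_wpM2r (abs_ge0 abs y) hi').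
by rewrite mulrC -ltr_pdivrMr.
Qed.

(** The logarithmic derivative at [u] is a sum of terms [1 / (u - h)] over the roots [h], all at
    distance at least [r]; this is the same bound in finite form. *)
Lemma noroot_lip P u r : P != 0 -> 0 < r ->
  (forall z, abs (z - u) < r -> P.[z] != 0) ->
  forall z, abs (z - u) < r -> abs (P.[z] - P.[u]) <= abs (z - u) / r * abs P.[u].
Proof.
move=> P0 r0; move: P P0; apply: poly_linear_ind => [c c0 _ z _|h P P0 IH nz z zu].
  by rewrite !hornerC subrr abs0 // !mulr_ge0 ?invr_ge0 ?abs_ge0 ?ltW.
have uh : r <= abs (u - h).
  rewrite leNgt; apply/negP => hu; have := nz h; rewrite abs_distC // => /(_ hu).
  by rewrite hornerM hornerXsubC subrr mulr0 eqxx.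
have nP w : abs (w - u) < r -> P.[w] != 0.
  by move=> /nz; apply: contraNneq => hw; rewrite hornerM hw mul0r.
have {IH} := IH nP z zu; rewrite !hornerM !hornerXsubC !absM // => IH.
have -> : P.[z] * (z - h) - P.[u] * (u - h) =
  (P.[z] - P.[u]) * (z - h) + P.[u] * (z - u) by ring.
have zh : abs (z - h) = abs (u - h) by apply: abs_dist_dom; apply: lt_le_trans uh.
apply: absD_le => //; rewrite absM //.
  by rewrite zh mulrA ler_wpM2r ?abs_ge0.
rewrite mulrCA ler_wpM2l ?abs_ge0 // mulrAC ler_pdivlMr //.
by rewrite ler_wpM2l ?abs_ge0.
Qed.

Lemma noroot_const P u r : 0 < r ->
  (forall z, abs (z - u) < r -> P.[z] != 0) ->
  forall z, abs (z - u) < r -> abs P.[z] = abs P.[u].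
Proof.
move=> r0 nz z zu.
have P0 : P != 0.
  by apply: contraTneq (nz u _) => [->|]; rewrite ?horner0 ?eqxx ?subrr ?abs0.
have nu : 0 < abs P.[u] by rewrite abs_gt0 // nz // subrr abs0.
apply: abs_eq_close; rewrite abs_distC.
apply: le_lt_trans (noroot_lip P0 r0 nz zu) _.
by rewrite gtr_pMl // ltr_pdivrMr // mul1r.
Qed.

(* The Newton polygon of [P] around the ball of radius [r]: on either side of
   [r], [abs P.[z]] is a monomial in the distance to the centre. *)
Lemma newton_profile P a r : P != 0 -> 0 < r ->
  exists c (k : nat) r1,
  [/\ 0 < c, r < r1,
      forall z, r < abs (z - a) -> abs (z - a) < r1 -> abs P.[z] = c * abs (z - a) ^+ k,
      forall z, abs (z - a) <= r -> (forall w, abs (w - z) < r -> P.[w] != 0) ->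
        abs P.[z] = c * r ^+ k
    & forall u, abs (u - a) <= r -> exists r2 (l : nat),
        [/\ 0 <= r2, r2 < r,
         forall z, r2 < abs (z - u) -> abs (z - u) < r ->
           abs P.[z] = c * r ^+ k * (abs (z - u) / r) ^+ l
        & P.[u] = 0 -> (0 < l)%N]].
Proof.
move=> P0 r0; move: P P0; apply: poly_linear_ind => [c c0|h P P0].
  exists (abs c), 0%N, (r + 1); split; rewrite ?abs_gt0 ?ltrDl //.
  - by move=> z _ _; rewrite hornerC mulr1.
  - by move=> z _ _; rewrite hornerC mulr1.
  move=> u _; exists 0, 0%N; split => // [z _ _|]; first by rewrite hornerC !mulr1.
  by rewrite hornerC => c0'; rewrite c0' eqxx in c0.
move=> [c [k [r1 [c0 rr1 out gen ins]]]].
(* A root in the ball contributes the distance to [a] and raises [k]; one outside contributes the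
   constant [abs (h - a)] and may shorten the range [r1]. *)
have [hr|hr] := leP (abs (h - a)) r.
- exists c, k.+1, r1; split => //.
  + move=> z z1 z2; rewrite hornerM hornerXsubC absM // out // exprSr mulrA.
    congr (_ * _); apply: (@abs_dist_domr _ _ _ a).
    by rewrite abs_distC; apply: le_lt_trans z1.
  + move=> z za nz; rewrite hornerM hornerXsubC absM // gen //; last first.
      by move=> w /nz; apply: contraNneq => hw; rewrite hornerM hw mul0r.
    rewrite exprSr mulrA; congr (_ * _); apply/eqP; rewrite eq_le; apply/andP; split.
      by apply: (abs_dist_le za); rewrite abs_distC.
    rewrite leNgt; apply/negP; rewrite abs_distC // => /nz.
    by rewrite hornerM hornerXsubC subrr mulr0 eqxx.
  + move=> u ua; have [r2 [l [r20 r2r uP ul]]] := ins u ua.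
    have [hu|hu] := ltP (abs (h - u)) r.
    * exists (Num.max r2 (abs (h - u))), l.+1; split => //.
      - by rewrite le_max r20.
      - by rewrite gt_max r2r.
      - move=> z; rewrite gt_max => /andP[z1 z2] z3.
        rewrite hornerM hornerXsubC absM // uP // !exprSr.
        rewrite (@abs_dist_domr _ _ _ u z h) 1?[abs (u - h)]abs_distC //.
        by field; rewrite gt_eqF.
    * exists r2, l; split => //.
      - move=> z z1 z2; rewrite hornerM hornerXsubC absM // uP //.
        have -> : abs (z - h) = r.
          have hur : abs (u - h) = r.
            apply/eqP; rewrite eq_le [X in _ && (_ <= X)]abs_distC // hu andbT.
            by apply: (abs_dist_le ua); rewrite abs_distC.
          by rewrite -hur; apply: abs_dist_dom; rewrite hur.
        by rewrite exprSr; ring.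
      - rewrite hornerM hornerXsubC => /eqP; rewrite mulf_eq0 => /orP[/eqP//|/eqP uh].
        by move: hu; rewrite -opprB uh absN // abs0 // leNgt r0.
- exists (c * abs (h - a)), k, (Num.min r1 (abs (h - a))); split.
  + by rewrite mulr_gt0 // (le_lt_trans _ hr) // ltW.
  + by rewrite lt_min rr1.
  + move=> z z1; rewrite lt_min => /andP[z2 z3].
    rewrite hornerM hornerXsubC absM // out //.
    rewrite (@abs_dist_dom _ _ _ a z h) 1?[abs (a - h)]abs_distC //; ring.
  + move=> z za nz; rewrite hornerM hornerXsubC absM // gen //; last first.
      by move=> w /nz; apply: contraNneq => hw; rewrite hornerM hw mul0r.
    rewrite (@abs_dist_dom _ _ _ a z h) 1?[abs (a - h)]abs_distC //;
      last exact: le_lt_trans hr.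
    ring.
  + move=> u ua; have [r2 [l [r20 r2r uP ul]]] := ins u ua.
    exists r2, l; split => //.
      move=> z z1 z2; rewrite hornerM hornerXsubC absM // uP //.
      have za : abs (z - a) <= r by apply: (abs_dist_le (ltW z2)).
      rewrite (@abs_dist_dom _ _ _ a z h) 1?[abs (a - h)]abs_distC //;
        last exact: le_lt_trans hr.
      ring.
    rewrite hornerM hornerXsubC => /eqP; rewrite mulf_eq0 => /orP[/eqP//|/eqP uh].
    by move: hr; rewrite -(subr0_eq uh) ltNge ua.
Qed.

Lemma noroot_near P u r : P != 0 -> 0 < r ->
  exists z, [/\ z != u, abs (z - u) < r & P.[z] != 0].
Proof.
move=> P0 r0; have [c [k [r1 [c0 _ _ _ /(_ u)]]]] := newton_profile u P0 r0.
rewrite subrr abs0 ltW // => /(_ isT) [r2 [l [r20 r2r Pz _]]].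
have [d d1 d2] := abs_dense r20 r2r; have d0 := le_lt_trans r20 d1.
have E : u + d - u = d by ring.
exists (u + d); rewrite -subr_eq0 E -!(abs_gt0 abs); split => //.
by rewrite Pz E // !(mulr_gt0, exprn_gt0, invr_gt0).
Qed.

(** A root at [w] would make [abs P.[z]] proportional to a positive power of the distance to [w] on
    some annulus, and such a power differs at two radii of the value group. *)
Lemma abs_const_neq0 P w r C : 0 < r -> 0 < C ->
  (forall z, z != w -> abs (z - w) < r -> abs P.[z] = C) -> P.[w] != 0.
Proof.
move=> r0 C0 PC; apply/eqP => Pw.
have P0 : P != 0.
  have [d d0 dr] := abs_dense (lexx 0) r0; have E : w + d - w = d by ring.
  apply: contraTneq C0 => P0; rewrite -(PC (w + d)) ?E ?P0 ?horner0 ?abs0 ?ltxx //.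
  by rewrite -subr_eq0 E -(abs_gt0 abs).
have [c [k [r1 [c0 _ _ _ /(_ w)]]]] := newton_profile w P0 r0.
rewrite subrr abs0 ltW // => /(_ isT) [r2 [l [r20 r2r Pz /(_ Pw) l0]]].
have [x r2x xr] := abs_dense r20 r2r; have [y xy yr] := abs_dense (abs_ge0 abs x) xr.
have val d : r2 < abs d -> abs d < r -> C = c * r ^+ k * (abs d / r) ^+ l.
  move=> d1 d2; have E : w + d - w = d by ring.
  rewrite -[abs d]/(abs d) -{1}E -Pz ?E // PC ?E // -subr_eq0 E -(abs_gt0 abs).
  exact: le_lt_trans d1.
have := val _ r2x xr; rewrite (val _ (lt_trans r2x xy) yr) => /mulfI.
rewrite mulf_neq0 ?expf_neq0 ?gt_eqF // => /(_ isT) /eqP.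
rewrite eqrXn2 ?divr_ge0 ?abs_ge0 ?(ltW r0) // => /eqP /(mulIf (invr_neq0 (lt0r_neq0 r0))) E.
by rewrite E ltxx in xy.
Qed.

Lemma monomial_eq a r r1 A B k l : 0 < r -> r < r1 -> 0 < A ->
  (forall z, r < abs (z - a) -> abs (z - a) < r1 ->
     A * abs (z - a) ^+ k = B * abs (z - a) ^+ l) ->
  k = l /\ A = B.
Proof.
move=> r0 rr1 A0 AB.
have [x rx xr1] := abs_dense (ltW r0) rr1; have [y ry yx] := abs_dense (ltW r0) rx.
have x0 := lt_trans r0 rx; have y0 := lt_trans r0 ry.
have ABx : A * abs x ^+ k = B * abs x ^+ l by have := AB (a + x);
  rewrite [a + x]addrC addrK; exact.
have ABy : A * abs y ^+ k = B * abs y ^+ l.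
  by have := AB (a + y); rewrite [a + y]addrC addrK; apply => //; apply: lt_trans xr1.
have B0 : 0 < B.
  by have := mulr_gt0 A0 (exprn_gt0 k x0); rewrite ABx pmulr_lgt0 ?exprn_gt0.
have E : (abs x / abs y) ^+ k = (abs x / abs y) ^+ l.
  rewrite !expr_div_n; apply/eqP; rewrite eqr_div ?lt0r_neq0 ?exprn_gt0 //.
  have AB0 : A * B != 0 by rewrite mulf_neq0 ?gt_eqF.
  by apply/eqP; apply: (mulfI AB0); rewrite mulrACA ABx -ABy; ring.
have kl : k = l.
  have q1 : 1 < abs x / abs y by rewrite ltr_pdivlMr // mul1r.
  by apply: (ieexprIn (lt_trans ltr01 q1)) E; rewrite gt_eqF.
by split => //; apply: (mulIf (lt0r_neq0 (exprn_gt0 k x0))); rewrite ABx kl.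
Qed.

(* A root of [\prod_b ('X - b) - c ^+ k] with [abs c = r] lies in the ball, at
   distance exactly [r] of each [b]: the residue field is infinite. *)
Lemma ball_avoid a c (bs : seq K) : c != 0 ->
  exists2 z, abs (z - a) <= abs c & forall b, b \in bs -> abs c <= abs (z - b).
Proof.
move=> c0; have rc0 : 0 < abs c by rewrite abs_gt0.
wlog bsa : bs / forall b, b \in bs -> abs (b - a) <= abs c.
  move=> H; have [b|z za zb] := H [seq b <- bs | abs (b - a) <= abs c].
    by rewrite mem_filter => /andP[].
  exists z => // b bbs; have [ba|ba] := leP (abs (b - a)) (abs c).
    by apply: zb; rewrite mem_filter ba.
  rewrite (@abs_dist_dom _ _ _ a z b) 1?[abs (a - b)]abs_distC ?(ltW ba) //.
  exact: le_lt_trans ba.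
have [z zP] : exists z, \prod_(b <- a :: bs) (z - b) = c ^+ (size bs).+1.
  have [|z] := padic_root abs (P := \prod_(b <- a :: bs) ('X - b%:P) - (c ^+ (size bs).+1)%:P).
    by rewrite size_polyDl ?size_prod_XsubC // size_polyN size_polyC expf_neq0.
  move=> /rootP; rewrite hornerD hornerN hornerC horner_prod => /subr0_eq <-.
  by exists z; apply: eq_bigr => b _; rewrite hornerXsubC.
have absP : \prod_(b <- a :: bs) abs (z - b) = abs c ^+ (size bs).+1.
  by rewrite -absX -zP abs_prod_seq.
have zb b : b \in a :: bs -> abs (b - a) <= abs c.
  by rewrite inE => /orP[/eqP ->|/bsa //]; rewrite subrr abs0 ltW.
have za : abs (z - a) <= abs c.
  rewrite leNgt; apply/negP => za; move: absP.
  have -> : \prod_(b <- a :: bs) abs (z - b) = \prod_(b <- a :: bs) abs (z - a).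
    rewrite !big_seq; apply: eq_bigr => b /zb ba.
    by apply: abs_dist_domr; rewrite abs_distC; apply: le_lt_trans za.
  rewrite big_const_seq count_predT iter_mulr_1 /= => /eqP.
  by rewrite eqrXn2 ?abs_ge0 // gt_eqF.
exists z => // b bbs.
have prod_le (s : seq K) : {subset s <= a :: bs} ->
    \prod_(b <- s) abs (z - b) <= abs c ^+ size s.
  elim: s => [|b' s IH] sb; first by rewrite big_nil.
  rewrite big_cons exprS; apply: ler_pM.
  - exact: abs_ge0.
  - by apply: prodr_ge0 => i _; exact: abs_ge0.
  - by apply: (abs_dist_le za); rewrite abs_distC zb // sb // mem_head.
  - by apply: IH => b'' hb; apply: sb; rewrite inE hb orbT.
rewrite leNgt; apply/negP => zbc; move: absP.
have bin : b \in a :: bs by rewrite inE bbs orbT.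
rewrite (perm_big _ (perm_to_rem bin)) big_cons => /eqP; rewrite lt_eqF //.
rewrite exprS; have -> : size bs = size (rem b (a :: bs)) by rewrite size_rem.
apply: le_lt_trans (_ : abs (z - b) * abs c ^+ size (rem b (a :: bs)) < _).
  by rewrite ler_wpM2l ?abs_ge0 // prod_le // => b'; apply: mem_rem.
by rewrite ltr_pM2r ?exprn_gt0.
Qed.

End Polynomials.

(** * Rational functions on discs *)

Definition proj_point (K : fieldType) (x y : K) : proj_line K :=
  if y == 0 then None else Some (x / y).

(* The restriction to the affine line of a rational map, given by homogeneous
   coordinates without common zeros. *)
Definition ratlike (K : fieldType) (f : K -> proj_line K) : Prop :=
  exists P S : {poly K},
    [/\ forall z, P.[z] = 0 -> S.[z] != 0 & forall z, f z = proj_point P.[z] S.[z]].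

(* The finite values of [f], with junk value [0] at the poles. *)
Definition finval (K : fieldType) (f : K -> proj_line K) (z : K) : K := odflt 0 (f z).

Lemma proj_point_eq (K : fieldType) (x y x' y' : K) :
  (x = 0 -> y != 0) -> (x' = 0 -> y' != 0) ->
  proj_point x y = proj_point x' y' <-> x * y' - x' * y = 0.
Proof.
move=> n n'; rewrite /proj_point; case: eqP => [y0|/eqP y0]; case: eqP => [y'0|/eqP y'0].
- by rewrite y0 y'0 !mulr0 subr0.
- rewrite y0 mulr0 subr0; split=> // /eqP; rewrite mulf_eq0 (negPf y'0) orbF => /eqP /n.
  by rewrite y0 eqxx.
- rewrite y'0 mulr0 sub0r; split=> // /eqP; rewrite oppr_eq0 mulf_eq0 (negPf y0) orbF.
  by move=> /eqP /n'; rewrite y'0 eqxx.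
- split=> [[] /eqP|/eqP]; first by rewrite eqr_div // => /eqP ->; rewrite subrr.
  by rewrite subr_eq0 => h; congr Some; apply/eqP; rewrite eqr_div.
Qed.

Section RationalMaps.
Context (RR : realType) (p : nat) (K : fieldType) (abs : padicAbs RR p K).
Implicit Types (x y z u a : K) (P S : {poly K}) (f : K -> proj_line K) (X : set K).

Lemma deriv_eq0_const P : P^`() = 0 -> exists c, P = c%:P.
Proof.
move=> P0; exists P`_0; apply/polyP => -[|i]; rewrite coefC //=.
have := congr1 (fun q : {poly K} => q`_i) P0; rewrite /= coef_deriv coef0 => /eqP.
by rewrite -mulr_natr mulf_eq0 (negPf (padic_char0 abs i)) orbF => /eqP.
Qed.

Lemma no_common_root_coprime P S : (forall z, P.[z] = 0 -> S.[z] != 0) -> coprimep P S.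
Proof.
move=> PS; rewrite coprimep_def; apply/negPn/negP => g1.
have nz : gcdp P S != 0.
  rewrite gcdp_eq0; apply/negP => /andP[/eqP P0 /eqP S0].
  by have := PS 0; rewrite P0 S0 !horner0 eqxx => /(_ erefl).
have [z] : exists z, root (gcdp P S) z.
  by apply: (padic_root abs); rewrite ltn_neqAle eq_sym g1 size_poly_gt0.
rewrite root_gcd => /andP[/rootP/PS + /rootP S0].
by rewrite S0 eqxx.
Qed.

(** If the Wronskian vanishes, [S] divides [P * S^]()[, hence]S^[()] by coprimality, so [S^]()[is
    zero for reasons of degree, and then so is]P^[()]. In characteristic zero both polynomials are
    constant. *)
Lemma wronskian_neq0 P S z w :
  (forall z, P.[z] = 0 -> S.[z] != 0) ->
  proj_point P.[z] S.[z] <> proj_point P.[w] S.[w] ->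
  P^`() * S - P * S^`() != 0.
Proof.
move=> PS nc; apply/eqP => /subr0_eq W.
have S0 : S != 0 by apply/eqP => S0; apply: nc; rewrite /proj_point S0 !horner0 eqxx.
have [d dS] : exists d, S = d%:P.
  apply: deriv_eq0_const; apply/eqP; apply/negPn/negP => dS0.
  have : S %| P * S^`() by rewrite -W dvdp_mull.
  rewrite Gauss_dvdpr; last by rewrite coprimep_sym no_common_root_coprime.
  by move=> /(dvdp_leq dS0); rewrite leqNgt lt_size_deriv.
have [c cP] : exists c, P = c%:P.
  apply: deriv_eq0_const; move: W; rewrite {2}dS derivC mulr0 => /eqP.
  by rewrite mulf_eq0 (negPf S0) orbF => /eqP.
by apply: nc; rewrite cP dS !hornerC.
Qed.

(** [T] is the divided difference at [w] cleared of denominators. Its zeros are the other points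
    with the same image as [w], and [w] itself when [w] is critical. *)
Lemma secant_quotient P S w : exists T : {poly K},
  (forall z, P.[z] * S.[w] - P.[w] * S.[z] = T.[z] * (z - w)) /\
  T.[w] = (P^`() * S - P * S^`()).[w].
Proof.
have [|T TE] := factor_theorem (P * S.[w]%:P - P.[w]%:P * S) w _.
  by rewrite rootE !hornerE subrr.
exists T; split.
  move=> z; have := congr1 (fun q : {poly K} => q.[z]) TE.
  by rewrite !hornerE => ->.
have := congr1 (fun q : {poly K} => q^`().[w]) TE.
rewrite derivB !derivM !derivC derivXsubC !hornerE.
by rewrite subrr mulr0 add0r.
Qed.

Lemma secant_abs P S T z w : S.[z] != 0 -> S.[w] != 0 ->
  P.[z] * S.[w] - P.[w] * S.[z] = T.[z] * (z - w) ->
  abs (P.[z] / S.[z] - P.[w] / S.[w]) =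
  abs T.[z] * abs (z - w) / (abs S.[z] * abs S.[w]).
Proof.
move=> z0 w0 E; rewrite -!absM -absV -absM -E; congr (abs _); field.
by rewrite z0 w0.
Qed.

(** For noncritical [w], injectivity leaves the secant quotient without zeros in the disc, so it and
    the denominator have constant absolute value there. Critical points are bypassed through
    noncritical ones arbitrarily close to them. *)
Lemma disc_injective_similarity f u r : 0 < r -> ratlike f ->
  (forall z, abs (z - u) < r -> f z = Some (finval f z)) ->
  (forall z w, abs (z - u) < r -> abs (w - u) < r -> f z = f w -> z = w) ->
  exists2 k, 0 < k & forall z w, abs (z - u) < r -> abs (w - u) < r ->
    abs (finval f z - finval f w) = k * abs (z - w).
Proof.
move=> r0 [P [S [PS fE]]] fin inj.
have fS z : abs (z - u) < r -> S.[z] != 0.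
  by move=> /fin; rewrite fE /proj_point; case: eqP.
have fv z : abs (z - u) < r -> finval f z = P.[z] / S.[z].
  by move=> /fS Sz; rewrite /finval fE /proj_point (negPf Sz).
have Sc z : abs (z - u) < r -> abs S.[z] = abs S.[u] by apply: noroot_const.
have uu : abs (u - u) < r by rewrite subrr abs0.
set W := P^`() * S - P * S^`().
have W0 : W != 0.
  have [z z1 z2] := abs_dense abs (lexx 0) r0.
  apply: (@wronskian_neq0 _ _ u (u + z)) => //; rewrite -!fE => /inj.
  have E : u + z - u = z by ring.
  rewrite E => /(_ uu z2) /eqP; rewrite -subr_eq0 -oppr_eq0 opprB E.
  by rewrite -(abs_eq0 abs) gt_eqF.
have ncrit w : abs (w - u) < r -> W.[w] != 0 ->
    exists2 k, 0 < k & forall z, abs (z - u) < r ->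
      abs (finval f z - finval f w) = k * abs (z - w).
  move=> wu Ww; have [T [TE Tw]] := secant_quotient P S w.
  have wcE z : (abs (z - w) < r) = (abs (z - u) < r).
    apply/idP/idP => h; first exact: abs_dist_lt wu.
    by apply: (abs_dist_lt h); rewrite abs_distC.
  have Tnz z : abs (z - w) < r -> T.[z] != 0.
    rewrite wcE => zu; have [->|zw] := eqVneq z w; first by rewrite Tw.
    apply: contraNneq zw => Tz; apply/eqP/inj => //; rewrite !fE.
    by apply/proj_point_eq; [exact: PS|exact: PS|rewrite TE Tz mul0r].
  exists (abs T.[w] / (abs S.[u] * abs S.[u])).
    by rewrite !(mulr_gt0, invr_gt0) ?abs_gt0 ?fS ?Tnz // subrr abs0.
  move=> z zu; rewrite !fv // (secant_abs _ _ (TE z)) ?fS // !Sc //.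
  by rewrite (noroot_const r0 Tnz) ?wcE // mulrAC.
have [w0 [_ w0u Ww0]] := noroot_near abs u W0 r0.
have [k k0 kE] := ncrit _ w0u Ww0; exists k => // z w zu wu.
(* The distance between the images of [w'] and [w0], computed from either end, shows that the ratio
   is the same at all noncritical points. *)
have kE' w' : abs (w' - u) < r -> W.[w'] != 0 -> forall z, abs (z - u) < r ->
    abs (finval f z - finval f w') = k * abs (z - w').
  move=> w'u Ww'; have [k' k'0 kE'] := ncrit _ w'u Ww'.
  have [->|ww] := eqVneq w' w0; first exact: kE.
  suff -> : k = k' by [].
  have := kE' _ w0u; rewrite abs_distC kE // abs_distC => /mulIf; apply.
  by rewrite abs_eq0 subr_eq0 eq_sym.
have [->|zw] := eqVneq z w; first by rewrite !subrr abs0 mulr0.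
have zw0 : 0 < abs (z - w) by rewrite abs_gt0 subr_eq0.
have [w' [_ w'w Ww']] := noroot_near abs w W0 zw0.
have w'u : abs (w' - u) < r.
  apply: (abs_dist_lt (lt_le_trans w'w _) wu); apply: ltW.
  by apply: (abs_dist_lt zu); rewrite abs_distC.
have E : abs (z - w) = abs (z - w') by symmetry; apply: abs_dist_domr; rewrite abs_distC.
rewrite E -kE' //; apply: abs_dist_domr; rewrite abs_distC !kE' // ltr_pM2l //.
by rewrite -E abs_distC.
Qed.

(** If [c] were omitted, [P - c S] would have no zero and [abs (f z - c)] would be constant on the
    disc; but [f] also takes values farther from [f u] than [c] is. *)
Lemma disc_onto f u r k : 0 < r -> 0 < k -> ratlike f ->
  (forall z, abs (z - u) < r -> f z = Some (finval f z)) ->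
  (forall z w, abs (z - u) < r -> abs (w - u) < r ->
    abs (finval f z - finval f w) = k * abs (z - w)) ->
  forall c, abs (c - finval f u) < k * r -> exists2 z, abs (z - u) < r & f z = Some c.
Proof.
move=> r0 k0 [P [S [PS fE]]] fin sim c cu.
have fS z : abs (z - u) < r -> S.[z] != 0.
  by move=> /fin; rewrite fE /proj_point; case: eqP.
have fv z : abs (z - u) < r -> finval f z = P.[z] / S.[z].
  by move=> /fS Sz; rewrite /finval fE /proj_point (negPf Sz).
have Sc z : abs (z - u) < r -> abs S.[z] = abs S.[u] by apply: noroot_const.
have uu : abs (u - u) < r by rewrite subrr abs0.
have [[z zu Pz]|nz] := pselect (exists2 z, abs (z - u) < r & (P - c%:P * S).[z] = 0).
  exists z => //; rewrite fE /proj_point (negPf (fS _ zu)); congr Some.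
  move: Pz; rewrite !hornerE => /subr0_eq ->.
  by rewrite mulfK ?fS.
have Pnz z : abs (z - u) < r -> (P - c%:P * S).[z] != 0.
  by move=> zu; apply/eqP => h; apply: nz; exists z.
have Pc z : abs (z - u) < r -> abs (finval f z - c) = abs (finval f u - c).
  move=> zu; have E w : abs (w - u) < r ->
      abs (finval f w - c) = abs (P - c%:P * S).[w] / abs S.[u].
    move=> wu; rewrite -(Sc w) // -absV -absM fv // !hornerE; congr (abs _).
    by field; rewrite fS.
  by rewrite !E // (noroot_const r0 Pnz).
have [d d1 d2] : exists2 d, abs (c - finval f u) / k < abs d & abs d < r.
  by apply: abs_dense; rewrite ?divr_ge0 ?abs_ge0 ?(ltW k0) // ltr_pdivrMr // mulrC.
have E : u + d - u = d by ring.
have := Pc (u + d); rewrite E => /(_ d2).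
have h : abs (finval f (u + d) - finval f u) = k * abs d by rewrite sim ?E.
have h2 : abs (finval f u - c) < k * abs d by rewrite abs_distC mulrC -ltr_pdivrMr.
by rewrite (@abs_dist_domr _ _ _ (finval f u)) h // => h'; rewrite -h' ltxx in h2.
Qed.

(** The difference quotient [G z w] is, in [z], a quotient of polynomials without zeros in the disc,
    so [noroot_lip] bounds its variation by [s / r] times its size. It is symmetric, hence both
    arguments can be varied in turn, and [c] is one of its values. *)
Lemma disc_lipschitz f u r k s : 0 < r -> 0 < k -> ratlike f ->
  (forall z, abs (z - u) < r -> f z = Some (finval f z)) ->
  (forall z w, abs (z - u) < r -> abs (w - u) < r ->
    abs (finval f z - finval f w) = k * abs (z - w)) ->
  0 <= s -> s < r -> exists2 c, abs c = k &
    forall z w, abs (z - u) <= s -> abs (w - u) <= s ->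
      abs (finval f z - finval f w - c * (z - w)) <= s / r * k * abs (z - w).
Proof.
move=> r0 k0 [P [S [PS fE]]] fin sim s0 sr.
have fS z : abs (z - u) < r -> S.[z] != 0.
  by move=> /fin; rewrite fE /proj_point; case: eqP.
have fv z : abs (z - u) < r -> finval f z = P.[z] / S.[z].
  by move=> /fS Sz; rewrite /finval fE /proj_point (negPf Sz).
have uu : abs (u - u) < r by rewrite subrr abs0.
pose G z w := (finval f z - finval f w) / (z - w).
have absG z w : abs (z - u) < r -> abs (w - u) < r -> z != w -> abs (G z w) = k.
  move=> zu wu zw; rewrite absM absV sim // mulfK // abs_eq0 subr_eq0 //.
have GC z w : G z w = G w z by rewrite /G -[in RHS](opprB z w) invrN mulrN -mulNr opprB.
have Glip z z' w : abs (z - u) <= s -> abs (z' - u) <= s -> abs (w - u) <= s ->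
    z != w -> z' != w -> abs (G z w - G z' w) <= s / r * k.
  move=> zu z'u wu zw z'w.
  have [zu' z'u' wu'] : [/\ abs (z - u) < r, abs (z' - u) < r & abs (w - u) < r].
    by split; exact: le_lt_trans sr.
  have [T [TE Tw]] := secant_quotient P S w.
  have GE z1 : abs (z1 - u) < r -> z1 != w -> G z1 w = T.[z1] / (S.[z1] * S.[w]).
    move=> z1u z1w; rewrite /G !fv //.
    have -> : P.[z1] / S.[z1] - P.[w] / S.[w] = T.[z1] * (z1 - w) / (S.[z1] * S.[w]).
      by rewrite -TE; field; rewrite !fS.
    by field; rewrite subr_eq0 z1w !fS.
  have Sw : 0 < abs S.[w] by rewrite abs_gt0 fS.
  have Sc z1 : abs (z1 - u) < r -> abs S.[z1] = abs S.[w].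
    by move=> z1u; rewrite !(noroot_const r0 fS).
  have absT z1 : abs (z1 - u) < r -> z1 != w -> abs T.[z1] = k * abs S.[w] ^+ 2.
    move=> z1u z1w; rewrite -(absG _ _ z1u wu' z1w) GE // absM absV absM Sc //.
    by field; rewrite gt_eqF.
  have wcE z1 : (abs (z1 - w) < r) = (abs (z1 - u) < r).
    apply/idP/idP => h; first exact: abs_dist_lt wu'.
    by apply: (abs_dist_lt h); rewrite abs_distC.
  have kS : 0 < k * abs S.[w] ^+ 2 by rewrite mulr_gt0 ?exprn_gt0.
  (* At [w] the quotient is undefined, but its numerator has constant absolute value around [w] and
     therefore does not vanish there. *)
  have Tnz z1 : abs (z1 - w) < r -> T.[z1] != 0.
    rewrite wcE => z1u; have [->|z1w] := eqVneq z1 w; last first.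
      by rewrite -(abs_gt0 abs) absT.
    by apply: (abs_const_neq0 (abs := abs) r0 kS) => z2 z2w; rewrite wcE => z2u;
      apply: absT.
  have z'cE z1 : (abs (z1 - z') < r) = (abs (z1 - u) < r).
    apply/idP/idP => h; first exact: abs_dist_lt z'u'.
    by apply: (abs_dist_lt h); rewrite abs_distC.
  have lip (Q : {poly K}) : (forall z1, abs (z1 - u) < r -> Q.[z1] != 0) ->
      abs (Q.[z] - Q.[z']) <= s / r * abs Q.[z'].
    move=> Qnz; have Q0 : Q != 0.
      by apply: contraNneq (Qnz _ uu) => ->; rewrite horner0.
    have Qnz' z1 : abs (z1 - z') < r -> Q.[z1] != 0 by rewrite z'cE; apply: Qnz.
    have := noroot_lip Q0 r0 Qnz'; move=> /(_ z); rewrite z'cE => /(_ zu') /le_trans; apply.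
    rewrite ler_wpM2r ?abs_ge0 // ler_wpM2r ?invr_ge0 ?(ltW r0) //.
    by apply: (abs_dist_le zu); rewrite abs_distC.
  have -> : G z w - G z' w = ((T.[z] - T.[z']) * S.[z'] - T.[z'] * (S.[z] - S.[z'])) /
      (S.[z] * S.[z'] * S.[w]).
    by rewrite !GE //; field; rewrite !fS.
  rewrite absM absV !absM !Sc // ler_pdivrMr ?mulr_gt0 //.
  have -> : s / r * k * (abs S.[w] * abs S.[w] * abs S.[w]) =
      s / r * (k * abs S.[w] ^+ 2) * abs S.[w] by ring.
  apply: absB_le; rewrite absM -(absT z') //.
    rewrite Sc // ler_wpM2r ?abs_ge0 //; apply: lip => z1.
    by rewrite -wcE; apply: Tnz.
  have := lip S fS; rewrite Sc // => h.
  by rewrite [leRHS](_ : _ = abs T.[z'] * (s / r * abs S.[w])) ?ler_wpM2l ?abs_ge0 //; ring.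
have [s00|s_gt0] : s = 0 \/ 0 < s by move: s0; rewrite le0r => /orP[/eqP|]; [left|right].
  have [d d0 dr] := abs_dense abs (lexx 0) r0; have E : u + d - u = d by ring.
  exists (G (u + d) u); first by rewrite absG ?E // -subr_eq0 E -(abs_gt0 abs).
  move=> z w; rewrite s00 => zu wu.
  have {zu} -> : z = u by apply/eqP; rewrite -subr_eq0 -(abs_eq0 abs) eq_le zu abs_ge0.
  have {wu} -> : w = u by apply/eqP; rewrite -subr_eq0 -(abs_eq0 abs) eq_le wu abs_ge0.
  by rewrite !subrr mulr0 subrr abs0 mulr0.
have [d d0 ds] := abs_dense abs (lexx 0) s_gt0; have E : u + d - u = d by ring.
have du : u + d != u by rewrite -subr_eq0 E -(abs_gt0 abs).
have uu' : abs (u - u) <= s by rewrite subrr abs0.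
exists (G (u + d) u); first by rewrite absG ?E // (lt_trans ds).
move=> z w zu wu; have [->|zw] := eqVneq z w.
  by rewrite !subrr mulr0 subrr abs0 mulr0.
have -> : finval f z - finval f w - G (u + d) u * (z - w) =
    (G z w - G (u + d) u) * (z - w).
  by rewrite mulrBl /G divfK // subr_eq0.
rewrite absM ler_wpM2r ?abs_ge0 //.
have dus : abs (u + d - u) <= s by rewrite E ltW.
have [wu0|wu0] := eqVneq w u; first by rewrite wu0 in zw *; apply: Glip.
apply: (@abs_dist_le _ _ _ (G u w)); first by rewrite Glip // eq_sym.
by rewrite GC Glip.
Qed.

End RationalMaps.

(** * Rigidity of injective rational functions *)

(** Bernoulli's inequality, which yields a radius whose [l]-th power is still close to [1] without
    extracting real roots. *)
Lemma bernoulli_le (RR : realType) (y : RR) l : 0 <= y <= 1 -> 1 - l%:R * (1 - y) <= y ^+ l.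
Proof.
move=> /andP[y0 y1]; elim: l => [|l IH]; first by rewrite mul0r subr0.
have h : 0 <= (1 - y) * (1 - y ^+ l).
  by rewrite mulr_ge0 ?subr_ge0 // exprn_ile1.
rewrite exprS -natr1; nra.
Qed.

Section Rigidity.
Context (RR : realType) (p : nat) (K : fieldType) (abs : padicAbs RR p K).
Context (f : K -> proj_line K) (a a' : K) (r r' k : RR) (X : set K).
Hypotheses (r0 : 0 < r) (rr' : r < r') (k0 : 0 < k) (f_rat : ratlike f).
(** The setting: [X] is a union of open discs of radius [r] in the closed ball of that radius, [Y]
    is the annulus around the ball, and [f] is injective on their union. The behaviour on [Y] is
    going to be forced upon [X]. *)
Let Y : set K := [set z | r < abs (z - a) < r'].
Hypothesis X_ball : forall z, X z -> abs (z - a) <= r.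
Hypothesis X_open : forall z w, X z -> abs (w - z) < r -> X w.
Hypothesis f_inj : forall z w, (X `|` Y) z -> (X `|` Y) w -> f z = f w -> z = w.
Hypothesis Y_fin : forall z, Y z -> f z = Some (finval f z).
Hypothesis Y_norm : forall z, Y z -> abs (finval f z - a') = k * abs (z - a).
Hypothesis Y_sim : forall z w, Y z -> Y w ->
  abs (finval f z - finval f w) = k * abs (z - w).
Hypothesis Y_onto : forall c, k * r < abs (c - a') < k * r' -> exists2 z, Y z & f z = Some c.

Let P := projT1 (cid f_rat).
Let S := projT1 (cid (projT2 (cid f_rat))).

Let PS z : P.[z] = 0 -> S.[z] != 0.
Proof. by have [+ _] := projT2 (cid (projT2 (cid f_rat))); apply. Qed.

Let fE z : f z = proj_point P.[z] S.[z].
Proof. by have [_] := projT2 (cid (projT2 (cid f_rat))); apply. Qed.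

Let finS z : f z = Some (finval f z) <-> S.[z] != 0.
Proof.
by rewrite /finval fE /proj_point; case: eqP.
Qed.

Let fv z : S.[z] != 0 -> finval f z = P.[z] / S.[z].
Proof. by move=> Sz; rewrite /finval fE /proj_point (negPf Sz). Qed.

Let X_far z y : X z -> Y y -> abs (z - y) = abs (y - a).
Proof.
move=> /X_ball za /andP[ya _]; rewrite abs_distC; apply: abs_dist_domr.
by rewrite abs_distC; apply: le_lt_trans ya.
Qed.

Let X_Y_disjoint z : X z -> ~ Y z.
Proof. by move=> /X_ball za /andP[]; rewrite ltNge za. Qed.

(* The secant quotient at [w] and the denominator have the same Newton data at
   radius [r], since their ratio is constant on the annulus. *)
Let secant_generic w : (X `|` Y) w -> S.[w] != 0 ->
  (exists2 r1, r < r1 & forall y, r < abs (y - a) -> abs (y - a) < r1 ->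
     abs (finval f y - finval f w) = k * abs (y - w)) ->
  exists (C : RR), 0 < C /\ forall z, X z ->
    (forall z', abs (z' - z) < r -> z' != w) \/ (P^`() * S - P * S^`()).[w] != 0 ->
    [/\ forall z', abs (z' - z) < r -> S.[z'] != 0 ->
          abs (finval f z' - finval f w) = k * abs (z' - w) * (C / abs S.[z']),
        (forall z', abs (z' - z) < r -> S.[z'] != 0) ->
           abs S.[z] = C
      & exists r2 (l : nat), [/\ 0 <= r2, r2 < r,
          forall z', r2 < abs (z' - z) -> abs (z' - z) < r ->
            abs S.[z'] = C * (abs (z' - z) / r) ^+ l
          & S.[z] = 0 -> (0 < l)%N]].
Proof.
move=> XYw Sw [r1 rr1 w_sim]; have [T [TE Tw]] := secant_quotient P S w.
have Sw0 : 0 < abs S.[w] by rewrite abs_gt0.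
have T_abs y : S.[y] != 0 -> y != w ->
    abs (finval f y - finval f w) = k * abs (y - w) ->
    abs T.[y] = k * abs S.[w] * abs S.[y].
  move=> Sy yw; have yw0 : abs (y - w) != 0 by rewrite abs_eq0 subr_eq0.
  have SS : abs S.[y] * abs S.[w] != 0 by rewrite mulf_neq0 ?abs_eq0.
  rewrite !fv // (secant_abs _ _ _ (TE y)) // => /(canRL (divfK SS)) h.
  by apply: (mulIf yw0); rewrite h; ring.
have T_nz z : X z \/ Y z -> z != w -> T.[z] != 0.
  move=> XYz zw; apply: contraNneq zw => Tz; apply/eqP/f_inj => //; rewrite !fE.
  by apply/proj_point_eq; [exact: PS|exact: PS|rewrite TE Tz mul0r].
have S_nz : S != 0 by apply: contraNneq Sw => ->; rewrite horner0.
set r3 := Num.min r1 r'; have rr3 : r < r3 by rewrite lt_min rr1.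
have [y0 [Yy0 y0w]] : exists y0, Y y0 /\ y0 != w.
  have [d1 rd1 d1r] := abs_dense abs (ltW r0) rr'.
  have [d2 rd2 d2r] := abs_dense abs (ltW r0) rd1.
  have E d : a + d - a = d by ring.
  have [wE|] := eqVneq w (a + d1); last first.
    by move=> h; exists (a + d1); rewrite eq_sym; split => //; rewrite /Y /= E rd1.
  exists (a + d2); rewrite /Y /= E rd2 (lt_trans d2r) //; split => //.
  by rewrite wE; apply: contraTneq d2r => /addrI ->; rewrite ltxx.
have T0 : T != 0.
  by apply: contraNneq (T_nz y0 (or_intror Yy0) y0w) => ->; rewrite horner0.
have [c1 [k1 [s1 [c10 rs1 out1 gen1 _]]]] := newton_profile abs a T0 r0.
have [c2 [k2 [s2 [c20 rs2 out2 gen2 ins2]]]] := newton_profile abs a S_nz r0.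
(* Points of the annulus below radius [rw] differ from [w], as the formula for [abs T.[y]]
   requires. *)
set rw := if `[< Y w >] then abs (w - a) else r'.
have rrw : r < rw by rewrite /rw; case: asboolP => // /andP[].
set s := Num.min (Num.min s1 s2) (Num.min r3 rw).
have rs : r < s by rewrite !lt_min rs1 rs2 rr1 rr' rrw.
(* The ratio of [abs T] to [abs S] is constant here, so the exponents agree and the constants differ
   by the factor [k * abs S.[w]]. The same constants govern the classes inside the ball. *)
have [k12 c12] : k1 = k2 /\ c1 = k * abs S.[w] * c2.
  apply: (monomial_eq (abs := abs) (a := a) r0 rs c10) => z rz.
  rewrite !lt_min => /andP[/andP[zs1 zs2] /andP[/andP[zr1 zr'] zrw]].
  have Yz : Y z by rewrite /Y /= rz.
  have zw : z != w.
    apply: contraTneq zrw => zw; rewrite /rw -zw; case: asboolP => // _.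
    by rewrite ltxx.
  have Sz : S.[z] != 0 by apply/finS/Y_fin.
  by rewrite -out1 // -mulrA -out2 // T_abs // w_sim.
exists (c2 * r ^+ k2); split; first by rewrite mulr_gt0 ?exprn_gt0.
move=> z Xz zw; have za := X_ball Xz; split.
- move=> z' z'z Sz'; rewrite !fv // (secant_abs _ _ _ (TE z')) //.
  have -> : abs T.[z'] = c1 * r ^+ k1.
    have Xz' := X_open Xz z'z; apply: gen1; first exact: X_ball.
    move=> w' w'z'; have w'z : abs (w' - z) < r by apply: abs_dist_lt z'z.
    have [w'w|w'w] := eqVneq w' w; last by apply: T_nz w'w; left; apply: X_open w'z.
    by case: zw => [/(_ _ w'z)|]; rewrite w'w ?eqxx // Tw.
  rewrite c12 k12; field.
  by rewrite !gt_eqF ?abs_gt0.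
- by move=> nz; rewrite gen2.
- exact: ins2.
Qed.

Let near_sim w : Y w -> exists2 r1, r < r1 & forall y, r < abs (y - a) -> abs (y - a) < r1 ->
  abs (finval f y - finval f w) = k * abs (y - w).
Proof. by move=> Yw; exists r' => // y y1 y2; apply: Y_sim => //; apply/andP. Qed.

Let far_neq z y : X z -> Y y -> forall z', abs (z' - z) < r -> z' != y.
Proof.
move=> Xz Yy z' z'z; apply/eqP => z'y.
by apply: (@X_Y_disjoint z'); [exact: X_open z'z|rewrite z'y].
Qed.

(* Near the boundary of the residue class of a pole, [f] would take values in
   the image of the annulus. *)
Lemma rigidity_finite z : X z -> f z = Some (finval f z).
Proof.
move=> Xz; apply/finS/eqP => Sz.
have [d rd dr'] := abs_dense abs (ltW r0) rr'.
have E : a + d - a = d by ring.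
have Yx : Y (a + d) by rewrite /Y /= E rd.
have Sx : S.[a + d] != 0 by apply/finS/Y_fin.
have [C [C0 /(_ z Xz)]] := secant_generic (or_intror Yx) Sx (near_sim Yx).
case/(_ (or_introl (far_neq Xz Yx))) => val _ [r2 [l [r20 r2r Sz' /(_ Sz) l0]]].
set q := abs d / r'.
have d0 : 0 < abs d := lt_trans r0 rd.
have r'0 := lt_trans r0 rr'.
have q1 : q < 1 by rewrite ltr_pdivrMr // mul1r.
have l0R : 0 < l%:R :> RR by rewrite ltr0n.
(* The radius [abs e] is so close to [r] that [q < (abs e / r) ^ l < 1]. Then [f (z + e)] is at a
   distance from [a'] strictly between [k * abs d] and [k * r'], hence in the image of [Y]. *)
have [e e1 er] : exists2 e, Num.max r2 (r * (1 - (1 - q) / l%:R)) < abs e & abs e < r.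
  apply: abs_dense; first by rewrite le_max r20.
  rewrite gt_max r2r /= gtr_pMr // ltrBlDr ltrDl divr_gt0 // subr_gt0 //.
move: e1; rewrite gt_max => /andP[e1 e2].
have e0 : 0 < abs e := le_lt_trans r20 e1.
have Ee : z + e - z = e by ring.
have SzE : abs S.[z + e] = C * (abs e / r) ^+ l by rewrite Sz' Ee.
have er1 : abs e / r < 1 by rewrite ltr_pdivrMr // mul1r.
have ql : q < (abs e / r) ^+ l.
  apply: lt_le_trans (bernoulli_le l _); last by rewrite divr_ge0 ?ltW.
  have h : 1 - (1 - q) / l%:R < abs e / r by rewrite ltr_pdivlMr // mulrC.
  have h2 : l%:R * (1 - abs e / r) < 1 - q.
    by rewrite mulrC -ltr_pdivlMr //; lra.
  lra.
have el0 : 0 < (abs e / r) ^+ l by rewrite exprn_gt0 ?divr_gt0.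
have Sze : S.[z + e] != 0 by rewrite -(abs_gt0 abs) SzE mulr_gt0.
have := val (z + e); rewrite Ee => /(_ er Sze).
have Xze : X (z + e) by apply: X_open Xz _; rewrite Ee.
rewrite (X_far Xze Yx) E SzE.
have -> : k * abs d * (C / (C * (abs e / r) ^+ l)) = k * abs d / (abs e / r) ^+ l.
  by field; rewrite !gt_eqF.
move=> fze.
have tau : k * abs d < k * abs d / (abs e / r) ^+ l.
  rewrite ltr_pdivlMr // gtr_pMr ?mulr_gt0 // exprn_ilt1 ?divr_ge0 ?(ltW r0) ?(ltW e0) //.
  by rewrite -lt0n.
have fzE : abs (finval f (z + e) - a') = k * abs d / (abs e / r) ^+ l.
  rewrite (@abs_dist_domr _ _ _ (finval f (a + d))) fze //.
  by rewrite Y_norm // E.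
have [|y Yy fy] := @Y_onto (finval f (z + e)).
  rewrite fzE (lt_trans _ tau) ?ltr_pM2l //=.
  by rewrite -mulrA ltr_pM2l // ltr_pdivrMr // mulrC -ltr_pdivrMr.
apply: (X_Y_disjoint Xze); rewrite (@f_inj (z + e) y) //; [by left|by right|].
by rewrite fy; apply/finS.
Qed.

Let X_S z : X z -> S.[z] != 0. Proof. by move=> Xz; apply/finS/rigidity_finite. Qed.

Let X_class z : X z -> forall z', abs (z' - z) < r -> S.[z'] != 0.
Proof. by move=> Xz z' /(X_open Xz)/X_S. Qed.

Let X_Y_sim z y : X z -> Y y -> abs (finval f z - finval f y) = k * abs (z - y).
Proof.
move=> Xz Yy; have Sy : S.[y] != 0 by apply/finS/Y_fin.
have [C [C0 /(_ z Xz (or_introl (far_neq Xz Yy))) [val Sz _]]] :=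
  secant_generic (or_intror Yy) Sy (near_sim Yy).
by rewrite val ?Sz ?divff ?mulr1 ?gt_eqF ?X_S //; [exact: X_class|rewrite subrr abs0].
Qed.

Let near_sim_X w : X w -> exists2 r1, r < r1 & forall y, r < abs (y - a) -> abs (y - a) < r1 ->
  abs (finval f y - finval f w) = k * abs (y - w).
Proof.
move=> Xw; exists r' => // y y1 y2; rewrite abs_distC X_Y_sim 1?abs_distC //.
exact/andP.
Qed.

(** Different classes, and points of [Y], are settled by the secant quotient alone. Within one class
    [f] is a similarity of some ratio, which makes [w] noncritical; the comparison with the annulus
    then identifies the ratio. *)
Lemma rigidity_similarity z w : X z -> (X `|` Y) w ->
  abs (finval f z - finval f w) = k * abs (z - w).
Proof.
move=> Xz [Xw|]; last exact: X_Y_sim.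
have [zw|wz] := leP r (abs (w - z)).
  have nw z' : abs (z' - z) < r -> z' != w.
    by move=> h; apply: contraTneq h => ->; rewrite -leNgt.
  have [C [C0 /(_ z Xz (or_introl nw)) [val Sz _]]] :=
    secant_generic (or_introl Xw) (X_S Xw) (near_sim_X Xw).
  by rewrite val ?Sz ?divff ?mulr1 ?gt_eqF ?X_S //; [exact: X_class|rewrite subrr abs0].
have [k' k'0 sim] : exists2 k', 0 < k' & forall z1 w1, abs (z1 - z) < r -> abs (w1 - z) < r ->
    abs (finval f z1 - finval f w1) = k' * abs (z1 - w1).
  apply: disc_injective_similarity => // [z1 z1z|z1 w1 z1z w1z].
    by apply: rigidity_finite; apply: X_open z1z.
  by apply: f_inj; left; [apply: X_open z1z|apply: X_open w1z].
have [->|zw] := eqVneq z w; first by rewrite !subrr abs0 mulr0.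
have wcE z' : (abs (z' - w) < r) = (abs (z' - z) < r).
  apply/idP/idP => h; first exact: abs_dist_lt wz.
  by apply: (abs_dist_lt h); rewrite abs_distC.
have Ww : (P^`() * S - P * S^`()).[w] != 0.
  have [T [TE <-]] := secant_quotient P S w.
  have kS : 0 < k' * abs S.[w] ^+ 2 by rewrite mulr_gt0 ?exprn_gt0 ?abs_gt0 ?X_S.
  apply: (abs_const_neq0 (abs := abs) r0 kS) => z1 z1w z1wr.
  have Sz1 : S.[z1] != 0 by apply: X_class z1wr.
  have yw0 : abs (z1 - w) != 0 by rewrite abs_eq0 subr_eq0.
  have Sw := X_S Xw.
  have SS : abs S.[z1] * abs S.[w] != 0 by rewrite mulf_neq0 // abs_eq0.
  have := sim z1 w; rewrite -wcE !fv // (secant_abs _ _ _ (TE z1)) //.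
  move=> /(_ z1wr wz) /(canRL (divfK SS)) h; apply: (mulIf yw0); rewrite h.
  by rewrite (noroot_const r0 (X_class Xw)) //; ring.
have [C [C0 /(_ z Xz (or_intror Ww)) [val Sz _]]] :=
  secant_generic (or_introl Xw) (X_S Xw) (near_sim_X Xw).
by rewrite val ?Sz ?divff ?mulr1 ?gt_eqF ?X_S //; [exact: X_class|rewrite subrr abs0].
Qed.

End Rigidity.

(** * Composition, charts and the chordal metric *)

Section RatlikeComposition.
Context (K : fieldType).
Implicit Types (x y z w a c : K) (f : K -> proj_line K) (R : {fraction {poly K}}).

Lemma ratlike_Some : ratlike (@Some K).
Proof.
exists 'X, 1; split=> z; first by rewrite hornerC oner_eq0.
by rewrite hornerX hornerC /proj_point oner_eq0 divr1.
Qed.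

Lemma ratmap_Some R z : ratmap R (Some z) = proj_point (ratnum R).[z] (ratden R).[z].
Proof. by []. Qed.

Lemma ratmap_None R : ratmap R None =
  proj_point (ratnum R)`_(ratdeg R) (ratden R)`_(ratdeg R).
Proof. by []. Qed.

Lemma ratnum_den_root R z : (ratnum R).[z] = 0 -> (ratden R).[z] != 0.
Proof. by move=> /rootP; apply: coprimep_root; exact: ratfun_coprime. Qed.

Lemma ratnum_den_lead R : (ratnum R)`_(ratdeg R) = 0 -> (ratden R)`_(ratdeg R) != 0.
Proof.
have M0 := ratden_neq0 R; rewrite /ratdeg.
have Ms : (0 < size (ratden R))%N by rewrite size_poly_gt0.
case: (leqP (size (ratden R)) (size (ratnum R))) => [h|h].
  rewrite -lead_coefE => /eqP; rewrite lead_coef_eq0 => /eqP N0.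
  by move: h; rewrite N0 size_poly0 leqNgt Ms.
by rewrite -lead_coefE => _; rewrite lead_coef_eq0.
Qed.

Lemma proj_pointMl c x y : c != 0 -> proj_point (c * x) (c * y) = proj_point x y.
Proof.
move=> c0; rewrite /proj_point mulf_eq0 (negPf c0) /=; case: eqP => // y0.
by rewrite -mulf_div divff // mul1r.
Qed.

(* The two forms of degree [ratdeg R] defining [R], applied to the homogeneous
   coordinates of [f]. *)
Lemma ratlike_ratmap R f : ratlike f -> ratlike (fun z => ratmap R (f z)).
Proof.
move=> [P [S [PS fE]]]; set d := ratdeg R.
pose hom (N : {poly K}) : {poly K} := \sum_(i < d.+1) N`_i *: (P ^+ i * S ^+ (d - i)).
have homE (N : {poly K}) z : (size N <= d.+1)%N -> S.[z] != 0 ->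
    (hom N).[z] = S.[z] ^+ d * N.[P.[z] / S.[z]].
  move=> sN Sz; rewrite /hom horner_sum (horner_coef_wide _ sN) mulr_sumr.
  apply: eq_bigr => i _; rewrite hornerZ hornerM !horner_exp.
  have -> : S.[z] ^+ d = S.[z] ^+ (d - i) * S.[z] ^+ i by rewrite -exprD subnK // -ltnS.
  rewrite expr_div_n; have := expf_neq0 i Sz.
  by move: (P.[z] ^+ i) (S.[z] ^+ i) (S.[z] ^+ (d - i)) => A B C B0; field.
have hom0 (N : {poly K}) z : S.[z] = 0 -> (hom N).[z] = P.[z] ^+ d * N`_d.
  move=> Sz; rewrite /hom big_ord_recr /= hornerD horner_sum big1 ?add0r.
    by rewrite subnn expr0 mulr1 hornerZ horner_exp mulrC.
  move=> i _; rewrite hornerZ hornerM !horner_exp Sz expr0n subn_eq0 leqNgt ltn_ord.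
  by rewrite !mulr0.
have Ms : (0 < size (ratden R))%N by rewrite size_poly_gt0 ratden_neq0.
have dE : d.+1 = maxn (size (ratnum R)) (size (ratden R)).
  by rewrite /d /ratdeg prednK // leq_max Ms orbT.
have sN : (size (ratnum R) <= d.+1)%N by rewrite dE leq_maxl.
have sM : (size (ratden R) <= d.+1)%N by rewrite dE leq_maxr.
exists (hom (ratnum R)), (hom (ratden R)); split=> z.
  have [Sz|Sz] := eqVneq S.[z] 0; last first.
    rewrite !homE // => /eqP; rewrite mulf_eq0 expf_eq0 (negPf Sz) andbF /= => /eqP h.
    by rewrite mulf_neq0 ?expf_neq0 // ratnum_den_root.
  have Pz : P.[z] != 0 by apply/eqP => /PS; rewrite Sz eqxx.
  rewrite !hom0 // => /eqP; rewrite mulf_eq0 expf_eq0 (negPf Pz) andbF /= => /eqP h.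
  by rewrite mulf_neq0 ?expf_neq0 // ratnum_den_lead.
rewrite fE {1}/proj_point; case: eqP => [Sz|/eqP Sz].
  have Pz : P.[z] != 0 by apply/eqP => /PS; rewrite Sz eqxx.
  by rewrite !hom0 // proj_pointMl ?expf_neq0 // ratmap_None.
by rewrite !homE // proj_pointMl ?expf_neq0 // ratmap_Some.
Qed.

Lemma ratlike_iter R m f : ratlike f -> ratlike (fun z => iter m (ratmap R) (f z)).
Proof. by move=> fr; elim: m => //= m; apply: ratlike_ratmap. Qed.

(** The coordinate [1 / (w - a)] on the projective line, with inverse [inv_chart a]. It sends
    infinity to [0], and [None] is its value at [a]. *)
Definition inv_coord (a : K) (w : proj_line K) : proj_line K :=
  if w is Some v then (if v == a then None else Some (v - a)^-1) else Some 0.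

Definition inv_chart (a t : K) : proj_line K :=
  if t == 0 then None else Some (a + t^-1).

Lemma inv_coordK a (w : proj_line K) t : inv_coord a w = Some t -> w = inv_chart a t.
Proof.
rewrite /inv_coord /inv_chart; case: w => [v|[<-]]; last by rewrite eqxx.
case: eqP => // /eqP va [<-]; rewrite invr_eq0 subr_eq0 (negPf va) invrK.
by rewrite addrC subrK.
Qed.

Lemma inv_coord_inj a : injective (inv_coord a).
Proof.
move=> w w' E; case E1: (inv_coord a w) => [t|].
  by rewrite (inv_coordK E1); rewrite E in E1; rewrite (inv_coordK E1).
move: (E1); rewrite E; move: E1; rewrite /inv_coord.
by case: w {E} => [v|//]; case: eqP => // -> _; case: w' => [v'|//]; case: eqP => // ->.
Qed.

Lemma inv_chart_inj a : injective (inv_chart a).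
Proof.
move=> t t'; rewrite /inv_chart; case: eqP => [->|t0]; case: eqP => [->|t'0] //.
by case=> /addrI /invr_inj.
Qed.

Lemma ratlike_inv_coord a f : ratlike f -> ratlike (fun z => inv_coord a (f z)).
Proof.
move=> [P [S [PS fE]]]; exists S, (P - a%:P * S); split=> z.
  move=> Sz; rewrite !hornerE Sz mulr0 subr0.
  by apply/eqP => /PS; rewrite Sz eqxx.
rewrite fE !hornerE /proj_point; case: (eqVneq S.[z] 0) => [Sz|Sz] /=.
  rewrite Sz mulr0 subr0 mul0r; case: eqP => // /PS.
  by rewrite Sz eqxx.
have -> : (P.[z] / S.[z] == a) = (P.[z] - a * S.[z] == 0).
  by rewrite subr_eq0 -(inj_eq (mulIf Sz)) divfK.
case: eqP => // _; congr Some; rewrite -[RHS]invf_div; congr (_^-1).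
by field.
Qed.

Lemma ratlike_inv_chart a : ratlike (inv_chart a).
Proof.
exists (1 + a *: 'X), 'X; split=> z; rewrite !hornerE /=.
  by move=> h; apply/eqP => z0; move: h => /eqP; rewrite z0 mulr0 addr0 oner_eq0.
rewrite /inv_chart /proj_point; case: eqP => // /eqP z0; congr Some.
by field.
Qed.

End RatlikeComposition.

Section ChordalMetric.
Context (RR : realType) (K : fieldType) (abs : nonarchAbs RR K).
Implicit Types (z w u : proj_line K) (x y : K) (e : RR).

Let norm z : RR := Num.max (abs (hcoord z).1) (abs (hcoord z).2).

Let norm_gt0 z : 0 < norm z.
Proof. by case: z => [x|]; rewrite /norm lt_max /= abs1 ltr01 ?orbT. Qed.

Let chordalE z w : chordal abs z w =
  abs ((hcoord z).1 * (hcoord w).2 - (hcoord w).1 * (hcoord z).2) / (norm z * norm w).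
Proof. by rewrite /chordal /norm; case: (hcoord z) => ? ?; case: (hcoord w). Qed.

Lemma chordal_xx z : chordal abs z z = 0.
Proof. by rewrite chordalE subrr abs0 mul0r. Qed.

Lemma chordal_sym z w : chordal abs z w = chordal abs w z.
Proof. by rewrite !chordalE abs_distC [norm w * _]mulrC. Qed.

Lemma chordal_gt0 z w : z <> w -> 0 < chordal abs z w.
Proof.
move=> zw; rewrite chordalE divr_gt0 ?mulr_gt0 // abs_gt0.
case: z w zw => [x|] [y|] //= zw; rewrite ?mulr1 ?mul1r ?mulr0 ?sub0r ?subr0 ?oppr_eq0 ?oner_eq0 //.
by rewrite subr_eq0; apply: contra_notN zw => /eqP ->.
Qed.

(** Multiplied by a coordinate of [u], the cross product of [z] and [w] becomes a sum of two terms,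
    each containing a cross product with [u]. The coordinate used is the larger one. *)
Lemma chordal_ultra u z w e :
  chordal abs z u < e -> chordal abs u w < e -> chordal abs z w < e.
Proof.
rewrite !chordalE !ltr_pdivrMr ?mulr_gt0 //.
set x1 := (hcoord z).1; set y1 := (hcoord z).2; set x2 := (hcoord u).1.
set y2 := (hcoord u).2; set x3 := (hcoord w).1; set y3 := (hcoord w).2.
move=> zu uw; have nu := norm_gt0 u; rewrite -(ltr_pM2r nu).
have [nz1 nz2] : abs x1 <= norm z /\ abs y1 <= norm z by rewrite !le_max !lexx orbT.
have [nw1 nw2] : abs x3 <= norm w /\ abs y3 <= norm w by rewrite !le_max !lexx orbT.
have bound c A B (nA nB : RR) : abs A < e * (nA * norm u) -> abs B <= nB -> 0 < nB ->
    c = A * B -> abs c < e * (nA * nB) * norm u.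
  move=> hA hB nB0 ->; rewrite absM.
  have -> : e * (nA * nB) * norm u = e * (nA * norm u) * nB by ring.
  apply: le_lt_trans (ler_wpM2l (abs_ge0 _ _) hB) _.
  by rewrite ltr_pM2r.
have step (t c d : K) : abs t = norm u -> t * (x1 * y3 - x3 * y1) = c + d ->
    abs c < e * (norm z * norm w) * norm u -> abs d < e * (norm z * norm w) * norm u ->
    abs (x1 * y3 - x3 * y1) * norm u < e * (norm z * norm w) * norm u.
  by move=> <- E hc hd; rewrite mulrC -absM E absD_lt.
have wu : abs (x2 * y3 - x3 * y2) < e * (norm w * norm u) by rewrite [norm w * _]mulrC.
have [h|h] := leP (abs x2) (abs y2).
  apply: (@step y2 ((x1 * y2 - x2 * y1) * y3) ((x2 * y3 - x3 * y2) * y1)).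
  - by rewrite /norm (max_idPr h).
  - by ring.
  - exact: bound zu nw2 (norm_gt0 w) erefl.
  - by rewrite [norm z * _]mulrC; exact: bound wu nz2 (norm_gt0 z) erefl.
apply: (@step x2 ((x1 * y2 - x2 * y1) * x3) ((x2 * y3 - x3 * y2) * x1)).
- by rewrite /norm (max_idPl (ltW h)).
- by ring.
- exact: bound zu nw1 (norm_gt0 w) erefl.
- by rewrite [norm z * _]mulrC; exact: bound wu nz1 (norm_gt0 z) erefl.
Qed.

Lemma chordal_Some_le x y : chordal abs (Some x) (Some y) <= abs (x - y).
Proof.
rewrite chordalE /= mulr1 mulr1 ler_pdivrMr ?mulr_gt0 //.
rewrite ler_peMr ?abs_ge0 // -[1]mulr1 ler_pM // le_max /= abs1 lexx orbT //.
Qed.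

Lemma chordal_small x e : 0 < e -> exists2 d, 0 < d &
  forall w, chordal abs (Some x) w < d -> exists2 y, w = Some y & abs (y - x) < e.
Proof.
move=> e0; set n := norm (Some x); have n0 : 0 < n := norm_gt0 _.
have nx : abs x <= n by rewrite le_max lexx.
have n1 : 1 <= n by rewrite le_max /= abs1 lexx orbT.
have nE : norm (Some x) = n by []; clearbody n.
(* [1 / n] is the distance from [Some x] to infinity, and staying below it also forces [abs y <= n];
   for such [y] the chordal distance is at least [abs (x - y) / n ^ 2]. *)
exists (Num.min n^-1 (e / n ^+ 2)).
  by rewrite lt_min invr_gt0 n0 divr_gt0 ?exprn_gt0.
move=> w; rewrite lt_min chordalE nE => /andP[].
case: w => [y|] /=.
  rewrite !mulr1 => h1 h2; exists y => //; rewrite abs_distC.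
  have yn : norm (Some y) <= Num.max n (abs (x - y)).
    rewrite ge_max /= abs1 !le_max n1 /= andbT.
    have [h|h] := leP (abs y) (abs x); first by rewrite (le_trans h nx).
    by rewrite [abs (x - y)]abs_distC abs_domB // lexx orbT.
  have ny : 0 < norm (Some y) := norm_gt0 _.
  move: h1 h2; rewrite !ltr_pdivrMr ?mulr_gt0 // => h1 h2.
  have h3 : abs (x - y) < norm (Some y) by move: h1; rewrite mulrA mulVf ?mul1r ?gt_eqF.
  have h4 : norm (Some y) <= n.
    by move: yn; rewrite le_max => /orP[//|]; rewrite leNgt h3.
  apply: lt_le_trans h2 _; rewrite expr2 invfM -!mulrA.
  rewrite ler_piMr ?(ltW e0) // mulrA mulrACA mulVf ?gt_eqF // mul1r.
  by rewrite mulrC ler_pdivrMr // mul1r.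
rewrite !mulr0 !mul1r sub0r absN abs1 /norm /= abs1 abs0 => h _; move: h.
by rewrite (max_idPl _) ?ler01 // mulr1 div1r ltxx.
Qed.

End ChordalMetric.

(** * Quasiperiodicity *)

Section Recurrence.
Context (RR : realType) (K : fieldType) (abs : nonarchAbs RR K).
Context (R : {fraction {poly K}}).
Implicit Types (z w x y : proj_line K) (e : RR).

(** A map that moves every point of an ultrametric ball by less than the radius preserves the ball,
    and so do its iterates. *)
Lemma quasiperiodic_return x e : quasiperiodicity abs R x -> 0 < e ->
  exists N d, [/\ (0 < N)%N, 0 < d, d <= e & forall w, chordal abs x w < d ->
    forall k, chordal abs x (iter (k * N) (ratmap R) w) < d].
Proof.
move=> [n [V [n_oo [e0 e00 e0V] unif]]] epos.
have d0 : 0 < Num.min e e0 by rewrite lt_min epos.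
have [N0 _ hN0] := unif _ d0.
have [N1 _ hN1] : \forall j \near \oo, (0 < n j)%N.
  by apply: (n_oo [set k | (0 < k)%N]); exists 1%N.
set j := maxn N0 N1; exists (n j), (Num.min e e0); split => //.
- by apply: hN1; rewrite /= leq_maxr.
- by rewrite ge_min lexx.
move=> w xw; elim=> [|k IH]; first exact: xw.
rewrite mulSn iterD; apply: (chordal_ultra IH).
rewrite chordal_sym; apply: hN0; first by rewrite /= leq_maxl.
by apply: e0V; rewrite /=; apply: lt_le_trans IH _; rewrite ge_min lexx orbT.
Qed.

(* Disjoint neighbourhoods of two points of the domain of quasiperiodicity are
   preserved by a common iterate. *)
Lemma quasiperiodic_iter_inj m x y :
  quasiperiodicity abs R x -> quasiperiodicity abs R y ->
  iter m (ratmap R) x = iter m (ratmap R) y -> x = y.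
Proof.
move=> Ex Ey mxy; have [//|/chordal_gt0 - /(_ _ abs) xy] := pselect (x = y).
have [N [d [N0 d0 de xN]]] := quasiperiodic_return Ex xy.
have [N' [d' [N'0 d'0 d'e yN]]] := quasiperiodic_return Ey xy.
have := xN x; rewrite chordal_xx => /(_ d0 (m * N')%N) hx.
have := yN y; rewrite chordal_xx => /(_ d'0 (m * N)%N) hy.
have mm : (m <= m * N' * N)%N by rewrite -mulnA leq_pmulr // muln_gt0 N0 N'0.
have E : iter (m * N' * N) (ratmap R) x = iter (m * N * N') (ratmap R) y.
  by rewrite -[in RHS]mulnA [(N * N')%N]mulnC mulnA -(subnK mm) !iterD mxy.
suff : chordal abs x y < chordal abs x y by rewrite ltxx.
apply: (chordal_ultra (lt_le_trans hx de)); rewrite E chordal_sym.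
exact: lt_le_trans hy d'e.
Qed.

End Recurrence.

Section NearRotation.
Context (RR : realType) (p : nat) (K : fieldType) (abs : padicAbs RR p K).
Implicit Types (z w x c : K) (g : K -> K) (Z : set K).

(** Each step acts on differences as multiplication by [c] up to the relative error [d]; in an
    ultrametric setting the errors of successive steps do not add up. *)
Lemma affine_iter g Z c (d : RR) : (forall z, Z z -> Z (g z)) -> abs c = 1 ->
  0 <= d <= 1 -> (forall z w, Z z -> Z w ->
    abs (g z - g w - c * (z - w)) <= d * abs (z - w)) ->
  forall i z w, Z z -> Z w ->
    abs (iter i g z - iter i g w - c ^+ i * (z - w)) <= d * abs (z - w).
Proof.
move=> gZ c1 /andP[d0 d1] glip i z w Zz Zw.
have iZ j u : Z u -> Z (iter j g u) by move=> Zu; elim: j => //= j; apply: gZ.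
elim: i => [|i IH]; first by rewrite expr0 mul1r subrr abs0 mulr_ge0 ?abs_ge0.
have iso : abs (iter i g z - iter i g w) <= abs (z - w).
  rewrite -[X in abs X](subrK (c ^+ i * (z - w))); apply: absD_le.
    by apply: le_trans IH _; rewrite ler_piMl ?abs_ge0.
  by rewrite absM absX c1 expr1n mul1r.
have -> : iter i.+1 g z - iter i.+1 g w - c ^+ i.+1 * (z - w) =
   (g (iter i g z) - g (iter i g w) - c * (iter i g z - iter i g w)) +
   c * (iter i g z - iter i g w - c ^+ i * (z - w)) by rewrite /= exprS; ring.
apply: absD_le; last by rewrite absM c1 mul1r.
by apply: le_trans (glip _ _ (iZ _ _ Zz) (iZ _ _ Zw)) _; rewrite ler_wpM2l.
Qed.

(** The [p] successive displacements are almost equal, so their sum is close to [p] times one of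
    them, and [p] is small. *)
Lemma near_identity_iter g Z (d b : RR) : (forall z, Z z -> Z (g z)) ->
  0 <= d <= 1 -> (forall z w, Z z -> Z w ->
    abs (g z - g w - (z - w)) <= d * abs (z - w)) ->
  (forall z, Z z -> abs (g z - z) <= b) ->
  forall z, Z z -> abs (iter p g z - z) <= Num.max d (abs p%:R) * b.
Proof.
move=> gZ /andP[d0 d1] glip gb z Zz.
have iZ j u : Z u -> Z (iter j g u) by move=> Zu; elim: j => //= j; apply: gZ.
have b0 : 0 <= b by apply: le_trans (gb z Zz); exact: abs_ge0.
have ib i : abs (iter i g z - z) <= b.
  elim: i => [|i IH]; first by rewrite subrr abs0.
  by apply: (abs_dist_le (gb _ (iZ i _ Zz)) IH).
have drift i : abs (iter i g z - z - i%:R * (g z - z)) <= d * b.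
  elim: i => [|i IH]; first by rewrite mul0r subrr subr0 abs0 mulr_ge0.
  have -> : iter i.+1 g z - z - i.+1%:R * (g z - z) =
     (g (iter i g z) - g z - (iter i g z - z)) + (iter i g z - z - i%:R * (g z - z)).
    by rewrite /= -natr1; ring.
  apply: absD_le => //; apply: le_trans (glip _ _ (iZ _ _ Zz) Zz) _.
  by rewrite ler_wpM2l.
rewrite -[X in abs X](subrK (p%:R * (g z - z))); apply: absD_le.
  by apply: le_trans (drift p) _; rewrite ler_wpM2r // le_max lexx.
by rewrite absM ler_pM ?abs_ge0 ?gb // le_max lexx orbT.
Qed.

(** Some power [c ^ M] is close to [1], so differences are almost preserved by the [M]-th iterate of
    [g]; its own iterates of order [p ^ j] then move points by at most [q ^ j * b]. The return times
    are [p ^ j * M * m]. *)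
Lemma quasiperiodic_near_rotation (R : {fraction {poly K}}) g Z m c (d b e : RR) x :
  (0 < m)%N ->
  (forall z, Z z -> iter m (ratmap R) (Some z) = Some (g z) /\ Z (g z)) ->
  abs c = 1 -> 0 <= d < 1 ->
  (forall z w, Z z -> Z w -> abs (g z - g w - c * (z - w)) <= d * abs (z - w)) ->
  (forall z w, Z z -> Z w -> abs (z - w) <= b) ->
  0 < e -> (forall z, abs (z - x) < e -> Z z) ->
  quasiperiodicity abs R (Some x).
Proof.
move=> m0 gE c1 /andP[d0 d1] glip diam e0 eZ.
have gZ z : Z z -> Z (g z) by move=> /gE[].
have [M M0 cM] := padic_torsion c1.
pose h := iter M g; pose d' := Num.max d (abs (c ^+ M - 1)).
have hZ z : Z z -> Z (h z) by move=> Zz; rewrite /h; elim: M {M0 cM h d'} => //= j;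
  apply: gZ.
have d'01 : 0 <= d' <= 1 by rewrite /d' le_max d0 /= ge_max (ltW d1) ltW.
have hlip z w : Z z -> Z w -> abs (h z - h w - (z - w)) <= d' * abs (z - w).
  move=> Zz Zw.
  have -> : h z - h w - (z - w) = (h z - h w - c ^+ M * (z - w)) + (c ^+ M - 1) * (z - w) by ring.
  apply: absD_le; last by rewrite absM ler_wpM2r ?abs_ge0 // le_max lexx orbT.
  apply: le_trans (_ : d * abs (z - w) <= _);
    last by rewrite ler_wpM2r ?abs_ge0 // le_max lexx.
  by apply: (affine_iter gZ c1 _ glip) => //; rewrite d0 ltW.
pose q := Num.max d' (abs p%:R).
have q0 : 0 <= q by rewrite le_max abs_ge0 orbT.
have q1 : q < 1 by rewrite !gt_max d1 cM padic_p_lt1.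
have b0 : 0 <= b.
  by have := diam x x; rewrite subrr abs0; apply; apply: eZ; rewrite subrr abs0.
have hZ' k z : Z z -> Z (iter k h z) by move=> Zz; elim: k => //= j; apply: hZ.
have close j z : Z z -> abs (iter (p ^ j) h z - z) <= q ^+ j * b.
  elim: j z => [|j IH] z Zz; first by rewrite expr0 mul1r expn0; apply: diam => //;
    apply: hZ.
  rewrite expnS iterM exprS -mulrA.
  apply: le_trans (near_identity_iter (Z := Z) (d := d') (b := q ^+ j * b) _ _ _ _ _) _ => //.
  - by move=> u; apply: hZ'.
  - have hlip1 u v : Z u -> Z v -> abs (h u - h v - 1 * (u - v)) <= d' * abs (u - v).
      by rewrite mul1r; apply: hlip.
    move=> u v Zu Zv; have := affine_iter hZ (abs1 abs) d'01 hlip1 (p ^ j) Zu Zv.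
    by rewrite expr1n mul1r.
have p1 : (1 < p)%N.
  rewrite ltn_neqAle (padic_p_gt0 abs) andbT; apply: contraTneq (padic_p_lt1 abs) => p1.
  by rewrite (_ : p%:R = 1) ?abs1 ?ltxx // -p1.
have iterE k z : Z z -> iter (k * m) (ratmap R) (Some z) = Some (iter k g z).
  move=> Zz; elim: k => // k IH; rewrite mulSn iterD IH.
  have [|-> _ //] := gE (iter k g z).
  by elim: k {IH} => //= k; apply: gZ.
have [r r0 rE] := chordal_small abs x e0.
exists (fun j => (p ^ j * M * m)%N), [set w | chordal abs (Some x) w < r]; split.
- move=> A [N _ NA]; exists N => // j /= Nj; apply: NA => /=.
  apply: (leq_trans Nj); apply: (leq_trans (ltnW (ltn_expl j p1))).
  by rewrite -mulnA leq_pmulr // muln_gt0 M0.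
- by exists r.
move=> t t0; have [j0 qj0] : exists j0, q ^+ j0 * b < t.
  have [b00|b00] := eqVneq b 0; first by exists 0%N; rewrite b00 mulr0.
  have bp : 0 < b by rewrite lt0r b00.
  have [||j0 hj0] := @expr_small _ q (t / b); rewrite ?q0 ?divr_gt0 //.
  by exists j0; rewrite -ltr_pdivlMr.
exists j0 => // j /= jj0 w /rE[z -> /eZ Zz].
rewrite iterE // iterM; apply: le_lt_trans (chordal_Some_le _ _ _) _.
apply: le_lt_trans (close j z Zz) _; apply: le_lt_trans qj0.
by rewrite ler_wpM2r // ler_wiXn2l // ltW.
Qed.

End NearRotation.

(** * Affinoids *)

Section Affinoids.
Context (RR : realType) (K : fieldType) (abs : nonarchAbs RR K).
Implicit Types (a b u x y z : K) (v : proj_line K) (r : RR) (A C E : set (proj_line K)).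

Lemma is_diskC_center r a b : abs (b - a) < r -> diskC abs r a = diskC abs r b.
Proof.
move=> ba; apply/seteqP; split=> z /= h; last exact: abs_dist_lt h ba.
by apply: (abs_dist_lt h); rewrite abs_distC.
Qed.

(** A bounded [G] that reaches a point at distance at least [r] from [u] contains the whole ball
    around [a]; the complement of a disc or ball centred at [c] can only lose the class of [c]. *)
Let ball_or_disk_avoid G a r u v : Defs.is_ballP abs G \/ is_diskP abs G ->
  G (Some u) -> abs (u - a) <= r -> G v -> (forall y, v = Some y -> r <= abs (y - u)) ->
  exists b, forall z, abs (z - a) <= r -> r <= abs (z - b) -> G (Some z).
Proof.
move=> GP Gu ua Gv vu.
have zu z : abs (z - a) <= r -> abs (z - u) <= r.
  by move=> za; apply: (abs_dist_le za); rewrite abs_distC.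
have Some_in (A : set K) w :
    (~` (Some @` A)) (Some w) <-> ~ A w.
  split; first by move=> h Aw; apply: h; exists w.
  by move=> h [w' Aw' [ww']]; apply: h; rewrite -ww'.
case: GP => [[s [A [[[_ [c ->]] GE]|[[_ [c ->]] GE]]]]|[s [A [[[_ [c ->]] GE]|[[_ [c ->]] GE]]]]];
  rewrite GE in Gu Gv *.
- case: Gu => u' /= u'c [uu']; rewrite uu' in u'c.
  case: Gv => y /= yc vy; have := vu y (esym vy) => ry.
  exists a => z za _; exists z => //=; apply: (abs_dist_le _ u'c).
  apply: le_trans (zu _ za) (le_trans ry _).
  by apply: (abs_dist_le yc); rewrite abs_distC.
- exists c => z za rz; apply/Some_in => /= zc.
  move/Some_in: Gu; apply => /=.
  by apply: (@abs_dist_lt _ _ _ z _ _ _ _ zc); rewrite abs_distC;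
    apply: le_lt_trans (zu _ za) (le_lt_trans rz zc).
- case: Gu => u' /= u'c [uu']; rewrite uu' in u'c.
  case: Gv => y /= yc vy; have := vu y (esym vy) => ry.
  exists a => z za _; exists z => //=; apply: (abs_dist_lt _ u'c).
  apply: le_lt_trans (zu _ za) (le_lt_trans ry _).
  by apply: (abs_dist_lt yc); rewrite abs_distC.
- exists c => z za rz; apply/Some_in => /= zc.
  move/Some_in: Gu; apply => /=.
  by apply: (@abs_dist_le _ _ _ z _ _ _ _ zc); rewrite abs_distC;
    apply: le_trans (zu _ za) (le_trans rz zc).
Qed.

Lemma affinoid_cofinite A a r u v : connected_affinoid abs A ->
  A (Some u) -> abs (u - a) <= r -> A v -> (forall y, v = Some y -> r <= abs (y - u)) ->
  exists bs : seq K, forall z, abs (z - a) <= r ->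
    (forall b, b \in bs -> r <= abs (z - b)) -> A (Some z).
Proof.
move=> [_ AP] Au ua Av vu.
have [F [finF FP AE]] : exists F : set (set (proj_line K)),
    [/\ finite_set F, (forall G, F G -> Defs.is_ballP abs G \/ is_diskP abs G)
      & A = \bigcap_(B in F) B].
  by case: AP => -[F [fF FP AE]]; exists F; split => // G /FP; [left|right].
have FA G : F G -> A `<=` G by move=> FG; rewrite AE => w; apply.
have [h hG] : {h : set (proj_line K) -> K & forall G, F G ->
    forall z, abs (z - a) <= r -> r <= abs (z - h G) -> G (Some z)}.
  apply: (@choice _ _ (fun G b => F G ->
    forall z, abs (z - a) <= r -> r <= abs (z - b) -> G (Some z))) => G.
  have [FG|nFG] := pselect (F G); last by exists a.
  have [b bG] := ball_or_disk_avoid (FP _ FG) (FA _ FG _ Au) ua (FA _ FG _ Av) vu.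
  by exists b.
have [s Fs] := (finite_seqP F).1 finF.
exists (map h s) => z za zb; rewrite AE => G FG; apply: hG => //.
by apply: zb; apply: map_f; move: FG; rewrite Fs.
Qed.

Lemma ball_minus_discs_affinoid a r (bs : seq K) z0 : value_group abs r ->
  abs (z0 - a) <= r -> (forall b, b \in bs -> r <= abs (z0 - b)) ->
  connected_affinoid abs
    (Some @` [set z | abs (z - a) <= r /\ forall b, b \in bs -> r <= abs (z - b)]).
Proof.
move=> vr z0a z0b; split; first by exists (Some z0), z0.
left; exists [set` (Some @` ballC abs r a) :: [seq ~` (Some @` diskC abs r b) | b <- bs]].
split.
- exact: finite_seq.
- move=> G /=; rewrite inE => /orP[/eqP ->|/mapP[b bbs ->]].
    by exists r, (ballC abs r a); left; split => //; split => //; exists a.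
  by exists r, (diskC abs r b); right; split => //; split => //; exists b.
apply/seteqP; split.
  move=> w [z [za zb] <-] G /=; rewrite inE => /orP[/eqP ->|/mapP[b bbs ->]].
    by exists z.
  by move=> [z' /= z'b [zz']]; have := zb b bbs; rewrite -zz' leNgt z'b.
move=> w wG; have [z /= za zw] := wG (Some @` ballC abs r a) (mem_head _ _).
exists z => //; split => // b bbs; rewrite leNgt; apply/negP => zb.
have := wG (~` (Some @` diskC abs r b)); rewrite /= inE (map_f (fun b => ~` _)) ?orbT //.
by apply => //; exists z.
Qed.

Lemma annulus_affinoid a r s z0 : value_group abs r -> value_group abs s ->
  s < abs (z0 - a) < r -> connected_affinoid abs (Some @` [set z | s < abs (z - a) < r]).
Proof.
move=> vr vs z0a; split; first by exists (Some z0), z0.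
right; exists [set Some @` diskC abs r a; ~` (Some @` ballC abs s a)]; split.
- exact: finite_set2.
- move=> G [->|->].
    by exists r, (diskC abs r a); left; split => //; split => //; exists a.
  by exists s, (ballC abs s a); right; split => //; split => //; exists a.
apply/seteqP; split.
  move=> w [z /= /andP[sz zr] <-] G [->|->]; first by exists z.
  by move=> [z' /= z's [zz']]; rewrite -zz' ltNge z's in sz.
move=> w wG; have [z /= za zw] := wG _ (or_introl erefl).
exists z => //=; rewrite za andbT ltNge; apply/negP => zs.
by apply: (wG _ (or_intror erefl)); exists z.
Qed.

Lemma disc_affinoid a r : value_group abs r ->
  connected_affinoid abs (Some @` diskC abs r a).
Proof.
move=> vr; have r0 : 0 < r by case: vr => c /= c0 <-; rewrite abs_gt0.
split; first by exists (Some a), a => //; rewrite /diskC /= subrr abs0.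
right; exists [set Some @` diskC abs r a]; split; first exact: finite_set1.
  by move=> G ->; exists r, (diskC abs r a); left; split => //; split => //; exists a.
by rewrite bigcap_set1.
Qed.

Lemma analytic_component_sub E C : analytic_component abs E C -> C `<=` E.
Proof. by move=> [x _ ->] w [A [_ _ AE] Aw]; apply: AE. Qed.

Lemma analytic_component_max E C A : analytic_component abs E C -> C !=set0 ->
  connected_affinoid abs A -> A `<=` E -> C `<=` A -> A `<=` C.
Proof.
move=> [x Ex ->] [w [B [cB Bx BE] Bw]] cA AE CA y Ay; exists A => //; split => //.
by apply: CA; exists B.
Qed.

End Affinoids.

(** * The perturbed map *)

Section Perturbation.
Context (RR : realType) (p : nat) (K : fieldType) (abs : padicAbs RR p K).
Context (R Q : {fraction {poly K}}) (n : nat) (a : nat -> K) (rho : nat -> RR).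
Context (sigma : RR) (eps : K).
Implicit Types (z w x y c : K) (m i : nat).

Let value (F : {fraction {poly K}}) i z : K :=
  finval (fun z => iter i (ratmap F) (Some z)) z.
Let g := value R 1.
Let d z : K := eps / (z - a 0%N).

Hypothesis n_gt0 : (0 < n)%N.
Hypothesis a_per : forall m k, m = k %[mod n] -> a m = a k.
Hypothesis rho_per : forall m k, m = k %[mod n] -> rho m = rho k.
Hypothesis rho_gt0 : forall m, 0 < rho m.
Hypotheses (sigma_gt0 : 0 < sigma) (sigma_lt1 : sigma < 1).
Hypothesis R_fin : forall m z, abs (z - a m) < rho m -> ratmap R (Some z) = Some (g z).
Hypothesis R_sim : forall m z w, abs (z - a m) < rho m -> abs (w - a m) < rho m ->
  abs (g z - g w) = rho m.+1 / rho m * abs (z - w).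
Hypothesis R_center : forall m, abs (g (a m) - a m.+1) <= sigma * rho m.+1.
Hypothesis QE : forall z, z != a 0%N -> ratmap Q (Some z) =
  if ratmap R (Some z) is Some w then Some (w + d z) else None.
Hypothesis abs_eps : abs eps = sigma ^+ 2 * rho 0%N * rho 1%N.
Hypothesis rho_min : forall m, rho 0%N <= rho m.
Hypothesis dist_rho : forall m, ~~ (n %| m)%N ->
  rho m <= abs (a m - a 0%N) /\ rho 1%N <= abs (a m - a 0%N).

Let kap m := rho m.+1 / rho m.

Let kap_gt0 m : 0 < kap m. Proof. by rewrite divr_gt0. Qed.

Let kap_rho m s : kap m * (s * rho m) = s * rho m.+1.
Proof. by rewrite /kap; field; rewrite gt_eqF. Qed.

Let kap_rho1 m : kap m * rho m = rho m.+1.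
Proof. by rewrite /kap divfK // gt_eqF. Qed.

Let per0 m : (n %| m)%N -> [/\ a m = a 0%N, rho m = rho 0%N & rho m.+1 = rho 1%N].
Proof.
move=> /eqP m0; split; [apply: a_per|apply: rho_per|apply: rho_per];
  by rewrite ?mod0n // -addn1 -modnDml m0.
Qed.

Let value1 F z w : ratmap F (Some z) = Some w -> value F 1 z = w.
Proof. by rewrite /value /finval /= => ->. Qed.

(* [z] lies at stage [m] at relative distance at least [t] from the pole of the
   perturbation. *)
Let far m t z : Prop := if (n %| m)%N then t * rho m <= abs (z - a 0%N)
  else abs (a m - a 0%N) <= abs (z - a 0%N).

Let far_neq m t z : 0 < t -> far m t z -> z != a 0%N.
Proof.
move=> t0; rewrite /far => h; apply/eqP => za; move: h; rewrite za subrr abs0.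
case: ifP => [_|/negbT /dist_rho[h _]]; rewrite leNgt ?mulr_gt0 //.
by rewrite (lt_le_trans _ h).
Qed.

(** At the stages of the pole, [abs eps] is divided by at least [t * rho 0]. At the others
    [dist_rho] gives a denominator of at least [rho 1], which leaves [sigma ^ 2 * rho 0], and
    [rho 0] is the least radius. *)
Let pert_bound m t z : 0 < t <= 1 -> far m t z ->
  abs (d z) <= sigma ^+ 2 / t * rho m.+1.
Proof.
move=> /andP[t0 t1] fz; have za := far_neq t0 fz.
have za0 : 0 < abs (z - a 0%N) by rewrite abs_gt0 subr_eq0.
rewrite /d absM absV ler_pdivrMr // abs_eps; move: fz; rewrite /far; case: ifP.
  move=> /per0[_ -> ->] h.
  have -> : sigma ^+ 2 * rho 0%N * rho 1%N = sigma ^+ 2 / t * rho 1%N * (t * rho 0%N).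
    by field; rewrite gt_eqF.
  by rewrite ler_wpM2l //; positivity.
move=> /negbT /dist_rho[_ h1] h.
have -> : sigma ^+ 2 * rho 0%N * rho 1%N = sigma ^+ 2 * (rho 0%N * rho 1%N) by ring.
have -> : sigma ^+ 2 / t * rho m.+1 * abs (z - a 0%N) =
  sigma ^+ 2 * (t^-1 * rho m.+1 * abs (z - a 0%N)) by ring.
apply: ler_wpM2l; first by positivity.
apply: ler_pM; [by positivity|by positivity| |exact: le_trans h].
by apply: le_trans (rho_min m.+1) _; rewrite ler_peMl ?(ltW (rho_gt0 _)) // invf_ge1.
Qed.

(** The difference has the denominator [(z - a 0) * (w - a 0)]. Off the disc of the pole one factor
    is compared with [rho 1] and the other with [rho m], the two bounds of [dist_rho]. *)
Let pert_lip m t z w : 0 < t <= 1 -> far m t z -> far m t w ->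
  abs (d z - d w) <= (sigma / t) ^+ 2 * kap m * abs (z - w).
Proof.
move=> /andP[t0 t1] fz fw; have za := far_neq t0 fz; have wa := far_neq t0 fw.
have za0 : 0 < abs (z - a 0%N) by rewrite abs_gt0 subr_eq0.
have wa0 : 0 < abs (w - a 0%N) by rewrite abs_gt0 subr_eq0.
have -> : d z - d w = eps / ((z - a 0%N) * (w - a 0%N)) * (w - z).
  by rewrite /d; field; rewrite !subr_eq0 za wa.
rewrite absM [abs (w - z)]abs_distC ler_wpM2r ?abs_ge0 // absM absV absM.
rewrite ler_pdivrMr ?mulr_gt0 // abs_eps; move: fz fw; rewrite /far; case: ifP.
  move=> /[dup] /per0[_ -> r1] m0 hz hw.
  have -> : sigma ^+ 2 * rho 0%N * rho 1%N =
      (sigma / t) ^+ 2 * kap m * (t * rho 0%N * (t * rho 0%N)).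
    have [_ r0 _] := per0 m0; rewrite /kap r1 r0; field.
    by rewrite !gt_eqF.
  apply: ler_wpM2l; first by positivity.
  by apply: ler_pM => //; positivity.
move=> /negbT /dist_rho[h1 h2] hz hw.
have h3 : rho 1%N * rho m <= abs (z - a 0%N) * abs (w - a 0%N).
  by rewrite ler_pM ?(ltW (rho_gt0 _)) //; [exact: le_trans hz|exact: le_trans hw].
have h4 : sigma ^+ 2 <= (sigma / t) ^+ 2.
  rewrite lerXn2r ?nnegrE; [|by positivity|by positivity|].
    by [].
  by rewrite ler_peMr ?(ltW sigma_gt0) // invf_ge1.
apply: le_trans (_ : (sigma / t) ^+ 2 * (kap m * (rho 1%N * rho m)) <= _); last first.
  rewrite -[leRHS]mulrA; apply: ler_wpM2l; first by positivity.
  by rewrite ler_wpM2l ?(ltW (kap_gt0 _)).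
have -> : kap m * (rho 1%N * rho m) = rho m.+1 * rho 1%N.
  by rewrite /kap; field; rewrite gt_eqF.
rewrite -mulrA; apply: ler_pM => //; [by positivity|by positivity|].
by rewrite ler_wpM2r ?(ltW (rho_gt0 _)).
Qed.

(** * The annuli and the circles in them *)

Let Cm m : set K := [set z | sigma * rho m < abs (z - a m) < rho m].

Let ratio m z := abs (z - a m) / rho m.

Let ratioE m z : ratio m z * rho m = abs (z - a m).
Proof. by rewrite /ratio divfK ?gt_eqF. Qed.

Let ratio_itv m z : Cm m z -> sigma < ratio m z < 1.
Proof. by rewrite /Cm /= /ratio ltr_pdivlMr // ltr_pdivrMr // mul1r. Qed.

Let far_annulus m z t : t * rho m <= abs (z - a m) -> abs (z - a m) < rho m -> far m t z.
Proof.
move=> tz zr; rewrite /far; case: ifP => [/per0[<- _ _] //|/negbT/dist_rho[h _]].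
by rewrite (@abs_dist_dom _ _ _ (a m) z) // (lt_le_trans zr).
Qed.

(** The image of the centre is off by at most [sigma * rho m.+1], which is less than the radius of
    the image of any circle in the annulus. *)
Let R_norm m z : Cm m z -> abs (g z - a m.+1) = kap m * abs (z - a m).
Proof.
move=> /andP[z1 z2]; have aa : abs (a m - a m) < rho m by rewrite subrr abs0.
rewrite -(R_sim z2 aa); apply: abs_dist_domr; rewrite (R_sim z2 aa).
apply: le_lt_trans (R_center m) _.
by rewrite -kap_rho ltr_pM2l.
Qed.

Let q := value Q 1.

Let Q_annulus_val m z : Cm m z -> ratmap Q (Some z) = Some (q z) /\ q z = g z + d z.
Proof.
move=> /[dup] Cz /andP[z1 z2]; have /andP[sr r1] := ratio_itv Cz.
have r0 : 0 < ratio m z := lt_trans sigma_gt0 sr.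
have fz : far m (ratio m z) z by apply: far_annulus; rewrite ?ratioE.
have E : ratmap Q (Some z) = Some (g z + d z) by rewrite QE ?(far_neq r0 fz) // (R_fin z2).
by rewrite /q (value1 E).
Qed.

(** At relative radius [t] the perturbation is at most [sigma ^ 2 / t] times the target radius, and
    [sigma ^ 2 / t < t] exactly when [sigma < t]: this is the inner radius of the annulus. *)
Let Q_annulus_pert m z : Cm m z -> abs (d z) < kap m * abs (z - a m).
Proof.
move=> /[dup] Cz /andP[z1 z2]; have /andP[sr r1] := ratio_itv Cz.
have r0 : 0 < ratio m z := lt_trans sigma_gt0 sr.
have fz : far m (ratio m z) z by apply: far_annulus; rewrite ?ratioE.
apply: le_lt_trans (pert_bound _ fz) _; first by rewrite r0 ltW.
rewrite -ratioE kap_rho ltr_pM2r // ltr_pdivrMr // expr2 ltr_pM ?(ltW sigma_gt0) //.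
Qed.

Let Q_annulus_norm m z : Cm m z -> abs (q z - a m.+1) = kap m * abs (z - a m).
Proof.
move=> Cz; have [_ ->] := Q_annulus_val Cz; rewrite addrAC -(R_norm Cz).
by apply: abs_domD; rewrite R_norm //; apply: Q_annulus_pert.
Qed.

Let Q_annulus_in m z : Cm m z -> Cm m.+1 (q z).
Proof.
move=> /[dup] Cz /andP[z1 z2]; apply/andP; rewrite Q_annulus_norm // -(kap_rho m).
by rewrite -(kap_rho1 m) !ltr_pM2l.
Qed.

Let Q_annulus_sim m z w : Cm m z -> Cm m w -> abs (q z - q w) = kap m * abs (z - w).
Proof.
move=> Cz Cw; have [_ ->] := Q_annulus_val Cz; have [_ ->] := Q_annulus_val Cw.
have [->|zw] := eqVneq z w; first by rewrite !subrr abs0 mulr0.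
have /andP[z1 z2] := Cz; have /andP[w1 w2] := Cw.
have -> : g z + d z - (g w + d w) = (g z - g w) + (d z - d w) by ring.
rewrite -(R_sim z2 w2); apply: abs_domD; rewrite (R_sim z2 w2).
set t := Num.min (ratio m z) (ratio m w).
have st : sigma < t by rewrite lt_min; case/andP: (ratio_itv Cz) => -> _;
  case/andP: (ratio_itv Cw).
have t1 : t <= 1 by rewrite ge_min; case/andP: (ratio_itv Cz) => _ /ltW ->.
have t0 := lt_trans sigma_gt0 st.
have fz : far m t z.
  by apply: far_annulus z2; rewrite -ratioE ler_wpM2r ?(ltW (rho_gt0 _)) // ge_min lexx.
have fw : far m t w.
  by apply: far_annulus w2; rewrite -ratioE ler_wpM2r ?(ltW (rho_gt0 _)) // ge_min lexx orbT.
apply: le_lt_trans (pert_lip _ fz fw) _; first by rewrite t0.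
rewrite ltr_pM2r ?abs_gt0 ?subr_eq0 // gtr_pMl // exprn_ilt1 //; first by positivity.
by rewrite ltr_pdivrMr // mul1r.
Qed.

Let R_onto m c : abs (c - a m.+1) < rho m.+1 ->
  exists2 z, abs (z - a m) < rho m & ratmap R (Some z) = Some c.
Proof.
move=> cm; apply: (disc_onto (abs := abs) (k := kap m) (u := a m) (r := rho m)
  (f := fun z => ratmap R (Some z))) => //.
- by apply: ratlike_ratmap; exact: ratlike_Some.
- by move=> z /R_fin.
- by move=> z w; apply: R_sim.
rewrite -/(kap m) kap_rho1; apply: (abs_dist_lt cm); rewrite abs_distC;
  apply: le_lt_trans (R_center m) _.
by rewrite gtr_pMl.
Qed.

(** [R y = c] is solved first. The open disc around [y] of radius [abs (y - a m)] lies on a single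
    circle, and the perturbation is too small to push [c] out of its image under [Q]. *)
Let Q_annulus_onto m c : Cm m.+1 c -> exists2 z, Cm m z & ratmap Q (Some z) = Some c.
Proof.
move=> /andP[c1 c2]; have [y ym gy] := R_onto c2.
have gyc : g y = c := value1 gy.
have yE : abs (c - a m.+1) = kap m * abs (y - a m).
  have aa : abs (a m - a m) < rho m by rewrite subrr abs0.
  have := R_sim ym aa; rewrite gyc -/(kap m) => <-; symmetry; apply: abs_dist_domr.
  by rewrite abs_distC; apply: le_lt_trans (R_center m) c1.
have Cy : Cm m y.
  by apply/andP; rewrite -(ltr_pM2l (kap_gt0 m)) -yE kap_rho.
set s := abs (y - a m).
have s0 : 0 < s by case/andP: Cy => h _; apply: le_lt_trans h; rewrite mulr_ge0 ?ltW.
have UC z : abs (z - y) < s -> Cm m z.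
  by move=> zy; rewrite /Cm /= (@abs_dist_dom _ _ _ y z).
have [z zy Qz] : exists2 z, abs (z - y) < s & ratmap Q (Some z) = Some c.
  apply: (disc_onto (abs := abs) (k := kap m) (f := fun z => ratmap Q (Some z))) => //.
  - by apply: ratlike_ratmap; exact: ratlike_Some.
  - by move=> z /UC /Q_annulus_val[].
  - by move=> z w /UC Cz /UC Cw; apply: Q_annulus_sim.
  have [_ E] := Q_annulus_val Cy; rewrite -[finval _ y]/(q y) E gyc opprD addrA subrr sub0r absN.
  exact: Q_annulus_pert.
by exists z => //; apply: UC.
Qed.

Let v := value Q.

Let v_fin i z w : iter i (ratmap Q) (Some z) = Some w -> v i z = w.
Proof. by rewrite /v /value /finval => ->. Qed.

Let iter_annulus m i z : Cm m z ->
  [/\ iter i (ratmap Q) (Some z) = Some (v i z), v i.+1 z = q (v i z), Cm (m + i) (v i z)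
    & abs (v i z - a (m + i)) = rho (m + i) / rho m * abs (z - a m)].
Proof.
move=> Cz; elim: i => [|i [IH1 IH2 IH3 IH4]].
  rewrite addn0 divff ?gt_eqF // mul1r; split => //.
have [E _] := Q_annulus_val IH3.
have E1 : iter i.+1 (ratmap Q) (Some z) = Some (v i.+1 z) by rewrite /= IH1 E IH2.
have C1 : Cm (m + i.+1) (v i.+1 z) by rewrite addnS IH2; apply: Q_annulus_in.
split => //.
- by apply: v_fin; rewrite iterS E1; have [-> _] := Q_annulus_val C1.
- rewrite addnS IH2 Q_annulus_norm // IH4 /kap; field.
  by rewrite !gt_eqF.
Qed.

Let iter_annulus_sim m i z w : Cm m z -> Cm m w ->
  abs (v i z - v i w) = rho (m + i) / rho m * abs (z - w).
Proof.
move=> Cz Cw; elim: i => [|i IH]; first by rewrite addn0 divff ?gt_eqF ?mul1r.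
have [_ Ez Ciz _] := iter_annulus i Cz; have [_ Ew Ciw _] := iter_annulus i Cw.
rewrite Ez Ew (Q_annulus_sim Ciz Ciw) IH addnS /kap; field.
by rewrite !gt_eqF.
Qed.

Let iter_annulus_onto m i c : Cm (m + i) c ->
  exists2 z, Cm m z & iter i (ratmap Q) (Some z) = Some c.
Proof.
elim: i c => [|i IH] c; first by rewrite addn0 => Cc; exists c.
rewrite addnS => /Q_annulus_onto[w /IH[z Cz zw] wc].
by exists z => //; rewrite iterS zw.
Qed.

Let circle_affine m t : sigma < t < 1 -> exists c (th : RR),
  [/\ abs c = kap m, 0 <= th < 1 & forall z w,
    abs (z - a m) = t * rho m -> abs (w - a m) = t * rho m ->
    abs (q z - q w - c * (z - w)) <= th * kap m * abs (z - w)].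
Proof.
move=> /andP[st t1]; have t0 := lt_trans sigma_gt0 st.
have tr : t * rho m < rho m by rewrite gtr_pMl.
have [||c cE clip] := disc_lipschitz (abs := abs) (rho_gt0 m) (kap_gt0 m)
    (ratlike_ratmap R (ratlike_Some K)) _ (@R_sim m) _ tr.
- by move=> z /R_fin.
- by positivity.
have tt : t * rho m / rho m = t by rewrite mulfK ?gt_eqF.
have st1 : sigma / t < 1 by rewrite ltr_pdivrMr // mul1r.
(* The relative error of the linear approximation of [R] on this ball is [t], and the polar term
   contributes [(sigma / t) ^ 2]; both are less than [1] in the annulus. *)
exists c, (Num.max t ((sigma / t) ^+ 2)); split => //.
  by rewrite le_max (ltW t0) /= gt_max t1 exprn_ilt1 //; positivity.
move=> z w zt wt.
have Cz : Cm m z by rewrite /Cm /= zt ltr_pM2r // st.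
have Cw : Cm m w by rewrite /Cm /= wt ltr_pM2r // st.
have [_ ->] := Q_annulus_val Cz; have [_ ->] := Q_annulus_val Cw.
have -> : g z + d z - (g w + d w) - c * (z - w) =
  (g z - g w - c * (z - w)) + (d z - d w) by ring.
have fz : far m t z by apply: far_annulus; rewrite zt.
have fw : far m t w by apply: far_annulus; rewrite wt.
apply: absD_le.
  apply: le_trans (clip z w _ _) _; rewrite ?zt ?wt // tt -!mulrA.
  by apply: ler_wpM2r; [positivity|rewrite le_max lexx].
apply: le_trans (pert_lip _ fz fw) _; first by rewrite t0 ltW.
apply: ler_wpM2r; first by positivity.
by apply: ler_wpM2r; [positivity|rewrite le_max lexx orbT].
Qed.

Let circle_affine_iter m i t : sigma < t < 1 -> exists c (th : RR),
  [/\ abs c = rho (m + i) / rho m, 0 <= th < 1 & forall z w,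
    abs (z - a m) = t * rho m -> abs (w - a m) = t * rho m ->
    abs (v i z - v i w - c * (z - w)) <= th * (rho (m + i) / rho m) * abs (z - w)].
Proof.
move=> t01; elim: i => [|i [c [th [cE th01 clip]]]].
  exists 1, 0; rewrite abs1 addn0 divff ?gt_eqF // lexx ltr01; split => // z w _ _.
  by rewrite mul1r subrr abs0 mul0r mul0r.
have [c1 [th1 [c1E /andP[th10 th11] c1lip]]] := circle_affine (m + i) t01.
have /andP[th0 th1'] := th01; have r0 := rho_gt0; have k0 := kap_gt0.
have kE : kap (m + i) * (rho (m + i) / rho m) = rho (m + i.+1) / rho m.
  by rewrite addnS /kap; field; rewrite !gt_eqF.
exists (c1 * c), (Num.max th th1); split.
- by rewrite absM cE c1E kE.
- by rewrite le_max th0 gt_max th1' th11.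
move=> z w zt wt.
have /andP[st t1] := t01.
have Cz : Cm m z by rewrite /Cm /= zt ltr_pM2r // st /= gtr_pMl.
have Cw : Cm m w by rewrite /Cm /= wt ltr_pM2r // st /= gtr_pMl.
have [_ -> _ iz] := iter_annulus i Cz; have [_ -> _ iw] := iter_annulus i Cw.
have tE x : abs (x - a m) = t * rho m -> rho (m + i) / rho m * abs (x - a m) = t * rho (m + i).
  by move=> ->; field; rewrite gt_eqF.
rewrite tE // in iz; rewrite tE // in iw.
have -> : q (v i z) - q (v i w) - c1 * c * (z - w) =
  (q (v i z) - q (v i w) - c1 * (v i z - v i w)) + c1 * (v i z - v i w - c * (z - w)) by ring.
have rr0 : 0 <= rho (m + i) / rho m by positivity.
rewrite -kE; apply: absD_le.
  apply: le_trans (c1lip _ _ iz iw) _; rewrite (iter_annulus_sim _ Cz Cw) -!mulrA.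
  by apply: ler_wpM2r; [positivity|rewrite le_max lexx orbT].
rewrite absM c1E; have := ler_wpM2l (ltW (k0 (m + i)%N)) (clip z w zt wt).
move=> /le_trans; apply.
have -> : kap (m + i) * (th * (rho (m + i) / rho m) * abs (z - w)) =
  th * (kap (m + i) * (rho (m + i) / rho m) * abs (z - w)) by ring.
rewrite -!mulrA; apply: ler_wpM2r; [positivity|by rewrite le_max lexx].
Qed.

(** Each circle of the annulus is invariant under [n] steps, with a multiplier of absolute value
    [rho (m + n) / rho m = 1]. *)
Lemma annulus_quasiperiodic m z : Cm m z -> quasiperiodicity abs Q (Some z).
Proof.
move=> Cz; have t01 := ratio_itv Cz; set t := ratio m z in t01.
have [c [th [cE th01 clip]]] := circle_affine_iter m n t01.
have mn : rho (m + n) = rho m by apply: rho_per; rewrite modnDr.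
have am : a (m + n) = a m by apply: a_per; rewrite modnDr.
rewrite mn divff ?gt_eqF // in cE clip; rewrite mulr1 in clip.
have zt : abs (z - a m) = t * rho m by rewrite ratioE.
have /andP[st t1] := t01; have t0 := lt_trans sigma_gt0 st.
have r0 := rho_gt0.
have tr0 : 0 < t * rho m by positivity.
apply: (@quasiperiodic_near_rotation _ _ _ abs Q (v n) [set w | abs (w - a m) = t * rho m]
  n c th (t * rho m) (t * rho m)) => //.
- move=> w /= wt.
  have Cw : Cm m w by rewrite /Cm /= wt ltr_pM2r // st /= gtr_pMl.
  have [-> _ _] := iter_annulus n Cw.
  by rewrite mn am divff ?gt_eqF // mul1r wt.
- move=> x w /= xt wt; apply: (@abs_dist_le _ _ _ (a m)); first by rewrite xt.
  by rewrite abs_distC wt.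
- move=> w wz /=; rewrite -zt; apply: abs_dist_dom.
  by rewrite zt.
Qed.

(** * The discs away from the pole, and the hole *)

Let Dm m : set K := [set z | abs (z - a m) < rho m].

Let a_in m : Dm m (a m). Proof. by rewrite /Dm /= subrr abs0. Qed.

Let Q_disc m z : ~~ (n %| m)%N -> Dm m z ->
  [/\ ratmap Q (Some z) = Some (q z), q z = g z + d z, far m 1 z & Dm m.+1 (q z)].
Proof.
move=> nm zm; have fz : far m 1 z.
  rewrite /far (negPf nm) (@abs_dist_dom _ _ _ (a m) z) //.
  by have [h _] := dist_rho nm; exact: lt_le_trans h.
have E : ratmap Q (Some z) = Some (g z + d z).
  by rewrite QE ?(far_neq ltr01 fz) // (R_fin zm).
have qE : q z = g z + d z by rewrite /q (value1 E).
split => //; first by rewrite E qE.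
have bz : abs (d z) < rho m.+1.
  apply: le_lt_trans (pert_bound _ fz) _; first by rewrite ltr01 lexx.
  by rewrite divr1 gtr_pMl // exprn_ilt1 // ltW.
rewrite /Dm /= qE addrAC; apply: absD_lt bz; apply: (@abs_dist_lt _ _ _ (g (a m))).
  rewrite (R_sim zm (a_in m)) -/(kap m) -[X in _ < X](kap_rho1 m).
  by rewrite ltr_pM2l.
by apply: le_lt_trans (R_center m) _; rewrite gtr_pMl.
Qed.

Let Q_disc_sim m z w : ~~ (n %| m)%N -> Dm m z -> Dm m w ->
  abs (q z - q w) = kap m * abs (z - w).
Proof.
move=> nm zm wm; have [_ -> fz _] := Q_disc nm zm; have [_ -> fw _] := Q_disc nm wm.
have [->|zw] := eqVneq z w; first by rewrite !subrr abs0 mulr0.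
have -> : g z + d z - (g w + d w) = (g z - g w) + (d z - d w) by ring.
rewrite -(R_sim zm wm); apply: abs_domD; rewrite (R_sim zm wm).
apply: le_lt_trans (pert_lip _ fz fw) _; first by rewrite ltr01 lexx.
rewrite divr1 ltr_pM2r ?abs_gt0 ?subr_eq0 // gtr_pMl // exprn_ilt1 //.
exact: ltW.
Qed.

Let Q_disc_center m : ~~ (n %| m)%N -> abs (q (a m) - a m.+1) <= sigma * rho m.+1.
Proof.
move=> nm; have [_ -> fa _] := Q_disc nm (a_in m); rewrite addrAC; apply: absD_le => //.
apply: le_trans (pert_bound _ fa) _; first by rewrite ltr01 lexx.
rewrite divr1 expr2 ler_wpM2r //; first exact: ltW.
by rewrite ger_pMl // ltW.
Qed.

Let Q_disc_onto m c : ~~ (n %| m)%N -> Dm m.+1 c ->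
  exists2 z, Dm m z & ratmap Q (Some z) = Some c.
Proof.
move=> nm cm; apply: (disc_onto (abs := abs) (k := kap m) (u := a m) (r := rho m)
  (f := fun z => ratmap Q (Some z))) => //.
- by apply: ratlike_ratmap; exact: ratlike_Some.
- by move=> z zm; have [] := Q_disc nm zm.
- by move=> z w zm wm; apply: Q_disc_sim.
rewrite kap_rho1; apply: (abs_dist_lt cm); rewrite abs_distC.
by apply: le_lt_trans (Q_disc_center nm) _; rewrite gtr_pMl.
Qed.

(** Before the next stage divisible by [n] the discs stay clear of the pole, so [Q] is a similarity
    on the full discs and carries the hole of stage [m] to the hole around the pole. *)
Let disc_iter m i : (forall k, (k < i)%N -> ~~ (n %| m + k)%N) ->
  [/\ forall z, Dm m z -> iter i (ratmap Q) (Some z) = Some (v i z) /\ Dm (m + i) (v i z),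
      forall z w, Dm m z -> Dm m w -> abs (v i z - v i w) = rho (m + i) / rho m * abs (z - w),
      abs (v i (a m) - a (m + i)) <= sigma * rho (m + i)
    & forall c, Dm (m + i) c -> exists2 z, Dm m z & v i z = c].
Proof.
elim: i => [|i IH] nmi.
  rewrite addn0 divff ?gt_eqF // subrr abs0; split => //.
  - by move=> z w _ _; rewrite mul1r.
  - by positivity.
  - by move=> c; exists c.
have [|IH1 IH2 IH3 IH4] := IH; first by move=> k ki; apply: nmi; rewrite ltnS ltnW.
have nm : ~~ (n %| m + i)%N by apply: nmi.
have step z : Dm m z -> iter i.+1 (ratmap Q) (Some z) = Some (v i.+1 z) /\ v i.+1 z = q (v i z).
  move=> zm; have [E Dz] := IH1 z zm; have [E1 _ _ _] := Q_disc nm Dz.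
  have E2 : iter i.+1 (ratmap Q) (Some z) = Some (q (v i z)) by rewrite iterS E E1.
  by rewrite (v_fin E2).
have sim1 z w : Dm m z -> Dm m w ->
    abs (v i.+1 z - v i.+1 w) = rho (m + i.+1) / rho m * abs (z - w).
  move=> zm wm; have [_ ->] := step z zm; have [_ ->] := step w wm.
  have [_ Dz] := IH1 z zm; have [_ Dw] := IH1 w wm.
  rewrite (Q_disc_sim nm Dz Dw) IH2 // addnS /kap; field.
  by rewrite !gt_eqF.
split => //.
- move=> z zm; have [E qE] := step z zm; split => //; have [_ Dz] := IH1 z zm.
  by rewrite addnS qE; have [] := Q_disc nm Dz.
- have [_ ->] := step _ (a_in m); rewrite addnS.
  apply: abs_dist_le (Q_disc_center nm); have [_ Da] := IH1 _ (a_in m).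
  rewrite (Q_disc_sim nm Da (a_in _)) -kap_rho ler_wpM2l //.
  by rewrite ltW.
- move=> c; rewrite addnS => /(Q_disc_onto nm)[y /IH4[z zm zy] yc].
  exists z => //; have [_ ->] := step z zm; rewrite zy.
  by rewrite /q (value1 yc).
Qed.

(* [Q] is not injective on the ball bounding the hole at stage [0]: there it is
   [g (z) + eps / (z - a 0)], and the points with [c (u - a 0) (v - a 0) = eps],
   [c] the derivative of [g], have too close images. *)
Lemma hole_not_quasiperiodic m (bs : seq K) :
  ~ (forall z, abs (z - a m) <= sigma * rho m ->
      (forall b, b \in bs -> sigma * rho m <= abs (z - b)) -> quasiperiodicity abs Q (Some z)).
Proof.
move=> cof.
have [i mi nmi] : exists2 i, (n %| m + i)%N & forall k, (k < i)%N -> ~~ (n %| m + k)%N.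
  have ex : exists i, (n %| m + i)%N.
    exists (n - m %% n)%N; rewrite {1}(divn_eq m n) -addnA subnKC ?dvdn_addr ?dvdn_mull //.
    by rewrite ltnW // ltn_mod.
  case: (ex_minnP ex) => i mi min_i; exists i => // k ki.
  by apply/negP => /min_i; rewrite leqNgt ki.
have [iv isim icen ionto] := disc_iter nmi.
have [a0 rho0 rho1] := per0 mi.
set X := [set z | abs (z - a m) <= sigma * rho m /\
                  forall b, b \in bs -> sigma * rho m <= abs (z - b)].
have sr : sigma * rho m < rho m by rewrite gtr_pMl.
have sr0 : 0 < sigma * rho m by positivity.
set kk := rho (m + i.+1) / rho m.
have kk0 : 0 < kk by rewrite /kk; positivity.
set f := fun z => iter i.+1 (ratmap Q) (Some z).
have XE z : X z -> quasiperiodicity abs Q (Some z) by move=> [za zb]; apply: cof.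
(* Rigidity, with the hole as ball and the annulus around it, continues the similarity to all of
   [X]; the rest of the proof refutes this. *)
have simX z w : X z -> X w -> abs (finval f z - finval f w) = kk * abs (z - w).
  move=> Xz Xw.
  apply: (@rigidity_similarity _ _ _ abs f (a m) (a (m + i.+1)) (sigma * rho m) (rho m) kk X) => //.
  - by apply: ratlike_iter; exact: ratlike_Some.
  - by move=> x [].
  - move=> x y [xa xb] yx; split; first by apply: (abs_dist_le (ltW yx)).
    move=> b bbs; rewrite (@abs_dist_dom _ _ _ x) ?xb //.
    exact: lt_le_trans yx (xb b bbs).
  - move=> x y XYx XYy xy; apply: Some_inj.
    apply: (quasiperiodic_iter_inj (abs := abs) (R := Q) (m := i.+1)) => //.
      by case: XYx => [/XE|/annulus_quasiperiodic].
    by case: XYy => [/XE|/annulus_quasiperiodic].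
  - by move=> x Yx; have [] := iter_annulus i.+1 Yx.
  - by move=> x Yx; have [_ _ _] := iter_annulus i.+1 Yx.
  - by move=> x y Yx Yy; apply: (iter_annulus_sim i.+1).
  - move=> c; rewrite /kk => c1; apply: (@iter_annulus_onto m i.+1).
    rewrite /Cm /=; move: c1.
    have -> : rho (m + i.+1) / rho m * (sigma * rho m) = sigma * rho (m + i.+1).
      by field; rewrite gt_eqF.
    by rewrite divfK ?gt_eqF.
  - by left.
have vf z : finval f z = v i.+1 z by [].
have s0r : sigma * rho 0%N < rho 0%N by rewrite gtr_pMl.
have [||c cE clip] := disc_lipschitz (abs := abs) (rho_gt0 0) (kap_gt0 0)
    (ratlike_ratmap R (ratlike_Some K)) _ (@R_sim 0) _ s0r.
- by move=> z /R_fin.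
- by positivity.
rewrite mulfK ?gt_eqF // in clip.
have c0 : c != 0 by rewrite -(abs_gt0 abs) cE.
have eps0 : eps != 0 by rewrite -(abs_gt0 abs) abs_eps; positivity.
have [w0 w0E] := padic_nth_root abs (eps / c) (isT : (0 < 2)%N).
have absw0 : abs w0 = sigma * rho 0%N.
  apply/eqP; rewrite -(@eqrXn2 _ 2) ?abs_ge0 //; last by positivity.
  rewrite -absX w0E absM absV cE abs_eps /kap; apply/eqP; field.
  by rewrite !gt_eqF.
have w00 : w0 != 0 by rewrite -(abs_gt0 abs) absw0; positivity.
(* The involution that exchanges two points with the same value of the model [c w + eps / w], where
   [w = z - a 0]; its fixed points are [a 0 + w0] and [a 0 - w0]. *)
pose inv z := a 0%N + eps / (c * (z - a 0%N)).
set bs0 := [seq v i b | b <- bs].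
(* Avoiding [a 0] puts [v1] on the sphere, avoiding the fixed points makes its partner [u] a
   different point, and avoiding the partners of the removed points keeps [u] out of the removed
   classes. *)
have [v1 v1a v1b] := ball_avoid abs (a 0%N)
  ([:: a 0%N, a 0%N + w0, a 0%N - w0 & bs0 ++ [seq inv b | b <- bs0]]) w00.
have v1a0 : abs (v1 - a 0%N) = abs w0.
  by apply/eqP; rewrite eq_le v1a v1b // mem_head.
have v1n : v1 - a 0%N != 0 by rewrite -(abs_gt0 abs) v1a0 abs_gt0.
have inv_abs z : abs (z - a 0%N) = abs w0 -> abs (inv z - a 0%N) = abs w0.
  move=> za; rewrite /inv addrAC subrr add0r absM absV absM za.
  have -> : abs eps / (abs c * abs w0) = abs (eps / c) / abs w0.
    by rewrite absM absV; field; rewrite !gt_eqF ?abs_gt0.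
  by rewrite -w0E absX expr2 mulfK // gt_eqF // abs_gt0.
set u := inv v1.
have ua0 : abs (u - a 0%N) = abs w0 by apply: inv_abs.
have un : u - a 0%N != 0 by rewrite -(abs_gt0 abs) ua0 abs_gt0.
have uvE : (u - a 0%N) * (v1 - a 0%N) = eps / c.
  by rewrite /u /inv; field; rewrite c0 v1n.
have uv : u != v1.
  apply/eqP => uv; have := uvE; rewrite uv -expr2 -w0E => /eqP;
    rewrite eqf_sqr => /orP[]/eqP h.
    have := v1b (a 0%N + w0); rewrite !inE eqxx orbT => /(_ isT).
    rewrite (_ : v1 - (a 0%N + w0) = 0) ?abs0 1?leNgt ?abs_gt0 ?w00 //.
    by rewrite opprD addrA h subrr.
  have := v1b (a 0%N - w0); rewrite !inE eqxx !orbT => /(_ isT).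
  rewrite (_ : v1 - (a 0%N - w0) = 0) ?abs0 1?leNgt ?abs_gt0 ?w00 //.
  by rewrite opprB addrCA h subrr.
have lift y : abs (y - a 0%N) = abs w0 -> (forall b, b \in bs0 -> abs w0 <= abs (y - b)) ->
    exists z, [/\ X z, v i z = y & iter i (ratmap Q) (Some z) = Some y].
  move=> ya yb; have Dy : Dm (m + i) y by rewrite /Dm /= a0 rho0 ya absw0.
  have [z zm zy] := ionto _ Dy.
  have [iz _] := iv z zm; rewrite zy in iz; exists z; split => //; split.
    have -> : abs (z - a m) = rho m / rho (m + i) * abs (v i z - v i (a m)).
      by rewrite isim //; field; rewrite !gt_eqF.
    rewrite -ler_pdivlMl; last by positivity.
    have -> : (rho m / rho (m + i))^-1 * (sigma * rho m) = sigma * rho (m + i).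
      by field; rewrite !gt_eqF.
    rewrite zy; apply: (@abs_dist_le _ _ _ (a (m + i))); last by rewrite abs_distC.
    by rewrite a0 ya absw0 rho0.
  move=> b bbs; have [bm|bm] := ltP (abs (b - a m)) (rho m).
    have -> : abs (z - b) = rho m / rho (m + i) * abs (v i z - v i b).
      by rewrite isim //; field; rewrite !gt_eqF.
    rewrite -ler_pdivrMl; last by positivity.
    have -> : (rho m / rho (m + i))^-1 * (sigma * rho m) = abs w0.
      by rewrite absw0 rho0; field; rewrite !gt_eqF.
    by rewrite zy yb // map_f.
  have -> : abs (z - b) = abs (b - a m).
    rewrite abs_distC; apply: abs_dist_domr; rewrite abs_distC.
    exact: lt_le_trans zm bm.
  exact: le_trans (ltW sr) bm.
have v1bs b : b \in bs0 -> abs w0 <= abs (v1 - b).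
  by move=> bb; apply: v1b; rewrite !inE mem_cat bb !orbT.
have ubs b : b \in bs0 -> abs w0 <= abs (u - b).
  move=> bb; rewrite leNgt; apply/negP => ub.
  have ba : abs (b - a 0%N) = abs w0.
    by rewrite -ua0; apply: abs_dist_dom; rewrite abs_distC ua0.
  have bn : b - a 0%N != 0 by rewrite -(abs_gt0 abs) ba abs_gt0.
  have := v1b (inv b); rewrite !inE mem_cat map_f ?orbT // => /(_ isT).
  have E : v1 - inv b = (u - a 0%N) * (v1 - a 0%N) * (b - u) / ((u - a 0%N) * (b - a 0%N)).
    have -> : inv b = a 0%N + (u - a 0%N) * (v1 - a 0%N) / (b - a 0%N).
      by rewrite uvE /inv; field; rewrite c0 bn.
    by field; rewrite un bn.
  rewrite E 2!absM absV !absM ua0 v1a0 ba [abs (b - u)]abs_distC.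
  have -> : abs w0 * abs w0 * abs (u - b) / (abs w0 * abs w0) = abs (u - b).
    by field; rewrite gt_eqF // abs_gt0.
  by rewrite leNgt ub.
have [zu [Xu vu iu]] := lift u ua0 ubs.
have [zv [Xv vv iv']] := lift v1 v1a0 v1bs.
have far0 y : abs (y - a 0%N) = abs w0 -> ratmap Q (Some y) = Some (g y + d y).
  move=> ya; have yn : y != a 0%N by rewrite -subr_eq0 -(abs_gt0 abs) ya abs_gt0.
  by rewrite QE // (@R_fin 0) // ya absw0.
have fu : finval f zu = g u + d u by rewrite /f /finval iterS iu far0.
have fv : finval f zv = g v1 + d v1 by rewrite /f /finval iterS iv' far0.
have uv0 : 0 < abs (u - v1) by rewrite abs_gt0 subr_eq0.
have Duz z : X z -> Dm m z by move=> [zz _]; apply: le_lt_trans zz sr.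
have := simX zu zv Xu Xv; rewrite fu fv.
have -> : kk * abs (zu - zv) = kap 0 * abs (u - v1).
  have := isim zu zv (Duz _ Xu) (Duz _ Xv); rewrite vu vv => ->.
  rewrite /kk addnS rho1 rho0 /kap; field.
  by rewrite !gt_eqF.
(* As [c (u - a 0) (v1 - a 0) = eps], the polar terms cancel the linear part of [R]. What remains is
   smaller, by the factor [sigma], than the similarity demands. *)
have -> : g u + d u - (g v1 + d v1) = g u - g v1 - c * (u - v1).
  have -> : d u = c * (v1 - a 0%N).
    have -> : v1 - a 0%N = eps / c / (u - a 0%N) by rewrite -uvE mulrC mulKf.
    by rewrite /d; field; rewrite c0 un.
  have -> : d v1 = c * (u - a 0%N).
    have -> : u - a 0%N = eps / c / (v1 - a 0%N) by rewrite -uvE mulfK.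
    by rewrite /d; field; rewrite c0 v1n.
  by ring.
move=> E; have := clip u v1; rewrite ua0 v1a0 absw0 => /(_ (lexx _) (lexx _)).
rewrite E leNgt => /negP; apply; rewrite ltr_pM2r // gtr_pMl //.
Qed.

(** * The outer boundary of an annulus *)

Section OuterBoundary.
Context (m : nat) (bs : seq K).
Hypothesis cofinite : forall z, abs (z - a m) <= rho m ->
  (forall b, b \in bs -> rho m <= abs (z - b)) -> quasiperiodicity abs Q (Some z).

(** In the coordinate [t = 1 / (z - a m)] the outside of the disc, with infinity, is the ball
    [abs t <= 1 / rho m], and the annulus surrounds it as in the rigidity setting. [X] gathers the
    classes kept on the sphere, and [h i] is the [i]-th iterate of [Q] in the coordinates of stages
    [m] and [m + i]. *)
Let X : set K := [set t | [/\ t != 0, abs t = (rho m)^-1 &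
  forall b, b \in bs -> rho m <= abs (a m + t^-1 - b)]].
Let h i t := inv_coord (a (m + i)) (iter i (ratmap Q) (inv_chart (a m) t)).
Let H i := finval (h i).

Let abs_invB x y s : x != 0 -> y != 0 -> abs x = s -> abs y = s ->
  abs (x^-1 - y^-1) = abs (x - y) / s ^+ 2.
Proof.
move=> x0 y0 xs ys; have -> : x^-1 - y^-1 = (y - x) / (x * y) by field; rewrite x0 y0.
by rewrite absM absV absM xs ys abs_distC.
Qed.

Let chartE t : t != 0 -> inv_chart (a m) t = Some (a m + t^-1).
Proof. by rewrite /inv_chart => /negPf ->. Qed.

Let X_quasiperiodic t : X t -> quasiperiodicity abs Q (inv_chart (a m) t).
Proof.
move=> [t0 ta tb]; rewrite chartE //; apply: cofinite => //.
by rewrite addrAC subrr add0r absV ta invrK.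
Qed.

Let X_open t w : X t -> abs (w - t) < (rho m)^-1 -> X w.
Proof.
move=> [t0 ta tb] wt; have wa : abs w = (rho m)^-1.
  by rewrite -ta; apply: (abs_eq_close (x := t)); rewrite abs_distC ta.
have w0 : w != 0 by rewrite -(abs_gt0 abs) wa invr_gt0.
split => // b bbs; rewrite (@abs_dist_dom _ _ _ (a m + t^-1)) ?tb //.
apply: lt_le_trans (tb b bbs); rewrite opprD addrACA subrr add0r.
rewrite (abs_invB w0 t0 wa ta) ltr_pdivrMr; last by positivity.
have r0 := rho_gt0 m.
by have -> : rho m * (rho m)^-1 ^+ 2 = (rho m)^-1 by field; rewrite gt_eqF.
Qed.

Let Y : set K := [set t | (rho m)^-1 < abs (t - 0) < (sigma * rho m)^-1].

Let Y_annulus t : Y t -> t != 0 /\ Cm m (a m + t^-1).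
Proof.
rewrite /Y /= subr0 => /andP[t1 t2]; have t0 : 0 < abs t by apply: lt_trans t1; positivity.
split; first by rewrite -(abs_gt0 abs).
have r0 := rho_gt0 m; have sr0 : 0 < sigma * rho m by positivity.
have e1 : sigma * rho m < (abs t)^-1 by rewrite -[X in X < _]invrK ltf_pV2 ?posrE ?invr_gt0.
have e2 : (abs t)^-1 < rho m by rewrite -[X in _ < X]invrK ltf_pV2 ?posrE ?invr_gt0.
by rewrite /Cm /= addrAC subrr add0r absV e1 e2.
Qed.

Let h_annulus i t : Y t -> [/\ h i t = Some (H i t), H i t = (v i (a m + t^-1) - a (m + i))^-1
  & abs (v i (a m + t^-1) - a (m + i)) = rho (m + i) / rho m * abs t^-1].
Proof.
move=> Yt; have [t0 Ct] := Y_annulus Yt; have [E _ /andP[C1 _] nE] := iter_annulus i Ct.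
have vn : v i (a m + t^-1) - a (m + i) != 0.
  by rewrite -(abs_gt0 abs); apply: lt_trans C1; positivity.
have hE : h i t = Some (v i (a m + t^-1) - a (m + i))^-1.
  by rewrite /h chartE // E /inv_coord -subr_eq0 (negPf vn).
have HE : H i t = (v i (a m + t^-1) - a (m + i))^-1 by rewrite /H /finval hE.
by split; [rewrite hE HE| |rewrite nE addrAC subrr add0r].
Qed.

Let kk i := rho m / rho (m + i).

Let kk_gt0 i : 0 < kk i. Proof. by rewrite /kk; positivity. Qed.

Let h_norm i t : Y t -> abs (H i t) = kk i * abs t.
Proof.
move=> Yt; have [t0 _] := Y_annulus Yt; have [_ -> E] := h_annulus i Yt.
rewrite absV E absV /kk; field.
by rewrite !gt_eqF // abs_gt0.
Qed.

Let rigid i : (forall t, X t -> h i t = Some (H i t)) /\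
  (forall t w, X t -> (X `|` Y) w -> abs (H i t - H i w) = kk i * abs (t - w)).
Proof.
have r0 := rho_gt0; have s0 := sigma_gt0.
have rr : (rho m)^-1 < (sigma * rho m)^-1.
  by rewrite ltf_pV2 ?posrE ?gtr_pMl //; positivity.
have rm : 0 < (rho m)^-1 by positivity.
have h_rat : ratlike (h i).
  by apply: ratlike_inv_coord; apply: ratlike_iter; exact: ratlike_inv_chart.
have X_ball t : X t -> abs (t - 0) <= (rho m)^-1 by move=> [_ <- _]; rewrite subr0.
have h_inj t w : (X `|` Y) t -> (X `|` Y) w -> h i t = h i w -> t = w.
  have qp y : (X `|` Y) y -> quasiperiodicity abs Q (inv_chart (a m) y).
    move=> [/X_quasiperiodic //|/Y_annulus[y0 Cy]].
    by rewrite chartE //; exact: annulus_quasiperiodic Cy.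
  move=> Xt Xw /inv_coord_inj tw; apply: (@inv_chart_inj _ (a m)).
  exact: (quasiperiodic_iter_inj (qp _ Xt) (qp _ Xw) tw).
have Y_fin t : Y t -> h i t = Some (H i t) by move=> /(h_annulus i)[].
have Y_norm t : Y t -> abs (H i t - 0) = kk i * abs (t - 0).
  by move=> /(h_norm i); rewrite !subr0.
have Y_sim t w : Y t -> Y w -> abs (H i t - H i w) = kk i * abs (t - w).
  move=> Yt Yw; have [t0 Ct] := Y_annulus Yt; have [w0 Cw] := Y_annulus Yw.
  have [_ -> tE] := h_annulus i Yt; have [_ -> wE] := h_annulus i Yw.
  set vt := v i _ in tE *; set vw := v i _ in wE *.
  have vt0 : vt - a (m + i) != 0 by rewrite -(abs_gt0 abs) tE absV; move: t0;
    rewrite -(abs_gt0 abs) => t0; positivity.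
  have vw0 : vw - a (m + i) != 0 by rewrite -(abs_gt0 abs) wE absV; move: w0;
    rewrite -(abs_gt0 abs) => w0; positivity.
  have -> : (vt - a (m + i))^-1 - (vw - a (m + i))^-1 =
      (vw - vt) / ((vt - a (m + i)) * (vw - a (m + i))) by field; rewrite vt0 vw0.
  rewrite absM absV absM tE wE (iter_annulus_sim i Cw Ct).
  have -> : a m + w^-1 - (a m + t^-1) = (t - w) / (t * w) by field; rewrite t0 w0.
  rewrite absM !absV absM /kk; field.
  by rewrite !gt_eqF ?abs_gt0.
have Y_onto c : kk i * (rho m)^-1 < abs (c - 0) < kk i * (sigma * rho m)^-1 ->
    exists2 t, Y t & h i t = Some c.
  rewrite subr0.
  have -> : kk i * (rho m)^-1 = (rho (m + i))^-1 by rewrite /kk; field; rewrite !gt_eqF.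
  have -> : kk i * (sigma * rho m)^-1 = (sigma * rho (m + i))^-1.
    by rewrite /kk; field; rewrite !gt_eqF.
  move=> /andP[c1 c2]; have sri : 0 < sigma * rho (m + i) by positivity.
  have c0 : c != 0 by rewrite -(abs_gt0 abs); apply: lt_trans c1; rewrite invr_gt0.
  have ac0 : 0 < abs c by rewrite abs_gt0.
  have Cc : Cm (m + i) (a (m + i) + c^-1).
    rewrite /Cm /= addrAC subrr add0r absV; apply/andP; split.
      by rewrite -[X in X < _]invrK ltf_pV2 ?posrE ?invr_gt0.
    by rewrite -[X in _ < X]invrK ltf_pV2 ?posrE ?invr_gt0.
  have [z Cz zc] := iter_annulus_onto Cc.
  have zn : z - a m != 0.
    by case/andP: Cz => z1 _; rewrite -(abs_gt0 abs); apply: lt_trans z1; positivity.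
  exists (z - a m)^-1.
    rewrite /Y /= subr0 absV; case/andP: Cz => z1 z2.
    by rewrite !ltf_pV2 ?posrE ?z1 ?z2 ?abs_gt0 //; positivity.
  rewrite /h chartE ?invr_eq0 // invrK [a m + _]addrC subrK zc /inv_coord.
  rewrite -subr_eq0 addrAC subrr add0r invr_eq0 (negPf c0) invrK //.
split=> [t Xt|t w Xt Xw].
  exact: (@rigidity_finite _ _ _ abs (h i) 0 0 _ _ (kk i) X rm rr (kk_gt0 i) h_rat X_ball X_open
    h_inj Y_fin Y_norm Y_sim Y_onto).
exact: (@rigidity_similarity _ _ _ abs (h i) 0 0 _ _ (kk i) X rm rr (kk_gt0 i) h_rat X_ball X_open
    h_inj Y_fin Y_norm Y_sim Y_onto).
Qed.

Let h_fin i t : X t -> h i t = Some (H i t). Proof. by case: (rigid i) => + _; apply. Qed.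

Let h_sim i t w : X t -> X w -> abs (H i t - H i w) = kk i * abs (t - w).
Proof. by case: (rigid i) => _ sim Xt Xw; apply: sim => //; left. Qed.

Let rinv_gt0 i : 0 < (rho i)^-1. Proof. by rewrite invr_gt0. Qed.

Let kk_rho i : kk i * (rho m)^-1 = (rho (m + i))^-1.
Proof. by rewrite /kk; field; rewrite !gt_eqF. Qed.

(** A value outside the ball could be compared with a smaller value taken on the annulus: their
    difference has the larger absolute value, whereas the similarity gives it the smaller one. *)
Let H_le i t : X t -> abs (H i t) <= (rho (m + i))^-1.
Proof.
move=> Xt; rewrite leNgt; apply/negP => Ht.
have [y y1] : exists2 y, (rho m)^-1 < abs y &
    abs y < Num.min (abs (H i t) / kk i) (sigma * rho m)^-1.
  apply: abs_dense; first by positivity.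
  have sr0 : 0 < sigma * rho m by positivity.
  by rewrite lt_min ltr_pdivlMr // mulrC kk_rho Ht ltf_pV2 ?posrE // gtr_pMl.
rewrite lt_min => /andP[y2 y3]; have Yy : Y y by rewrite /Y /= subr0 y1.
have ty : abs (t - y) = abs y.
  have [_ ta _] := Xt; rewrite -[t - y]opprB absN abs_domB // ta //.
have [_ sim] := rigid i; have := sim t y Xt (or_intror Yy); rewrite ty -(h_norm i Yy).
have hy : abs (H i y) < abs (H i t) by rewrite (h_norm i Yy) mulrC -ltr_pdivlMr.
by rewrite abs_domB // => e; rewrite e ltxx in hy.
Qed.

Let h_onto i t c : X t -> abs (c - H i t) < (rho (m + i))^-1 ->
  exists2 w, abs (w - t) < (rho m)^-1 & h i w = Some c.
Proof.
move=> Xt ct; apply: (disc_onto (abs := abs) (k := kk i) (f := h i)) => //.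
- by apply: ratlike_inv_coord; apply: ratlike_iter; exact: ratlike_inv_chart.
- by move=> w /(X_open Xt) /(h_fin i).
- by move=> w w' /(X_open Xt) Xw /(X_open Xt) Xw'; exact: h_sim.
- by rewrite kk_rho.
Qed.

Let iter_h i t s : h i t = Some s ->
  iter i (ratmap Q) (inv_chart (a m) t) = inv_chart (a (m + i)) s.
Proof. exact: inv_coordK. Qed.

Let perD i i' : i = i' %[mod n] -> a (m + i) = a (m + i') /\ rho (m + i) = rho (m + i').
Proof.
move=> ii; have E : m + i = m + i' %[mod n] by apply/eqP; rewrite eqn_modDl; apply/eqP.
by split; [apply: a_per|apply: rho_per].
Qed.

Let per_mul k : a (m + k * n) = a m /\ rho (m + k * n) = rho m.
Proof. by rewrite -{2 4}[m]addn0; apply: perD; rewrite modnMl mod0n. Qed.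

Let class_return t : X t -> exists2 N, (0 < N)%N &
  forall k, abs (H (k * N * n) t - t) < (rho m)^-1.
Proof.
move=> Xt; have [t0 ta tb] := Xt; have Et := X_quasiperiodic Xt; rewrite chartE // in Et.
have [e e0 eE] := chordal_small abs (a m + t^-1) (rho_gt0 m).
have [N [e' [N0 e'0 ee' ret]]] := quasiperiodic_return Et e0.
exists N => // k.
have [y yE yx] : exists2 y,
    iter (k * N * n) (ratmap Q) (Some (a m + t^-1)) = Some y &
    abs (y - (a m + t^-1)) < rho m.
  have := ret (Some (a m + t^-1)); rewrite chordal_xx => /(_ e'0 (k * n)%N) ret1.
  by apply: eE; rewrite mulnAC; apply: lt_le_trans ret1 ee'.
have txa : abs (a m + t^-1 - a m) = rho m by rewrite addrAC subrr add0r absV ta invrK.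
have ya : abs (y - a m) = rho m by rewrite -txa; apply: abs_dist_dom; rewrite txa.
have yn : y - a m != 0 by rewrite -(abs_gt0 abs) ya.
have -> : H (k * N * n) t = (y - a m)^-1.
  have [am _] := per_mul (k * N).
  by rewrite /H /finval /h chartE // yE am /inv_coord -subr_eq0 (negPf yn).
have tn : t^-1 != 0 by rewrite invr_eq0.
rewrite -[t in X in abs X < _]invrK (abs_invB yn tn ya) ?absV ?ta ?invrK //.
have -> : y - a m - t^-1 = y - (a m + t^-1) by rewrite opprD addrA.
rewrite ltr_pdivrMr; last by positivity.
by have -> : (rho m)^-1 * rho m ^+ 2 = rho m by field; rewrite gt_eqF.
Qed.

(* Each class returns to itself, so the forward orbits of two classes that meet
   coincide. *)
Let same_orbit t t0 N i i' : X t -> X t0 -> i = i' %[mod n] -> (0 < N)%N ->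
  (forall k, abs (H (k * N * n) t0 - t0) < (rho m)^-1) ->
  abs (H i t - H i' t0) < (rho (m + i))^-1 ->
  exists2 l, (l < N)%N & abs (t - H (l * n) t0) < (rho m)^-1.
Proof.
move=> Xt Xt0 ii N0 ret tt0; have [ai ri] := perD ii.
(* The meeting of classes is made exact: some [w] in the class of [t0] has the same image as [t].
   The two orbits coincide from there on, and the return of [t] to its class takes place on the
   orbit of [w]. *)
have [|w wt0 hw] := @h_onto i' t0 (H i t) Xt0; first by rewrite -ri.
have Xw := X_open Xt0 wt0.
have E : iter i (ratmap Q) (inv_chart (a m) t) = iter i' (ratmap Q) (inv_chart (a m) w).
  by rewrite (iter_h (h_fin i Xt)) ai -(iter_h hw).
have [M M0 retM] := class_return Xt.
have iM : (i <= i * M * n)%N by rewrite -mulnA leq_pmulr // muln_gt0 M0.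
have [l lE] : exists l, (i * M * n - i + i' = l * n)%N.
  apply/dvdnP; rewrite /dvdn -modnDmr -ii modnDmr subnK // modnMl //.
have tl : H (i * M * n) t = H (l * n) w.
  have [a1 _] := per_mul (i * M); have [a2 _] := per_mul l.
  rewrite /H /finval /h a1 a2 -lE -{1}(subnK iM) !iterD E //.
have kk1 k : kk (k * n) = 1 by rewrite /kk; have [_ ->] := per_mul k; rewrite divff ?gt_eqF.
have tlw : abs (t - H (l * n) t0) < (rho m)^-1.
  apply: (@abs_dist_lt _ _ _ (H (i * M * n) t)); first by rewrite abs_distC; apply: retM.
  by rewrite tl h_sim // kk1 mul1r.
exists (l %% N)%N; first by rewrite ltn_mod.
apply: abs_dist_lt tlw _.
set t1 := H (l %/ N * N * n) t0.
have Xt1 : X t1 by apply: (X_open Xt0); exact: ret.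
have -> : H (l * n) t0 = H (l %% N * n) t1.
  have [a1 _] := per_mul l; have [a2 _] := per_mul (l %% N);
    have [a3 _] := per_mul (l %/ N * N).
  have := iter_h (h_fin (l %/ N * N * n) Xt0); rewrite -/t1 a3 => E1.
  rewrite /H /finval /h a1 a2 -E1 -iterD -mulnDl [(l %% N + _)%N]addnC -divn_eq //.
by rewrite h_sim // kk1 mul1r; apply: ret.
Qed.

(** The coordinates at stage [m + i] of infinity and of the pole. When [n] divides [m + i] the pole
    is the centre, and the convention [0^-1 = 0] yields the coordinate of infinity again. *)
Let bad i (b : bool) : K := if b then 0 else (a 0%N - a (m + i))^-1.

(** The stage modulo [n] and the point to be avoided leave finitely many cases. In each of them, the
    classes that ever reach the class of that point all lie on one periodic orbit of classes. *)
Let exceptional : exists ex : seq K, forall t, X t ->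
  (forall e, e \in ex -> (rho m)^-1 <= abs (t - e)) ->
  forall i b, (rho (m + i))^-1 <= abs (H i t - bad i b).
Proof.
have [L LE] : {L : nat * bool -> seq K & forall jb t, X t -> forall i, i = jb.1 %[mod n] ->
    abs (H i t - bad i jb.2) < (rho (m + i))^-1 ->
    exists2 e, e \in L jb & abs (t - e) < (rho m)^-1}.
  apply: (@choice _ _ (fun (jb : nat * bool) L => forall t, X t -> forall i, i = jb.1 %[mod n] ->
    abs (H i t - bad i jb.2) < (rho (m + i))^-1 ->
    exists2 e, e \in L & abs (t - e) < (rho m)^-1)) => -[j b] /=.
  have [[t0 [i0 [Xt0 i0j hit0]]]|none] := pselect (exists t0 i0, [/\ X t0, i0 = j %[mod n] &
      abs (H i0 t0 - bad i0 b) < (rho (m + i0))^-1]); last first.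
    by exists [::] => t Xt i ij hit; exfalso; apply: none; exists t, i.
  have [N N0 ret] := class_return Xt0.
  exists [seq H (l * n) t0 | l <- iota 0 N] => t Xt i ij hit.
  have ii0 : i = i0 %[mod n] by rewrite ij.
  have [ai ri] := perD ii0.
  have [|l lN tl] := same_orbit Xt Xt0 ii0 N0 ret.
    apply: abs_dist_lt hit _; rewrite abs_distC ri.
    by rewrite /bad ai; exact: hit0.
  by exists (H (l * n) t0) => //; apply: map_f; rewrite mem_iota.
exists (flatten [seq L jb | jb <- [seq (j, b) | j <- iota 0 n, b <- [:: true; false]]]).
move=> t Xt tex i b; rewrite leNgt; apply/negP => hit.
have [|e eL te] := LE ((i %% n)%N, b) t Xt i _ hit; first by rewrite /= modn_mod.
have := tex e; rewrite leNgt te => /(_ _)/negP; apply => //.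
apply/flattenP; exists (L ((i %% n)%N, b)) => //; apply: map_f.
apply: allpairs_f; first by rewrite mem_iota ltn_mod.
by case: b {hit eL}; rewrite !inE eqxx ?orbT.
Qed.

(** * Classes whose orbits avoid infinity and the pole *)

Section GoodClass.
Context (t : K).
Hypothesis Xt : X t.
Hypothesis t_good : forall i b, (rho (m + i))^-1 <= abs (H i t - bad i b).
Let x0 := a m + t^-1.
Let U : set K := [set x | abs (x - x0) < rho m].
Let tau x := (x - a m)^-1.
Let z i x := a (m + i) + (H i (tau x))^-1.

Let x0U : U x0. Proof. by rewrite /U /= subrr abs0. Qed.

Let x0a : abs (x0 - a m) = rho m.
Proof. by have [_ ta _] := Xt; rewrite /x0 addrAC subrr add0r absV ta invrK. Qed.

Let U_norm x : U x -> abs (x - a m) = rho m /\ x - a m != 0.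
Proof.
move=> xU; have xa : abs (x - a m) = rho m by rewrite -x0a; apply: abs_dist_dom;
  rewrite x0a.
by rewrite -(abs_gt0 abs) xa.
Qed.

Let tauB x y : U x -> U y -> abs (tau x - tau y) = abs (x - y) / rho m ^+ 2.
Proof.
move=> /U_norm[xa xn] /U_norm[ya yn]; rewrite /tau (abs_invB xn yn xa ya).
by rewrite opprB addrA subrK.
Qed.

Let tau0 : tau x0 = t. Proof. by rewrite /tau /x0 addrAC subrr add0r invrK. Qed.

Let tau_close x : U x -> abs (tau x - t) < (rho m)^-1.
Proof.
move=> xU; rewrite -tau0 tauB // ltr_pdivrMr; last by positivity.
by have -> : (rho m)^-1 * rho m ^+ 2 = rho m by field; rewrite gt_eqF.
Qed.

Let X_tau x : U x -> X (tau x). Proof. by move=> xU; apply: (X_open Xt);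
  apply: tau_close. Qed.

Let H_avoid i b x : U x -> (rho (m + i))^-1 <= abs (H i (tau x) - bad i b).
Proof.
move=> xU; rewrite (@abs_dist_dom _ _ _ (H i t)); first exact: t_good.
apply: lt_le_trans (t_good i b); rewrite (h_sim i (X_tau xU) Xt) -kk_rho.
by rewrite ltr_pM2l // tau_close.
Qed.

Let H_abs i x : U x -> abs (H i (tau x)) = (rho (m + i))^-1 /\ H i (tau x) != 0.
Proof.
move=> xU; have E : abs (H i (tau x)) = (rho (m + i))^-1.
  apply/eqP; rewrite eq_le (H_le i (X_tau xU)) /=.
  by have := H_avoid i true xU; rewrite subr0.
by rewrite -(abs_gt0 abs) E.
Qed.

Let z_iter i x : U x -> iter i (ratmap Q) (Some x) = Some (z i x).
Proof.
move=> xU; have [_ xn] := U_norm xU; have [_ Hn] := H_abs i xU.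
have := iter_h (h_fin i (X_tau xU)); rewrite /inv_chart (negPf Hn) invr_eq0 (negPf xn).
by rewrite invrK addrC subrK.
Qed.

Let zB i x y : U x -> U y -> abs (z i x - z i y) = rho (m + i) / rho m * abs (x - y).
Proof.
move=> xU yU; have [xH xn] := H_abs i xU; have [yH yn] := H_abs i yU.
have -> : z i x - z i y = (H i (tau x))^-1 - (H i (tau y))^-1 by rewrite /z; ring.
rewrite (abs_invB xn yn xH yH) (h_sim i (X_tau xU) (X_tau yU)) tauB // /kk; field.
by rewrite !gt_eqF.
Qed.

(** When the pole is not the centre, avoiding its class in the inverse coordinate amounts to staying
    at distance at least [abs (a (m + i) - a 0)] from it. *)
Let z_far i x : U x -> far (m + i) 1 (z i x).
Proof.
move=> xU; have [xH xn] := H_abs i xU; rewrite /far mul1r;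
  case: ifP => [/per0[<- _ _]|/negbT nmi].
  by rewrite /z addrAC subrr add0r absV xH invrK.
have [h1 _] := dist_rho nmi; have := H_avoid i false xU; rewrite /bad.
have D0 : 0 < abs (a (m + i) - a 0%N) by apply: lt_le_trans h1.
have Dn : a 0%N - a (m + i) != 0 by rewrite -(abs_gt0 abs) abs_distC.
have -> : H i (tau x) - (a 0%N - a (m + i))^-1 =
    H i (tau x) * (a 0%N - z i x) / (a 0%N - a (m + i)).
  by rewrite /z; field; rewrite xn Dn.
rewrite absM absV absM xH [abs (a 0%N - z i x)]abs_distC [abs (a 0%N - _)]abs_distC.
by rewrite -mulrA ler_pMr // ler_pdivlMr // mul1r.
Qed.

Let z_onto i w : abs (w - z i x0) < rho (m + i) -> exists2 x, U x & z i x = w.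
Proof.
move=> wz; have rr : 0 < rho (m + i) / rho m by positivity.
have fv x : U x -> finval (fun x => iter i (ratmap Q) (Some x)) x = z i x.
  by move=> xU; rewrite /finval z_iter.
have [|||x xU] := disc_onto (abs := abs) (u := x0) (rho_gt0 m) rr
    (ratlike_iter Q i (ratlike_Some K)) _ _ (c := w).
- by move=> x xU; rewrite fv // z_iter.
- by move=> x y xU yU; rewrite !fv // zB.
- by rewrite fv // divfK ?gt_eqF.
by rewrite z_iter // => -[<-]; exists x.
Qed.

(** The [i]-th iterate of [Q] maps [U] onto a full disc, where [R = Q - d] with [d] smaller than the
    radius of the next disc; so [R] follows the same sequence of discs. *)
Let R_step i w : abs (w - z i x0) < rho (m + i) ->
  ratmap R (Some w) = Some (g w) /\ abs (g w - z i.+1 x0) < rho (m + i.+1).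
Proof.
move=> /z_onto[x xU zx]; have fw := z_far i xU; rewrite zx in fw.
have := z_iter i.+1 xU; rewrite iterS z_iter // zx QE ?(far_neq ltr01 fw) //.
case E : (ratmap R (Some w)) => [w'|//] [w'E].
have -> : g w = w' by rewrite /g (value1 E).
split => //; have -> : w' = z i.+1 x - d w by rewrite -w'E addrK.
have dw : abs (d w) < rho (m + i.+1).
  apply: le_lt_trans (pert_bound _ fw) _; first by rewrite ltr01 lexx.
  by rewrite divr1 addnS gtr_pMl // exprn_ilt1 // ltW.
rewrite addrAC; apply: absB_lt dw; rewrite zB //.
by rewrite mulrC mulrA ltr_pdivrMr // mulrC ltr_pM2l.
Qed.

Let R_step_sim i w w' : abs (w - z i x0) < rho (m + i) -> abs (w' - z i x0) < rho (m + i) ->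
  abs (g w - g w') = kap (m + i) * abs (w - w').
Proof.
have gE x : U x -> g (z i x) = z i.+1 x - d (z i x) /\ far (m + i) 1 (z i x).
  move=> xU; have fw := z_far i xU; split => //.
  have := z_iter i.+1 xU; rewrite iterS z_iter // QE ?(far_neq ltr01 fw) //.
  case E : (ratmap R (Some (z i x))) => [w1|//] [<-].
  by rewrite addrK /g (value1 E).
have [-> _ _|ww'] := eqVneq w w'; first by rewrite !subrr abs0 mulr0.
move=> /z_onto[x xU xw] /z_onto[y yU yw]; rewrite -{}xw -{}yw in ww' *;
  have [-> fx] := gE x xU; have [-> fy] := gE y yU.
have E : abs (z i.+1 x - z i.+1 y) = kap (m + i) * abs (z i x - z i y).
  by rewrite !zB // addnS /kap; field; rewrite !gt_eqF.
have -> : z i.+1 x - d (z i x) - (z i.+1 y - d (z i y)) =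
  (z i.+1 x - z i.+1 y) - (d (z i x) - d (z i y)) by ring.
rewrite -E; apply: abs_domB; rewrite E.
apply: le_lt_trans (pert_lip _ fx fy) _; first by rewrite ltr01 lexx.
rewrite divr1 ltr_pM2r ?abs_gt0 ?subr_eq0 // gtr_pMl // exprn_ilt1 //.
exact: ltW.
Qed.

Let R_iter i x : U x -> [/\ iter i (ratmap R) (Some x) = Some (value R i x),
   value R i.+1 x = g (value R i x) & abs (value R i x - z i x0) < rho (m + i)].
Proof.
move=> xU; have st j : iter j (ratmap R) (Some x) = Some (value R j x) ->
    abs (value R j x - z j x0) < rho (m + j) ->
    iter j.+1 (ratmap R) (Some x) = Some (g (value R j x)).
  by move=> E /R_step[E1 _]; rewrite iterS E E1.
elim: i => [|i [IH1 IH2 IH3]].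
  have z0 : z 0 x0 = x0 by have := z_iter 0 x0U => -[].
  have E : iter 0 (ratmap R) (Some x) = Some (value R 0 x) by [].
  have cl : abs (value R 0 x - z 0 x0) < rho (m + 0) by rewrite z0 addn0.
  by split => //; rewrite {1}/value /finval st.
have [_ cl] := R_step IH3; rewrite -IH2 in cl.
have E : iter i.+1 (ratmap R) (Some x) = Some (value R i.+1 x) by rewrite st // IH2.
by split => //; rewrite {1}/value /finval st.
Qed.

Let R_iter_sim i x y : U x -> U y ->
  abs (value R i x - value R i y) = rho (m + i) / rho m * abs (x - y).
Proof.
move=> xU yU; elim: i => [|i IH].
  by rewrite addn0 divff ?gt_eqF // mul1r.
have [_ -> xz] := R_iter i xU; have [_ -> yz] := R_iter i yU.
rewrite (R_step_sim xz yz) IH /kap addnS; field.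
by rewrite !gt_eqF.
Qed.

Lemma good_class_quasiperiodic : quasiperiodicity abs R (Some x0).
Proof.
have [N N0 /(_ 1%N)] := class_return Xt; rewrite mul1n => ret.
set M := (N * n)%N in ret; have [aM rM] := per_mul N.
have zM : abs (z M x0 - x0) < rho m.
  have [tM tMn] := H_abs M x0U; have [t0 ta _] := Xt.
  rewrite tau0 rM in tM; rewrite tau0 in tMn.
  have -> : z M x0 - x0 = (H M t)^-1 - t^-1 by rewrite /z aM tau0 /x0; ring.
  rewrite (abs_invB tMn t0 tM ta) ltr_pdivrMr; last by positivity.
  by have -> : rho m * (rho m)^-1 ^+ 2 = (rho m)^-1 by field; rewrite gt_eqF.
have sim1 x y : U x -> U y -> abs (value R M x - value R M y) = 1 * abs (x - y).
  by move=> xU yU; rewrite R_iter_sim // rM divff ?gt_eqF.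
have gx0 : abs (value R M x0 - x0) < rho m.
  by apply: abs_dist_lt zM; have [_ _] := R_iter M x0U; rewrite rM.
(* The radius is less than [rho m], which makes the error [s / rho m] less than [1], and is at least
   the displacement of [x0], which makes the ball invariant. The term [rho m / 2] keeps it
   positive. *)
set s := Num.max (abs (value R M x0 - x0)) (rho m / 2).
have s1 : s < rho m by rewrite gt_max gx0 /= ltr_pdivrMr // ltr_pMr // ltr1n.
have s0 : 0 < s by rewrite lt_max divr_gt0 ?orbT.
have [|c c1 clip] := disc_lipschitz (abs := abs) (u := x0) (rho_gt0 m) ltr01
    (ratlike_iter R M (ratlike_Some K)) _ sim1 (ltW s0) s1.
  by move=> x xU; have [] := R_iter M xU.
have ZU x : abs (x - x0) <= s -> U x by move=> xs; apply: le_lt_trans s1.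
apply: (@quasiperiodic_near_rotation _ _ _ abs R (value R M) [set x | abs (x - x0) <= s]
  M c (s / rho m) s s) => //.
- by rewrite muln_gt0 N0.
- move=> x /= xs; have [-> _ _] := R_iter M (ZU _ xs); split => //.
  apply: (@abs_dist_le _ _ _ (value R M x0)).
    by rewrite sim1 ?mul1r //; apply: ZU.
  by rewrite le_max lexx.
- by rewrite divr_ge0 ?(ltW s0) ?(ltW (rho_gt0 _)) //= ltr_pdivrMr // mul1r.
- by move=> x y /= xs ys; have := clip x y xs ys; rewrite mulr1.
- by move=> x y /= xs ys; apply: (abs_dist_le xs); rewrite abs_distC.
- by move=> x /ltW.
Qed.

End GoodClass.

Lemma outer_boundary_quasiperiodic : exists bs' : seq K,
  forall z, abs (z - a m) = rho m -> (forall b, b \in bs' -> rho m <= abs (z - b)) ->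
  quasiperiodicity abs R (Some z).
Proof.
have [ex exE] := exceptional; exists (bs ++ [seq a m + e^-1 | e <- ex]) => z za zb.
have zn : z - a m != 0 by rewrite -(abs_gt0 abs) za.
have zE : a m + (z - a m)^-1^-1 = z by rewrite invrK addrC subrK.
have ta : abs (z - a m)^-1 = (rho m)^-1 by rewrite absV za.
have t0 : (z - a m)^-1 != 0 by rewrite invr_eq0.
have Xt : X (z - a m)^-1.
  by split => // b bbs; rewrite zE zb // mem_cat bbs.
rewrite -zE; apply: (good_class_quasiperiodic Xt) => i b; apply: (exE _ Xt) => e eex.
rewrite leNgt; apply/negP => te.
have ea : abs e = (rho m)^-1 by rewrite -ta; apply: (abs_eq_close (x := (z - a m)^-1));
  rewrite ta.
have en : e != 0 by rewrite -(abs_gt0 abs) ea.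
have := zb (a m + e^-1); rewrite mem_cat (map_f (fun e => a m + e^-1)) ?orbT // => /(_ isT).
have -> : z - (a m + e^-1) = (z - a m)^-1^-1 - e^-1 by rewrite invrK; ring.
rewrite (abs_invB t0 en ta ea) leNgt ltr_pdivrMr; last by positivity.
by have -> : rho m * (rho m)^-1 ^+ 2 = (rho m)^-1; [field; rewrite gt_eqF|rewrite te].
Qed.

End OuterBoundary.

(** * The annuli as full components *)

Lemma annulus_component m (A : set (proj_line K)) z :
  (forall bs : seq K, ~ (forall z, abs (z - a m) = rho m ->
    (forall b, b \in bs -> rho m <= abs (z - b)) -> quasiperiodicity abs R (Some z))) ->
  Cm m z -> connected_affinoid abs A -> A (Some z) -> A `<=` quasiperiodicity abs Q ->
  A `<=` Some @` Cm m.
Proof.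
move=> R_max Cz cA Az AQ w Aw; apply: contrapT => wC.
have /andP[z1 z2] := Cz.
have [[y [wy ym]]|far_w] := pselect (exists y, w = Some y /\ abs (y - a m) < rho m).
  have ys : abs (y - a m) <= sigma * rho m.
    by rewrite leNgt; apply/negP => ys; apply: wC; exists y => //; apply/andP.
  rewrite wy in Aw.
  (* Here the stray point lies in the inner ball and [z] is the far point; in the other case the
     roles are exchanged. *)
  have [x [xz]|bs bsE] := affinoid_cofinite cA Aw ys Az.
    rewrite -xz; apply: ltW; rewrite (@abs_dist_domr _ _ _ (a m)) //.
    by rewrite abs_distC; apply: le_lt_trans z1.
  by apply: (@hole_not_quasiperiodic m bs) => x xa xb; apply: AQ; apply: bsE.
have [y yw|bs bsE] := affinoid_cofinite cA Az (ltW z2) Aw.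
  have ym : rho m <= abs (y - a m).
    by rewrite leNgt; apply/negP => ym; apply: far_w; exists y.
  by rewrite (@abs_dist_domr _ _ _ (a m)) // abs_distC; apply: lt_le_trans ym.
have [|bs' bs'E] := @outer_boundary_quasiperiodic m bs.
  by move=> x xa xb; apply: AQ; apply: bsE.
exact: R_max bs' bs'E.
Qed.

Lemma annulus_image m : ratmap Q @` (Some @` Cm m) = Some @` Cm m.+1.
Proof.
apply/seteqP; split => [_ [_ [z Cz <-] <-]|_ [c Cc <-]].
  by have [-> _] := Q_annulus_val Cz; exists (q z) => //; apply: Q_annulus_in.
by have [z Cz zc] := Q_annulus_onto Cc; exists (Some z) => //; exists z.
Qed.

End Perturbation.

(** * Adding a simple pole *)

Section LowestTerms.
Context (K : fieldType).
Implicit Types (F : {fraction {poly K}}) (N M : {poly K}).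

Lemma lowest_terms_unique F N M : M != 0 -> coprimep N M ->
  F = tofrac N / tofrac M -> exists2 c, c != 0 & ratnum F = c *: N /\ ratden F = c *: M.
Proof.
move=> M0 cNM FE; have d0 := ratden_neq0 F; have cnd := ratfun_coprime F.
have E : ratnum F * M = N * ratden F.
  apply/eqP; rewrite -tofrac_eq !tofracM -eqr_div ?tofrac_eq0 //.
  by rewrite -ratfun_repr FE.
have dM : ratden F %| M.
  by rewrite -(@Gauss_dvdpr _ M (ratnum F) (ratden F)) 1?coprimep_sym // E dvdp_mull.
have Md : M %| ratden F.
  by rewrite -(@Gauss_dvdpr _ (ratden F) N M) 1?coprimep_sym // -E dvdp_mull.
have [[c1 c2] /= /andP[c10 c20] cE] : exists2 c : K * K, (c.1 != 0) && (c.2 != 0) &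
    c.1 *: ratden F = c.2 *: M.
  have /eqpP[[c1 c2] /= c12 cE] : ratden F %= M by rewrite /eqp dM.
  by exists (c1, c2).
have dE : ratden F = (c2 / c1) *: M.
  by rewrite mulrC -scalerA -cE scalerA mulVf // scale1r.
exists (c2 / c1); first by rewrite mulf_neq0 ?invr_eq0.
split => //; apply: (mulIf M0); rewrite E dE -scalerAr scalerAl //.
Qed.

Lemma ratmap_lowest_terms F N M z : M != 0 -> coprimep N M -> F = tofrac N / tofrac M ->
  ratmap F (Some z) = proj_point N.[z] M.[z].
Proof.
move=> M0 cNM /(lowest_terms_unique M0 cNM)[c c0 [nE dE]].
by rewrite ratmap_Some nE dE !hornerZ proj_pointMl.
Qed.

Lemma ratdeg_lowest_terms F N M : M != 0 -> coprimep N M -> F = tofrac N / tofrac M ->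
  ratdeg F = (maxn (size N) (size M)).-1.
Proof.
move=> M0 cNM /(lowest_terms_unique M0 cNM)[c c0 [nE dE]].
by rewrite /ratdeg nE dE !size_scale.
Qed.

Definition add_pole F (a e : K) : {fraction {poly K}} :=
  F + tofrac e%:P / tofrac ('X - a%:P).

Let pole_num F (a e : K) := ratnum F * ('X - a%:P) + e *: ratden F.
Let pole_den F (a : K) := ratden F * ('X - a%:P).

(** Nothing cancels: modulo [ratden F] the numerator is [ratnum F] times the new factor, and at [a]
    it takes the value [e * (ratden F).[a]], which is not zero. *)
Let pole_facts F a e : e != 0 -> (ratden F).[a] != 0 ->
  [/\ pole_den F a != 0, coprimep (pole_num F a e) (pole_den F a)
    & add_pole F a e = tofrac (pole_num F a e) / tofrac (pole_den F a)].
Proof.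
move=> e0 da; have d0 := ratden_neq0 F; have X0 : 'X - a%:P != 0 by rewrite polyXsubC_eq0.
split; first by rewrite mulf_neq0.
- rewrite /pole_den coprimepMr; apply/andP; split.
    rewrite coprimep_sym /pole_num -mul_polyC addrC coprimep_addl_mul.
    by rewrite coprimepMr coprimep_sym ratfun_coprime coprimep_XsubC rootE.
  by rewrite coprimep_XsubC rootE !hornerE subrr mulr0 add0r mulf_neq0.
- rewrite /add_pole {1}(ratfun_repr F) addf_div ?tofrac_eq0 //.
  by rewrite -!tofracM -tofracD /pole_num -mul_polyC.
Qed.

Lemma ratdeg_add_pole F a e : e != 0 -> (ratden F).[a] != 0 ->
  ratdeg (add_pole F a e) = (ratdeg F).+1.
Proof.
move=> e0 da; have [M0 cop E] := pole_facts e0 da.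
rewrite (ratdeg_lowest_terms M0 cop E) /ratdeg.
have d0 := ratden_neq0 F; have ds : (0 < size (ratden F))%N by rewrite size_poly_gt0.
have sd : size (pole_den F a) = (size (ratden F)).+1.
  by rewrite /pole_den size_Mmonic ?monicXsubC // size_XsubC addn2.
have se : size (e *: ratden F) = size (ratden F) by rewrite size_scale.
have [n0|n0] := eqVneq (ratnum F) 0.
  rewrite sd /pole_num n0 mul0r add0r se size_poly0 max0n.
  by rewrite (maxn_idPr (leqnSn _)) prednK.
have sn : size (ratnum F * ('X - a%:P)) = (size (ratnum F)).+1.
  by rewrite size_Mmonic ?monicXsubC // size_XsubC addn2.
have [h|h] := ltnP (size (ratnum F)).+1 (size (ratden F)).+1.
  have -> : maxn (size (ratnum F)) (size (ratden F)) = size (ratden F).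
    by apply/maxn_idPr; rewrite ltnW.
  rewrite sd prednK // (maxn_idPr _) //; apply: (leq_trans (size_polyD _ _)).
  by rewrite geq_max sn se leqnSn andbT ltnS ltnW.
have -> : maxn (size (ratnum F)) (size (ratden F)) = size (ratnum F).
  exact/maxn_idPl.
have ns : (0 < size (ratnum F))%N by rewrite size_poly_gt0.
rewrite prednK // sd /pole_num size_polyDl ?sn ?se ?ltnS //.
by rewrite (maxn_idPl _) // ltnS.
Qed.

Lemma ratmap_add_pole F a e z : e != 0 -> (ratden F).[a] != 0 -> z != a ->
  ratmap (add_pole F a e) (Some z) =
  if ratmap F (Some z) is Some w then Some (w + e / (z - a)) else None.
Proof.
move=> e0 da za; have [M0 cop E] := pole_facts e0 da.
have zn : z - a != 0 by rewrite subr_eq0.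
rewrite (ratmap_lowest_terms _ M0 cop E) ratmap_Some /pole_num /pole_den !hornerE.
rewrite /proj_point mulf_eq0 (negPf zn) orbF; case: eqP => // /eqP dz.
by congr Some; field; rewrite zn dz.
Qed.

End LowestTerms.

(** * From Siegel disks to Herman rings *)

Section Assembly.
Context (RR : realType) (p : nat) (K : fieldType) (abs : padicAbs RR p K).
Context (R : {fraction {poly K}}) (n : nat) (D : nat -> set K) (rho : nat -> RR).
Hypothesis R_deg : (2 <= ratdeg R)%N.
Hypothesis n_gt0 : (0 < n)%N.
Hypothesis D_disk : forall j, (j < n)%N -> is_diskC abs (rho j) (D j).
Hypothesis D_cycle : is_cycle n R (siegel_disk abs R) (fun j => Some @` D j).
Hypothesis rho_min : forall j, (1 <= j < n)%N -> rho 0%N <= rho j.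
Hypothesis D_dist : forall j, (1 <= j)%N ->
  set_dist abs (D 0%N) (D (j %% n)%N) = set_dist abs (D (1 %% n)%N) (D (j.+1 %% n)%N).

Let g := finval (fun z => ratmap R (Some z)).
Let rh m := rho (m %% n)%N.
Let Dm m := D (m %% n)%N.

Let mn_lt m : (m %% n < n)%N. Proof. by rewrite ltn_mod. Qed.

Let rh_value m : value_group abs (rh m). Proof. by case: (D_disk (mn_lt m)). Qed.

Let rh_gt0 m : 0 < rh m.
Proof. by have [c /= c0 <-] := rh_value m; rewrite abs_gt0. Qed.

Let Dm_center m x : Dm m x -> Dm m = diskC abs (rh m) x.
Proof.
have [_ [z0 DE]] := D_disk (mn_lt m); rewrite /Dm DE => /= xz.
exact: is_diskC_center.
Qed.

Let Dm_component m : analytic_component abs (quasiperiodicity abs R) (Some @` Dm m).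
Proof. by have [/(_ _ (mn_lt m))[]] := D_cycle. Qed.

Let Dm_quasiperiodic m z : Dm m z -> quasiperiodicity abs R (Some z).
Proof. by move=> Dz; apply: (analytic_component_sub (Dm_component m)); exists z. Qed.

Let Dm_image m : ratmap R @` (Some @` Dm m) = Some @` Dm m.+1.
Proof.
have [_ _ /(_ _ (mn_lt m))] := D_cycle; rewrite /Dm => ->.
by rewrite -[in (m %% n).+1]addn1 modnDml addn1.
Qed.

Let R_Dm m z : Dm m z -> ratmap R (Some z) = Some (g z) /\ Dm m.+1 (g z).
Proof.
move=> Dz; have : (Some @` Dm m.+1) (ratmap R (Some z)).
  by rewrite -Dm_image; exists (Some z) => //; exists z.
by case=> w Dw E; rewrite /g /finval -E.
Qed.

Let a0_ex : exists a0, Dm 0 a0.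
Proof.
have [_ [z0 DE]] := D_disk (mn_lt 0); exists z0.
by rewrite /Dm DE /diskC /= subrr abs0 -/(rh 0).
Qed.

Let a0 := projT1 (cid a0_ex).
(** The centres follow the orbit of [a0] for one period only: [R] maps each centre to the next,
    except at the end of the period, where the error is [iter n g a0 - a0]. *)
Let a m := iter (m %% n) g a0.

Let iter_g m : Dm m (iter m g a0).
Proof.
elim: m => [|m IH]; first exact: projT2 (cid a0_ex).
by rewrite iterS; have [] := R_Dm IH.
Qed.

Let a_in m : Dm m (a m).
Proof. by have := iter_g (m %% n); rewrite /Dm modn_mod. Qed.

Let DmE m : Dm m = diskC abs (rh m) (a m). Proof. exact: Dm_center. Qed.

Let per m k : m = k %[mod n] -> [/\ a m = a k, rh m = rh k & Dm m = Dm k].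
Proof. by rewrite /a /rh /Dm => ->. Qed.

Let R_inj m z w : Dm m z -> Dm m w -> ratmap R (Some z) = ratmap R (Some w) -> z = w.
Proof.
move=> Dz Dw zw; apply: Some_inj.
exact: (quasiperiodic_iter_inj (m := 1) (Dm_quasiperiodic Dz) (Dm_quasiperiodic Dw) zw).
Qed.

Let R_fin m z : abs (z - a m) < rh m -> ratmap R (Some z) = Some (g z).
Proof. by move=> za; have [|] := @R_Dm m z; rewrite ?DmE. Qed.

(** The ratio is read off from the radii, because [Dm m] is mapped onto [Dm m.+1]: a smaller one
    would miss points, a larger one would leave the target. *)
Let R_sim m z w : abs (z - a m) < rh m -> abs (w - a m) < rh m ->
  abs (g z - g w) = rh m.+1 / rh m * abs (z - w).
Proof.
have [k k0 sim] : exists2 k, 0 < k & forall z w, abs (z - a m) < rh m -> abs (w - a m) < rh m ->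
    abs (g z - g w) = k * abs (z - w).
  apply: disc_injective_similarity => //.
  - by apply: ratlike_ratmap; exact: ratlike_Some.
  - by move=> z1 z1m; rewrite (R_fin z1m).
  - by move=> z1 w1 z1m w1m; apply: (@R_inj m); rewrite DmE.
suff -> : rh m.+1 / rh m = k by apply: sim.
have aa : abs (a m - a m) < rh m by rewrite subrr abs0.
have [_ ga] := R_Dm (a_in m).
apply/eqP; rewrite -(inj_eq (mulIf (lt0r_neq0 (rh_gt0 m)))) divfK ?lt0r_neq0 //.
rewrite eq_le; apply/andP; split; rewrite leNgt; apply/negP => lt.
  have [d d1 d2] : exists2 d, k * rh m < abs d & abs d < rh m.+1.
    by apply: abs_dense => //; rewrite mulr_ge0 // ltW.
  have : (Some @` Dm m.+1) (Some (g (a m) + d)).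
    exists (g (a m) + d) => //; rewrite (Dm_center ga) /diskC /=.
    by rewrite addrAC subrr add0r.
  rewrite -Dm_image => -[_ [y Dy <-]]; have [-> _] := R_Dm Dy => -[gy].
  have ym : abs (y - a m) < rh m by move: Dy; rewrite DmE.
  have := sim y (a m) ym aa; rewrite gy addrAC subrr add0r => dE.
  by move: d1; rewrite dE ltr_pM2l // ltNge ltW.
have [d d1 d2] : exists2 d, rh m.+1 / k < abs d & abs d < rh m.
  by apply: abs_dense; rewrite ?divr_ge0 ?(ltW k0) ?(ltW (rh_gt0 _)) // ltr_pdivrMr // mulrC.
have E : a m + d - a m = d by rewrite addrAC subrr add0r.
have dm : abs (a m + d - a m) < rh m by rewrite E.
have Dd : Dm m (a m + d) by rewrite DmE.
have [_] := R_Dm Dd; rewrite (Dm_center ga) /diskC /= sim // E => h.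
by move: d1; rewrite ltNge => /negP; apply; rewrite ler_pdivlMr // mulrC ltW.
Qed.

(** Discs of the cycle that meet are nested. The larger one is an affinoid in the domain of
    quasiperiodicity, so the component formed by the smaller one contains it, and the two
    coincide. *)
Let Dm_disjoint i j : i != j %[mod n] -> rh i <= abs (a i - a j) /\ rh j <= abs (a i - a j).
Proof.
have [_ C_inj _] := D_cycle.
have eqD i1 j1 : Dm i1 = Dm j1 -> i1 = j1 %[mod n].
  by move=> E; apply: C_inj => //; rewrite -/(Dm i1) -/(Dm j1) E.
suff key i1 j1 : i1 != j1 %[mod n] -> rh i1 <= rh j1 -> rh j1 <= abs (a i1 - a j1).
  move=> ij; have [h|h] := leP (rh i) (rh j).
    by have := key _ _ ij h; split => //; exact: le_trans h _.
  by rewrite eq_sym in ij; have := key _ _ ij (ltW h); rewrite abs_distC; split => //;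
    apply: le_trans (ltW h) _.
move=> ij ri; rewrite leNgt; apply/negP => aij; case/eqP: ij; apply: eqD.
have sub : Dm i1 `<=` Dm j1.
  by rewrite !DmE => z /= zi; apply: (abs_dist_lt (lt_le_trans zi ri) aij).
apply/seteqP; split => // z Dz.
have ne : (Some @` Dm i1) !=set0 by exists (Some (a i1)), (a i1).
have aff : connected_affinoid abs (Some @` Dm j1).
  by rewrite DmE; apply: disc_affinoid.
have EDj : Some @` Dm j1 `<=` quasiperiodicity abs R.
  by move=> _ [y Dy <-]; exact: Dm_quasiperiodic Dy.
have Dij : Some @` Dm i1 `<=` Some @` Dm j1.
  by move=> _ [y Dy <-]; exists y => //; apply: sub.
have Dzj : (Some @` Dm j1) (Some z) by exists z.
by have [y Dy [<-]] := analytic_component_max (Dm_component i1) ne aff EDj Dij Dzj.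
Qed.

Let set_dist_Dm i j : i != j %[mod n] -> set_dist abs (Dm i) (Dm j) = abs (a i - a j).
Proof.
move=> /Dm_disjoint[ri rj]; rewrite /set_dist.
rewrite (_ : [set _ | _ in _ & _ in _] = [set abs (a i - a j)]) ?inf1 //.
apply/seteqP; split; last by move=> _ ->; exists (a i) => //; exists (a j).
move=> _ [x Dx [y Dy <-]] /=; rewrite !DmE /diskC /= in Dx Dy.
have E : abs (a i - y) = abs (a i - a j).
  by apply: abs_dist_domr; rewrite abs_distC; apply: lt_le_trans Dy rj.
by rewrite -E; apply: abs_dist_dom; rewrite E; apply: lt_le_trans Dx ri.
Qed.

Let rh_min m : rh 0 <= rh m.
Proof.
rewrite /rh mod0n; case E : (m %% n)%N => [//|j]; apply: rho_min.
by rewrite -E mn_lt E.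
Qed.

(** Disjoint discs are as far apart as their centres. So [abs (a m - a 0)] is also the distance
    between [D 1] and the successor of [D m], which is at least the radius of [D 1]. *)
Let dist_rho m : ~~ (n %| m)%N -> rh m <= abs (a m - a 0%N) /\ rh 1%N <= abs (a m - a 0%N).
Proof.
move=> nm; have m0 : m != 0 %[mod n] by rewrite mod0n.
have [rm r0] := Dm_disjoint m0; split => //.
have m1 : (1 <= m)%N by case: m nm {m0 rm r0}; rewrite ?dvdn0.
have m11 : 1 != m.+1 %[mod n].
  by rewrite -(addn1 m) -[X in X != _ %[mod n]]add0n eqn_modDr eq_sym.
have := D_dist m1; rewrite -{1}(mod0n n) -!/(Dm _) set_dist_Dm 1?eq_sym //.
rewrite set_dist_Dm // [abs (a 0 - _)]abs_distC => ->.
by have [] := Dm_disjoint m11.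
Qed.

Let r_ex : exists r, [/\ value_group abs r, abs (iter n g a0 - a0) <= r & r < rh 0].
Proof.
have D0 : Dm n (iter n g a0) by apply: iter_g.
have [|_ _ nE] := @per n 0; first by rewrite modnn mod0n.
rewrite nE DmE /diskC /= /a mod0n /= in D0.
(* If the [n]-th iterate fixes [a0], the displacement is [0] and cannot serve as a radius;
   [abs p%:R * rh 0] is taken instead. *)
have [t0|t0] := eqVneq (abs (iter n g a0 - a0)) 0; last first.
  exists (abs (iter n g a0 - a0)); split => //.
  by exists (iter n g a0 - a0) => //=; rewrite -(abs_eq0 abs).
have [c /= c0 cE] := rh_value 0; exists (abs (p%:R * c)); split.
- by exists (p%:R * c) => //=; rewrite mulf_neq0 // -(abs_gt0 abs) abs_p_gt0.
- by rewrite t0 abs_ge0.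
- by rewrite absM cE gtr_pMl // padic_p_lt1.
Qed.

Let r := projT1 (cid r_ex).
Let sigma := r / rh 0.

Let sigma_value : exists2 s, s != 0 & abs s = sigma.
Proof.
have [[c /= c0 cE] _ _] := projT2 (cid r_ex); have [d /= d0 dE] := rh_value 0.
by exists (c / d); rewrite ?mulf_neq0 ?invr_eq0 // absM absV cE dE.
Qed.

Let sigma_gt0 : 0 < sigma.
Proof. by have [s s0 <-] := sigma_value; rewrite abs_gt0. Qed.

Let sigma_lt1 : sigma < 1.
Proof. by have [_ _ h] := projT2 (cid r_ex); rewrite /sigma ltr_pdivrMr // mul1r. Qed.

Let R_center m : abs (g (a m) - a m.+1) <= sigma * rh m.+1.
Proof.
rewrite /a modnS; case: ifP => [nm|_]; last first.
  by rewrite iterS subrr abs0 mulr_ge0 // ltW.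
have E : (m %% n).+1 = n.
  apply/eqP; rewrite eqn_leq mn_lt /= dvdn_leq //.
  by rewrite -addn1 /dvdn modnDml addn1.
have -> : rh m.+1 = rh 0 by have [|_ ->] := @per m.+1 0; rewrite ?mod0n //; apply/eqP.
have [_ + _] := projT2 (cid r_ex).
by rewrite -iterS E /sigma divfK // gt_eqF.
Qed.

Let eps_ex : exists2 e, e != 0 & abs e = sigma ^+ 2 * rh 0 * rh 1.
Proof.
have [s s0 <-] := sigma_value; have [c /= c0 <-] := rh_value 0.
have [d /= d0 <-] := rh_value 1; exists (s ^+ 2 * c * d).
  by rewrite !mulf_neq0 ?expf_neq0.
by rewrite !absM.
Qed.

Theorem siegel_to_herman : exists Q : {fraction {poly K}},
  ratdeg Q = (ratdeg R).+1 /\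
  exists C : nat -> set (proj_line K), is_cycle n Q (herman_ring1 abs Q) C.
Proof.
have [eps eps0 absE] := eps_ex.
have da : (ratden R).[a 0] != 0.
  have [+ _] := R_Dm (a_in 0); rewrite ratmap_Some /proj_point.
  by case: eqP.
set Q := add_pole R (a 0) eps.
have QE z : z != a 0 -> ratmap Q (Some z) =
    if ratmap R (Some z) is Some w then Some (w + eps / (z - a 0)) else None.
  exact: ratmap_add_pole.
have Q_deg : ratdeg Q = (ratdeg R).+1 by apply: ratdeg_add_pole.
have a_per m k : m = k %[mod n] -> a m = a k by case/per.
have rh_per m k : m = k %[mod n] -> rh m = rh k by case/per.
exists Q; split => //.
pose A m : set K := [set z | sigma * rh m < abs (z - a m) < rh m].
have A_qp := @annulus_quasiperiodic _ _ _ abs R Q n a rh sigma eps n_gt0 a_per rh_per rh_gt0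
  sigma_gt0 R_fin R_sim R_center QE absE rh_min dist_rho.
have A_comp := @annulus_component _ _ _ abs R Q n a rh sigma eps n_gt0 a_per rh_per rh_gt0
  sigma_gt0 sigma_lt1 R_fin R_sim R_center QE absE rh_min dist_rho.
have A_image := @annulus_image _ _ _ abs R Q n a rh sigma eps a_per rh_per rh_gt0
  sigma_gt0 sigma_lt1 R_fin R_sim R_center QE absE rh_min dist_rho.
(* Otherwise the closed ball without finitely many classes would be an affinoid in the domain of [R]
   that strictly contains the Siegel disk. *)
have R_max m (bs : seq K) : ~ (forall z, abs (z - a m) = rh m ->
    (forall b, b \in bs -> rh m <= abs (z - b)) -> quasiperiodicity abs R (Some z)).
  move=> bsE; have [c /= c0 cE] := rh_value m.
  (* Points inside the disk are dropped from the list: removing their class would remove the disk,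
     and the whole sphere is at distance [rh m] from them anyway. *)
  set bs' := [seq b <- bs | rh m <= abs (b - a m)].
  have [z0 z0a z0b] := ball_avoid abs (a m) (a m :: bs') c0; rewrite cE in z0a z0b.
  pose B := Some @` [set z | abs (z - a m) <= rh m /\ forall b, b \in bs' -> rh m <= abs (z - b)].
  have z0b' b : b \in bs' -> rh m <= abs (z0 - b) by move=> bb; apply: z0b;
    rewrite inE bb orbT.
  have cB : connected_affinoid abs B := ball_minus_discs_affinoid (rh_value m) z0a z0b'.
  have BE : B `<=` quasiperiodicity abs R.
    move=> _ [z [za zb] <-]; have [zm|zm] := ltP (abs (z - a m)) (rh m).
      by apply: (@Dm_quasiperiodic m); rewrite DmE.
    have zE : abs (z - a m) = rh m by apply/eqP; rewrite eq_le za zm.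
    apply: bsE => // b bbs; have [bm|bm] := leP (rh m) (abs (b - a m)).
      by apply: zb; rewrite mem_filter bm.
    by rewrite (@abs_dist_domr _ _ _ (a m)) // abs_distC; exact: lt_le_trans bm zm.
  have DB : Some @` Dm m `<=` B.
    move=> _ [z Dz <-]; rewrite DmE /diskC /= in Dz; exists z => //; split;
      first exact: ltW.
    move=> b; rewrite mem_filter => /andP[bm _].
    have -> : abs (z - b) = abs (b - a m); last by [].
    rewrite abs_distC; apply: abs_dist_domr; rewrite abs_distC.
    exact: lt_le_trans Dz bm.
  have ne : (Some @` Dm m) !=set0 by exists (Some (a m)), (a m).
  have Bz0 : B (Some z0) by exists z0.
  have [z Dz [zz]] := analytic_component_max (Dm_component m) ne cB BE DB Bz0.
  by move: Dz; rewrite zz DmE /diskC /= ltNge z0b // mem_head.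
have A_ne m : exists z, A m z.
  have [d d1 d2] : exists2 d, sigma * rh m < abs d & abs d < rh m.
    by apply: abs_dense; [rewrite mulr_ge0 ?(ltW sigma_gt0) ?ltW|rewrite gtr_pMl].
  by exists (a m + d); rewrite /A /= addrAC subrr add0r d1.
have sr_value m : value_group abs (sigma * rh m).
  have [s s0 <-] := sigma_value; have [c /= c0 <-] := rh_value m.
  by exists (s * c); rewrite ?absM //= mulf_neq0.
exists (fun m => Some @` A m); split.
- move=> j jn; split; first by rewrite Q_deg leqW.
    have [z Az] := A_ne j; exists (Some z); first exact: A_qp Az.
    apply/seteqP; split => [w Aw|w [B [cB Bz BQ] Bw]].
      exists (Some @` A j); last by [].
      split; [exact: (annulus_affinoid (rh_value j) (sr_value j) Az)|by exists z|].
      by move=> _ [y Ay <-]; exact: A_qp Ay.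
    by apply: (A_comp j B z _ Az cB Bz BQ) => // bs; exact: R_max.
  exists (~` (Some @` diskC abs (rh j) (a j))), (Some @` ballC abs (sigma * rh j) (a j));
    split.
  + by exists (rh j), (diskC abs (rh j) (a j)); right; split => //; split => //;
    exists (a j).
  + by exists (sigma * rh j), (ballC abs (sigma * rh j) (a j)); left; split => //;
    split => //; exists (a j).
  + rewrite -subset0 => w [nD [z /= zs zw]]; apply: nD; exists z => //=.
    by apply: le_lt_trans zs _; rewrite gtr_pMl.
  + rewrite setCU setCK; apply/seteqP; split => [_ [z /= /andP[z1 z2] <-]|w [[z /= z2 zw] nB]].
      split; first by exists z.
      by move=> [y /= ys [yz]]; move: z1; rewrite -yz ltNge ys.
    exists z => //; apply/andP; split=> //; rewrite ltNge; apply/negP => zs; apply: nB.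
    by exists z.
- move=> i j iln jn Aij; apply/eqP; apply: contraT => ij.
  have ijn : i != j %[mod n] by rewrite !modn_small.
  have [ri rj] := Dm_disjoint ijn.
  have [z Az] := A_ne i; have : (Some @` A j) (Some z) by rewrite -Aij; exists z.
  move=> [y /andP[_ yj] [yz]]; rewrite yz in yj; have /andP[_ zi] := Az.
  have [h|h] := leP (rh i) (rh j).
    have : abs (a i - a j) < rh j by apply: (@abs_dist_lt _ _ _ z) => //;
      rewrite abs_distC (lt_le_trans zi).
    by rewrite ltNge rj.
  have : abs (a i - a j) < rh i.
    by apply: (@abs_dist_lt _ _ _ z); [rewrite abs_distC|apply: lt_trans yj h].
  by rewrite ltNge ri.
- move=> j jn; rewrite A_image; congr (_ @` _); rewrite /A.
  by have [|-> -> _] := @per j.+1 (j.+1 %% n)%N; first by rewrite modn_mod.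
Qed.

End Assembly.

(** * The field [Cp] is algebraically closed *)

Section AlgebraicallyClosedCompletion.
Context (RR : realType) (L : closedFieldType) (K : fieldType) (abs : nonarchAbs RR K).
Context (k : {rmorphism L -> K}).
Hypothesis k_dense : forall y e, 0 < e -> exists x, abs (y - k x) < e.
Hypothesis K_complete : abs_complete abs.
Implicit Types (x y : K) (P : {poly K}).

Lemma abs_sum_le (I : Type) (s : seq I) (Q : pred I) (F : I -> K) e : 0 <= e ->
  (forall i, Q i -> abs (F i) <= e) -> abs (\sum_(i <- s | Q i) F i) <= e.
Proof.
move=> e0 Fe; elim/big_ind: _ => [|x y hx hy|//]; first by rewrite abs0.
exact: absD_le.
Qed.

Lemma abs_sum_lt (I : Type) (s : seq I) (Q : pred I) (F : I -> K) e : 0 < e ->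
  (forall i, Q i -> abs (F i) < e) -> abs (\sum_(i <- s | Q i) F i) < e.
Proof.
move=> e0 Fe; elim/big_ind: _ => [|x y hx hy|//]; first by rewrite abs0.
exact: absD_lt.
Qed.

Lemma poly_lipschitz P (M : RR) : 0 <= M -> exists B, 0 <= B /\ forall x y,
  abs x <= M -> abs y <= M -> abs P.[x] <= B /\ abs (P.[x] - P.[y]) <= B * abs (x - y).
Proof.
move=> M0; elim/poly_ind: P => [|P c [B [B0 BP]]].
  by exists 0; split => // x y _ _; rewrite !horner0 subrr abs0 mul0r.
have BM0 : 0 <= B * M by rewrite mulr_ge0.
exists (Num.max (Num.max (B * M) B) (abs c)); split; first by rewrite !le_max BM0.
move=> x y xM yM; have [Px Pxy] := BP x y xM yM; have [Py _] := BP y x yM xM.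
rewrite !hornerMXaddC; split.
  by apply: absD_le; [rewrite absM !le_max ler_pM ?abs_ge0|rewrite le_max lexx orbT].
have -> : P.[x] * x + c - (P.[y] * y + c) = (P.[x] - P.[y]) * x + P.[y] * (x - y) by ring.
apply: absD_le; rewrite absM.
  apply: le_trans (_ : B * M * abs (x - y) <= _).
    by rewrite mulrAC ler_pM ?abs_ge0.
  by rewrite ler_wpM2r ?abs_ge0 // !le_max lexx.
by rewrite ler_wpM2r ?abs_ge0 // !le_max Py orbT.
Qed.

Lemma coef_bound P : exists M : RR, 1 <= M /\ forall i, abs P`_i <= M.
Proof.
elim/poly_ind: P => [|P c [M [M1 MP]]].
  by exists 1; split => // i; rewrite coef0 abs0.
exists (Num.max M (abs c)); split; first by rewrite le_max M1.
move=> i; rewrite coefD coefMX coefC; case: i => [|i] /=.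
  by rewrite add0r le_max lexx orbT.
by rewrite addr0 le_max MP.
Qed.

(** Continuity of roots: a monic polynomial over [L] with nearby coefficients splits, and if its
    value at [x] is at most [e], one of its [d] roots [r] satisfies [abs (x - k r) ^ d <= e]. *)
Let approx_root P d (M e e' : RR) x : P \is monic -> size P = d.+1 -> (0 < d)%N ->
  1 <= M -> abs x <= M -> abs P.[x] <= e -> 0 < e -> e <= M ^+ d -> 0 < e' ->
  exists y, [/\ abs y <= M, abs P.[y] <= e' & abs (x - y) ^+ d <= e].
Proof.
move=> Pm Ps d0 M1 xM Px e0 eM e'0; have M0 : 0 < M := lt_le_trans ltr01 M1.
set eta := Num.min e e' / M ^+ d.
have eta0 : 0 < eta by rewrite divr_gt0 ?exprn_gt0 // lt_min e0.
have [c cP] := @choice nat L (fun i (w : L) => abs (P`_i - k w) < eta)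
  (fun i => k_dense P`_i eta0).
pose P' : {poly L} := 'X^d + \poly_(i < d) c i.
have P'm : P' \is monic by rewrite monicE lead_coefDl ?size_polyXn ?ltnS ?size_poly // lead_coefXn.
have P's : size P' = d.+1 by rewrite size_polyDl ?size_polyXn // ltnS size_poly.
have diff y : abs y <= M -> abs (P.[y] - (map_poly k P').[y]) <= Num.min e e'.
  move=> yM; rewrite -hornerN -hornerD horner_coef; apply: abs_sum_le.
    by rewrite le_min !ltW.
  move=> i _; have ib : (i < d.+1)%N.
    apply: (leq_trans (ltn_ord i)); apply: (leq_trans (size_polyD _ _)).
    by rewrite size_polyN size_map_poly Ps P's maxnn.
  have -> : Num.min e e' = eta * M ^+ d by rewrite divfK // expf_neq0 // gt_eqF.
  rewrite absM; apply: ler_pM; rewrite ?abs_ge0 //.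
    rewrite coefB coef_map coefD coefXn coef_poly /=.
    have [id|id] := ltnP i d; first by rewrite (ltn_eqF id) add0r ltW.
    have -> : i = d :> nat by apply/eqP; rewrite eqn_leq id -ltnS ib.
    rewrite eqxx addr0 rmorph1 -[d]/(d.+1.-1) -Ps -lead_coefE (monicP Pm) subrr abs0.
    exact: ltW.
  rewrite absX; apply: le_trans (_ : M ^+ i <= _);
    first by rewrite lerXn2r ?nnegrE ?abs_ge0 // ltW.
  by rewrite ler_weXn2l // -ltnS.
have [rs rsE] := closed_field_poly_normal P'.
rewrite (monicP P'm) scale1r in rsE.
have rsd : size rs = d by apply/eqP; rewrite -eqSS -P's rsE size_prod_XsubC.
have P'E y : (map_poly k P').[y] = \prod_(r <- rs) (y - k r).
  rewrite rsE rmorph_prod horner_prod; apply: eq_bigr => r _.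
  by rewrite rmorphB /= map_polyX map_polyC hornerXsubC.
have P'x : \prod_(r <- rs) abs (x - k r) <= e.
  rewrite -(abs_prod_seq abs) -P'E.
  rewrite -[X in abs X](subKr P.[x]); apply: absB_le => //.
  by apply: le_trans (diff x xM) _; rewrite ge_min lexx.
have [r r_rs xr] : exists2 r, r \in rs & abs (x - k r) ^+ d <= e.
  apply: contrapT => no; move: P'x; rewrite leNgt => /negP; apply.
  rewrite -(@ltr_pXn2r _ d) ?nnegrE ?(ltW e0) // ?prodr_ge0 // => [|i _];
    last exact: abs_ge0.
  have -> : e ^+ d = \prod_(r <- rs) e by rewrite big_const_seq count_predT rsd iter_mulr_1.
  rewrite -prodrXl big_seq [ltRHS]big_seq; apply: ltr_prod.
    by apply/hasP; case: (rs) rsd d0 => [<-//|r rs' _ _]; exists r; rewrite mem_head.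
  move=> r r_rs; rewrite (ltW e0) /= ltNge; apply/negP => h.
  by apply: no; exists r.
exists (k r).
have P'r : (map_poly k P').[k r] = 0.
  by rewrite P'E (big_rem _ r_rs) /= subrr mul0r.
have xkr : abs (x - k r) <= M.
  by rewrite -(@ler_pXn2r _ d) ?nnegrE ?abs_ge0 ?(ltW M0) // (le_trans xr).
have krM : abs (k r) <= M.
  rewrite -[X in abs X](subKr x); exact: absB_le.
split => //; have := diff _ krM; rewrite P'r subr0 => /le_trans; apply.
by rewrite ge_min lexx orbT.
Qed.

Lemma completion_closed P : (1 < size P)%N -> exists x, root P x.
Proof.
wlog Pm : P / P \is monic => [H|] sP.
  have P0 : P != 0 by rewrite -size_poly_gt0 ltnW.
  have lP : (lead_coef P)^-1 != 0 by rewrite invr_eq0 lead_coef_eq0.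
  have [||x] := H ((lead_coef P)^-1 *: P).
  - by rewrite monicE lead_coefZ mulVf // lead_coef_eq0.
  - by rewrite size_scale.
  by rewrite rootZ // => xP; exists x.
set d := (size P).-1; have Ps : size P = d.+1 by rewrite prednK // ltnW.
have d0 : (0 < d)%N by rewrite -ltnS -Ps.
have [M [M1 MP]] := coef_bound P; have M0 : 0 < M := lt_le_trans ltr01 M1.
pose q : RR := 2^-1; have q0 : 0 < q by rewrite invr_gt0.
have q1 : q < 1 by rewrite invf_lt1 // ltr1n.
(* With [q ^ m] inside the [d]-th power, the [m]-th step has length at most [M * q ^ m], and the
   approximate roots form a Cauchy sequence. *)
pose e (m : nat) := (M * q ^+ m) ^+ d.
have e0 m : 0 < e m by rewrite exprn_gt0 // mulr_gt0 // exprn_gt0.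
have eM m : e m <= M ^+ d.
  rewrite lerXn2r ?nnegrE ?(ltW M0) // ?mulr_ge0 ?exprn_ge0 ?(ltW M0) ?(ltW q0) //.
  by rewrite ler_piMr ?(ltW M0) // exprn_ile1 // ltW.
pose good m x := abs x <= M /\ abs P.[x] <= e m.
have [F FE] : {F : nat * K -> K & forall mx, good mx.1 mx.2 ->
    good mx.1.+1 (F mx) /\ abs (mx.2 - F mx) ^+ d <= e mx.1}.
  apply: (@choice _ _ (fun (mx : nat * K) y => good mx.1 mx.2 ->
    good mx.1.+1 y /\ abs (mx.2 - y) ^+ d <= e mx.1)) => -[m x] /=.
  have [[xM Px]|ng] := pselect (good m x); last by exists 0 => /ng.
  have [y [yM Py xy]] := approx_root Pm Ps d0 M1 xM Px (e0 m) (eM m) (e0 m.+1).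
  by exists y.
pose u := fix u m := if m is m'.+1 then F (m', u m') else 0.
have ug m : good m (u m).
  elim: m => [|m IH]; last by have [] := FE (m, u m) IH.
  split; rewrite /= ?abs0 ?(ltW M0) // horner_coef0 /e expr0 mulr1.
  by apply: le_trans (MP 0%N) _; rewrite -[leLHS]expr1 ler_weXn2l.
have ustep m : abs (u m - u m.+1) <= M * q ^+ m.
  have [_ h] := FE (m, u m) (ug m).
  rewrite -(@ler_pXn2r _ d) ?nnegrE ?abs_ge0 // mulr_ge0 ?exprn_ge0 ?(ltW M0) ?(ltW q0) //.
have uN N m : (N <= m)%N -> abs (u m - u N) <= M * q ^+ N.
  move=> /subnK <-; elim: (m - N)%N => [|i IH].
    by rewrite subrr abs0 mulr_ge0 ?exprn_ge0 ?(ltW M0) ?(ltW q0).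
  rewrite addSn; apply: abs_dist_le IH; rewrite abs_distC; apply: le_trans (ustep _) _.
  by rewrite ler_pM2l // ler_wiXn2l ?(ltW q0) ?(ltW q1) // leq_addl.
have small t : 0 < t -> exists N, M * q ^+ N < t.
  move=> t0; have [||N hN] := @expr_small _ q (t / M); rewrite ?(ltW q0) ?divr_gt0 //.
  by exists N; rewrite mulrC -ltr_pdivlMr.
have [|l ul] := K_complete (u := u).
  move=> t /small[N hN]; exists N => m m' Nm Nm'.
  apply: (@abs_dist_lt _ _ _ (u N)); first exact: le_lt_trans (uN _ _ Nm) hN.
  by rewrite abs_distC; exact: le_lt_trans (uN _ _ Nm') hN.
have lim t : 0 < t -> exists N, forall m, (N <= m)%N -> abs (u m - l) < t.
  move=> t0; move/cvgr0Pnorm_lt: ul => /(_ t t0)[N _ NE]; exists N => m Nm.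
  by have := NE m Nm; rewrite /= ger0_norm ?abs_ge0.
have lM : abs l <= M.
  have [N /(_ N (leqnn N)) uNl] := lim M M0; have [uNM _] := ug N.
  by rewrite -[l](subKr (u N)) absB_le // ltW.
exists l; apply/rootP/eqP; rewrite -(abs_eq0 abs); apply/eqP/le_anti;
  rewrite abs_ge0 andbT leNgt.
apply/negP => Pl.
have [B [B0 PB]] := poly_lipschitz P (ltW M0).
have [|N1 N1E] := small (Num.min 1 (abs P.[l])); first by rewrite lt_min ltr01.
have B1 : 0 < B + 1 by apply: ltr_wpDl.
have [N2 N2E] := lim (abs P.[l] / (B + 1)) (divr_gt0 Pl B1).
set m := maxn N1 N2.
have [um Pum] := ug m; have [_ lip] := PB _ _ lM um.
suff : abs P.[l] < abs P.[l] by rewrite ltxx.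
rewrite -{1}[P.[l]](subrK P.[u m]); apply: absD_lt.
  apply: le_lt_trans lip _; rewrite abs_distC.
  apply: le_lt_trans (_ : (B + 1) * abs (u m - l) < _).
    by rewrite ler_wpM2r ?abs_ge0 // lerDl.
  by rewrite mulrC -ltr_pdivlMr // N2E // leq_maxr.
have : M * q ^+ m < Num.min 1 (abs P.[l]).
  apply: le_lt_trans N1E; rewrite ler_pM2l // ler_wiXn2l ?(ltW q0) ?(ltW q1) //.
  exact: leq_maxl.
rewrite lt_min => /andP[h1 h2]; apply: le_lt_trans Pum (le_lt_trans _ h2).
have Mq : 0 <= M * q ^+ m by rewrite mulr_ge0 ?exprn_ge0 ?(ltW M0) ?(ltW q0).
by rewrite /e -(prednK d0) exprS ler_piMr // exprn_ile1 // ltW.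
Qed.

End AlgebraicallyClosedCompletion.

(** * Residue classes of [Cp] *)

Section ResidueField.
Context (RR : realType) (p : nat) (K : fieldType) (abs : nonarchAbs RR K).
Hypotheses (p_prime : prime p) (p_lt1 : abs p%:R < 1).
Implicit Types (x y : K).

Lemma abs_int (z : int) : abs z%:~R <= 1.
Proof. by case: z => m; rewrite ?NegzE ?mulrNz ?absN ?pmulrn abs_nat. Qed.

Lemma gcdz_prime (z : int) : ~~ (p%:Z %| z)%Z -> gcdz z p = 1.
Proof.
rewrite dvdzE -prime_coprime // coprime_sym => /eqP zp.
by rewrite /gcdz zp.
Qed.

Lemma abs_int_unit (z : int) : ~~ (p%:Z %| z)%Z -> abs z%:~R = 1.
Proof.
move=> pz; have [u [v uv]] := Bezoutz z p.
have g1 := gcdz_prime pz.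
rewrite g1 in uv; apply/eqP; rewrite eq_le abs_int leNgt /=; apply/negP => z1.
have : abs 1 < 1.
  have -> : 1 = u%:~R * z%:~R + v%:~R * p%:R :> K.
    by have := congr1 (fun t : int => t%:~R : K) uv; rewrite rmorphD !rmorphM mulr1z => E;
      exact: esym E.
  apply: absD_lt; rewrite absM.
    by apply: le_lt_trans z1; rewrite ler_piMl ?abs_ge0 ?abs_int.
  by apply: le_lt_trans p_lt1; rewrite ler_piMl ?abs_ge0 ?abs_int.
by rewrite abs1 ltxx.
Qed.

Lemma int_residue (z : int) : exists2 b, (b < p)%N & abs (z%:~R - b%:R) < 1.
Proof.
have p0 : p%:Z != 0 by rewrite eqz_nat -lt0n prime_gt0.
exists `|(z %% p)%Z|%N.
  by rewrite -ltz_nat gez0_abs ?modz_ge0 // ltz_mod.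
have -> : z%:~R - (`|(z %% p)%Z|%N)%:R = (z %/ p)%Z%:~R * p%:R :> K.
  rewrite {1}(divz_eq z p) rmorphD rmorphM /= -addrA.
  by rewrite -[X in - X]/((Posz _)%:~R) gez0_abs ?modz_ge0 // subrr addr0.
by rewrite absM; apply: le_lt_trans p_lt1; rewrite ler_piMl ?abs_ge0 ?abs_int.
Qed.

(** A rational of absolute value at most [1] has a denominator prime to [p], which Bezout inverts
    modulo [p]. *)
Lemma rat_residue (f : {rmorphism rat -> K}) (q : rat) : abs (f q) <= 1 ->
  exists2 b, (b < p)%N & abs (f q - b%:R) < 1.
Proof.
have fE : f q = (numq q)%:~R / (denq q)%:~R.
  by rewrite -[in LHS](divq_num_den q) fmorph_div !rmorph_int.
have d0 : (denq q)%:~R != 0 :> K by rewrite -(rmorph_int f) fmorph_eq0 intr_eq0 denq_neq0.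
have ad0 : 0 < abs (denq q)%:~R by rewrite abs_gt0.
move=> fq1; have pd : ~~ (p%:Z %| denq q)%Z.
  apply/negP => pd; have pn : ~~ (p%:Z %| numq q)%Z.
    apply/negP => pn; have := coprime_num_den q; rewrite /coprime => /eqP g1.
    have : (p %| gcdn `|numq q| `|denq q|)%N by move: (pn) (pd);
      rewrite dvdn_gcd !dvdzE /= => -> ->.
    by rewrite g1 dvdn1 => /eqP p1; move: p_prime; rewrite p1.
  have d1 : abs (denq q)%:~R < 1.
    have /dvdzP[t ->] := pd; rewrite rmorphM absM; apply: le_lt_trans p_lt1.
    by rewrite ler_piMl ?abs_ge0 ?abs_int.
  move: fq1; rewrite fE absM absV (abs_int_unit pn) mul1r leNgt.
  by rewrite invf_gt1 // d1.
have ad := abs_int_unit pd.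
have [u [v uv]] := Bezoutz (denq q) p.
have g1 := gcdz_prime pd.
have [b bp bE] := int_residue (numq q * u); exists b => //.
apply: abs_dist_lt bE.
have -> : f q - (numq q * u)%:~R = (numq q)%:~R * v%:~R / (denq q)%:~R * p%:R.
  have E : v%:~R * p%:R = 1 - u%:~R * (denq q)%:~R :> K.
    have := congr1 (fun t : int => t%:~R : K) uv; rewrite g1 rmorphD !rmorphM mulr1z => E.
    by apply/eqP; rewrite -subr_eq0 opprB addrA [_ + u%:~R * _]addrC E subrr.
  have -> : (numq q)%:~R * v%:~R / (denq q)%:~R * p%:R =
    (numq q)%:~R * (v%:~R * p%:R) / (denq q)%:~R :> K by ring.
  by rewrite E fE rmorphM /=; field.
rewrite absM; apply: le_lt_trans p_lt1; rewrite ler_piMl ?abs_ge0 //.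
by rewrite absM absV ad invr1 mulr1 absM mulr_ile1 ?abs_ge0 ?abs_int.
Qed.

Lemma abs_subX_le x y m : abs x <= 1 -> abs y <= 1 -> abs (x ^+ m - y ^+ m) <= abs (x - y).
Proof.
move=> x1 y1; rewrite subrXX absM ler_piMr ?abs_ge0 //.
elim/big_ind: _ => [|u v hu hv|i _]; first by rewrite abs0.
  exact: absD_le.
by rewrite absM !absX mulr_ile1 ?exprn_ge0 ?abs_ge0 ?exprn_ile1 ?abs_ge0.
Qed.

(* Modulo the maximal ideal the powers of [y] stay in the finite set of
   combinations of [1, y, ..., y ^+ d.-1] with coefficients below [p]. *)
Lemma integral_torsion y d (c : nat -> nat) : abs y = 1 ->
  abs (y ^+ d - \sum_(i < d) (c i)%:R * y ^+ i) < 1 ->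
  exists2 M, (0 < M)%N & abs (y ^+ M - 1) < 1.
Proof.
move=> y1 yd; pose comb (f : nat -> nat) := \sum_(i < d) (f i)%:R * y ^+ i.
case: d yd @comb => [|e] yd comb; first by rewrite big_ord0 subr0 abs1 ltxx in yd.
have pow m : exists f, abs (y ^+ m - comb f) < 1.
  elim: m => [|m [f fE]].
    exists (fun i => (i == 0)%N); rewrite /comb big_ord_recl big1.
      by rewrite addr0 mul1r subrr abs0.
    by move=> i _; rewrite mul0r.
  (* Multiply by [y], and replace [y ^ e.+1] by the combination of lower powers to which it is
     congruent. *)
  exists (fun i => ((if i is i'.+1 then f i' else 0) + f e * c i)%N).
  have -> : comb (fun i => ((if i is i'.+1 then f i' else 0) + f e * c i)%N) =
      y * comb f - (f e)%:R * (y ^+ e.+1 - \sum_(i < e.+1) (c i)%:R * y ^+ i).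
    have -> : y * comb f = \sum_(i < e.+1) (f i)%:R * y ^+ i.+1.
      by rewrite mulr_sumr; apply: eq_bigr => i _; rewrite mulrCA -exprS.
    have -> : \sum_(i < e.+1) (c i)%:R * y ^+ i =
        (c 0%N)%:R + \sum_(i < e) (c i.+1)%:R * y ^+ i.+1 by rewrite big_ord_recl mulr1.
    rewrite big_ord_recr /= /comb big_ord_recl /= mulr1.
    set S1 := \sum_(i < e) (f i)%:R * _; set S2 := \sum_(i < e) (c _)%:R * _.
    have -> : \sum_(i < e) (f i + f e * c i.+1)%:R * y ^+ i.+1 =
        S1 + (f e)%:R * S2.
      rewrite /S1 /S2 mulr_sumr -big_split /=; apply: eq_bigr => i _.
      by rewrite natrD natrM mulrDl mulrA.
    by rewrite add0n natrM; ring.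
  rewrite opprB addrCA [y ^+ m.+1]exprS -mulrBr; apply: absD_lt; rewrite absM.
    by apply: le_lt_trans yd; rewrite ler_piMl ?abs_ge0 ?abs_nat.
  by rewrite y1 mul1r.
have p0 : (0 < p)%N := prime_gt0 p_prime.
pose comb' (h : {ffun 'I_e.+1 -> 'I_p}) := \sum_i (h i : nat)%:R * y ^+ i.
have [H HE] : {H : nat -> {ffun 'I_e.+1 -> 'I_p} & forall m, abs (y ^+ m - comb' (H m)) < 1}.
  apply: (@choice _ _ (fun m h => abs (y ^+ m - comb' h) < 1)) => m.
  have [f fE] := pow m; exists [ffun i : 'I_e.+1 => Ordinal (ltn_pmod (f i) p0)].
  apply: abs_dist_lt fE _; rewrite /comb /comb' -sumrB; apply: abs_sum_lt => // i _.
  rewrite ffunE /= -mulrBl absM absX y1 expr1n mulr1 {1}(divn_eq (f i) p) natrD addrK natrM absM.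
  by apply: le_lt_trans p_lt1; rewrite ler_piMl ?abs_ge0 ?abs_nat.
have [m1 [m2 [m12 E]]] : exists m1 m2, (m1 < m2)%N /\ H m1 = H m2.
  pose N := #|{ffun 'I_e.+1 -> 'I_p}|.
  have /injectivePn[i1 [i2 i12 E]] : ~~ injectiveb (fun i : 'I_N.+1 => H i).
    by apply/negP => /injectiveP /leq_card; rewrite card_ord ltnn.
  have [h|h] := ltnP i1 i2; first by exists i1, i2.
  by exists i2, i1; rewrite ltn_neqAle eq_sym i12 h.
exists (m2 - m1)%N; first by rewrite subn_gt0.
have -> : abs (y ^+ (m2 - m1) - 1) = abs (y ^+ m2 - y ^+ m1).
  rewrite -{2}(subnK (ltnW m12)) exprD -[X in _ = abs (_ - X)]mul1r -mulrBl absM.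
  by rewrite absX y1 expr1n mulr1.
by apply: (abs_dist_lt (HE m2)); rewrite abs_distC -E.
Qed.

End ResidueField.

Section IntegralEquation.
Context (RR : realType) (p : nat) (K : fieldType) (abs : nonarchAbs RR K).
Hypotheses (p_prime : prime p) (p_lt1 : abs p%:R < 1).

Lemma top_coefficient (y : K) (b : nat -> nat) s i0 : (i0 < s)%N -> b i0 != 0%N ->
  abs (\sum_(i < s) (b i)%:R * y ^+ i) < 1 ->
  exists d, b d != 0%N /\ abs (\sum_(i < d.+1) (b i)%:R * y ^+ i) < 1.
Proof.
elim: s => // s IH i0s bi0 by1; have [bs|bs] := eqVneq (b s) 0%N; last by exists s.
apply: IH => //; last by move: by1; rewrite big_ord_recr /= bs mul0r addr0.
by move: i0s; rewrite ltnS leq_eqVlt => /orP[/eqP i0s|//]; rewrite i0s bs in bi0.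
Qed.

Lemma residue_algebraic_torsion (y : K) (b : nat -> nat) s i0 : abs y = 1 ->
  (i0 < s)%N -> (forall i, (b i < p)%N) -> b i0 != 0%N ->
  abs (\sum_(i < s) (b i)%:R * y ^+ i) < 1 ->
  exists2 M, (0 < M)%N & abs (y ^+ M - 1) < 1.
Proof.
move=> y1 i0s bp bi0 /(top_coefficient i0s bi0)[d [bd T1]].
have bd0 : (0 < b d)%N by rewrite lt0n.
case: (egcdnP p bd0) => u v uv _.
have g1 : gcdn (b d) p = 1%N.
  by apply/eqP; rewrite -[_ == _]/(coprime _ _) coprime_sym prime_coprime // gtnNdvd.
rewrite g1 in uv.
(* [u] inverts the leading coefficient modulo [p], and [p.-1] stands for [-1], so that the
   coefficients remain natural numbers. *)
apply: (integral_torsion p_prime p_lt1 (d := d) (c := fun i => (p.-1 * u * b i)%N) y1).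
set S := \sum_(i < d) (b i)%:R * y ^+ i.
have S1 : abs S <= 1.
  apply: abs_sum_le => // i _; rewrite absM absX y1 expr1n mulr1.
  exact: abs_nat.
rewrite big_ord_recr /= -/S in T1; set T := S + _ in T1.
have -> : \sum_(i < d) (p.-1 * u * b i)%:R * y ^+ i = (p%:R - 1) * u%:R * S.
  rewrite mulr_sumr; apply: eq_bigr => i _; rewrite !natrM mulrA.
  by rewrite -[in RHS](prednK (prime_gt0 p_prime)) -natr1 addrK.
have -> : y ^+ d - (p%:R - 1) * u%:R * S = u%:R * T - p%:R * (v%:R * y ^+ d + u%:R * S).
  have E : (u%:R * (b d)%:R : K) = v%:R * p%:R + 1 by rewrite -!natrM uv natrD.
  have -> : u%:R * T = u%:R * S + u%:R * (b d)%:R * y ^+ d by rewrite /T; ring.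
  by rewrite E; ring.
apply: absB_lt; rewrite absM.
  by apply: le_lt_trans T1; rewrite ler_piMl ?abs_ge0 ?abs_nat.
apply: le_lt_trans p_lt1; rewrite ler_piMr ?abs_ge0 //.
by apply: absD_le; rewrite absM ?absX ?y1 ?expr1n ?mulr1 ?abs_nat // mulr_ile1 ?abs_ge0 ?abs_nat.
Qed.

End IntegralEquation.

Lemma max_below (RR : realType) (F : nat -> RR) s : exists2 i0, (i0 <= s)%N &
  forall i, (i <= s)%N -> F i <= F i0.
Proof.
elim: s => [|s [i0 i0s IH]]; first by exists 0%N => // -[].
have [h|h] := leP (F i0) (F s.+1).
  exists s.+1 => // i; rewrite leq_eqVlt => /orP[/eqP -> //|i_s].
  by apply: le_trans h; apply: IH.
exists i0; first exact: leqW.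
by move=> i; rewrite leq_eqVlt => /orP[/eqP ->|/IH //]; apply: ltW.
Qed.

Lemma padic_abs_prime (RR : realType) p : prime p -> padic_abs RR p p%:R < 1.
Proof.
move=> pp; have -> : (p%:R : rat) = (p%:Z)%:~R by [].
rewrite /padic_abs numq_int denq_int intr_eq0 eqz_nat eqn0Ngt prime_gt0 //=.
rewrite logn1 expr0 logn_prime // eqxx expr1 div1r invf_lt1 ?ltr0n ?prime_gt0 //.
by rewrite ltr1n prime_gt1.
Qed.

Lemma is_Cp_padicAbs (RR : realType) (p : nat) (Cp : fieldType) (abs : Cp -> RR) :
  prime p -> is_Cp p abs -> exists v : padicAbs RR p Cp, v = abs :> (Cp -> RR).
Proof.
move=> pp [Qp [absQ [i [L [absL [j [k [completeQ closedL completeC]]]]]]]].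
have [[naQ isoQ denseQ _] [alg _ extL]] := (completeQ, closedL).
have [naC isoC denseC complC] := completeC.
pose v := NonarchAbs naC.
pose f : {rmorphism rat -> Cp} := (k \o (j \o i))%FUN.
have fE q : v (f q) = padic_abs RR p q by rewrite /= isoC extL isoQ.
have p_lt1 : v p%:R < 1 by rewrite -(rmorph_nat f) fE padic_abs_prime.
have char0 n : n.+1%:R != 0 :> Cp by rewrite -(rmorph_nat f) fmorph_eq0 pnatr_eq0.
have rootC (P : {poly Cp}) : (1 < size P)%N -> exists x, root P x.
  exact: (@completion_closed RR L Cp v k denseC complC).
have tors c : v c = 1 -> exists2 M, (0 < M)%N & v (c ^+ M - 1) < 1.
  move=> c1; have [y cy] := denseC c 1 ltr01.
  have y1 : v (k y) = 1 by rewrite -c1; apply: (abs_eq_close (x := c)); rewrite c1.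
  suff [M M0 yM] : exists2 M, (0 < M)%N & v (k y ^+ M - 1) < 1.
    exists M => //; apply: abs_dist_lt yM; apply: le_lt_trans cy.
    by apply: abs_subX_le; rewrite ?c1 ?y1.
  have [P P0 /rootP Py] := alg y.
  set s := (size P).-1; have sE : size P = s.+1 by rewrite prednK // size_poly_gt0.
  (* Division by the coefficient of largest absolute value makes all coefficients integral and one
     of them [1], so the relation stays nontrivial modulo the maximal ideal. *)
  have [i0 i0s i0max] := max_below (fun l => absQ P`_l) s.
  have nzi0 : P`_i0 != 0.
    apply/eqP => Pi0; have := i0max s (leqnn s); rewrite Pi0.
    have -> : absQ 0 = 0 by apply/(nonarch_abs_eq0 naQ).
    rewrite /s -lead_coefE => h; have := nonarch_abs_ge0 naQ (lead_coef P) => h'.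
    have /(nonarch_abs_eq0 naQ)/eqP : absQ (lead_coef P) = 0 by apply/le_anti/andP.
    by rewrite lead_coef_eq0 (negPf P0).
  have kjE x : v (k (j x)) = absQ x by rewrite /= isoC extL.
  pose N l := k (j (P`_l / P`_i0)).
  have N1 l : (l <= s)%N -> v (N l) <= 1.
    move=> ls; have n0 : 0 < absQ P`_i0 by rewrite -kjE abs_gt0 !fmorph_eq0.
    by rewrite /N !fmorph_div absM absV !kjE ler_pdivrMr // mul1r i0max.
  have Ni0 : N i0 = 1 by rewrite /N divff // !rmorph1.
  have Nsum : \sum_(l < s.+1) N l * k y ^+ l = 0.
    have Py' : \sum_(l < s.+1) j P`_l * y ^+ l = 0.
      move: Py; rewrite horner_coef size_map_poly sE => Py0; rewrite -[RHS]Py0;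
        apply: eq_bigr => l _.
      by rewrite coef_map.
    have := congr1 (fun t : L => k (j (P`_i0)^-1 * t)) Py'.
    rewrite mulr0 rmorph0 mulr_sumr rmorph_sum => E; rewrite -[RHS]E.
    apply: eq_bigr => l _; rewrite /N mulrA -rmorphM [(P`_i0)^-1 * _]mulrC rmorphM rmorphXn //.
  (* The residue field of [Qp] is the prime field: each coefficient is close to a rational, and that
     rational to a natural number below [p]. *)
  have [b bE] : {b : nat -> nat & forall l, (b l < p)%N /\
      ((l <= s)%N -> v (N l - (b l)%:R) < 1)}.
    apply: (@choice _ _ (fun l b => (b < p)%N /\ ((l <= s)%N -> v (N l - b%:R) < 1))) => l.
    have [ls|ls] := leqP l s; last by exists 0%N; rewrite prime_gt0.
    have [q qE] := denseQ (P`_l / P`_i0) 1 ltr01.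
    have Nq : v (N l - f q) < 1.
      by rewrite (_ : N l - f q = k (j (P`_l / P`_i0 - i q))) ?kjE // !rmorphB.
    have fq1 : v (f q) <= 1.
      by rewrite -[f q](subKr (N l)); apply: absB_le; [exact: N1|exact: ltW].
    have [b bp bq] := rat_residue pp p_lt1 fq1.
    by exists b; split => // _; apply: abs_dist_lt Nq bq.
  apply: (residue_algebraic_torsion pp p_lt1 (b := b) (s := s.+1) (i0 := i0)) => //.
  - by move=> l; case: (bE l).
  - apply/eqP => b0; have [_ /(_ i0s)] := bE i0.
    by rewrite b0 subr0 Ni0 abs1 ltxx.
  have -> : \sum_(l < s.+1) (b l)%:R * k y ^+ l =
      - \sum_(l < s.+1) (N l - (b l)%:R) * k y ^+ l.
    by under [in RHS]eq_bigr do rewrite mulrBl; rewrite sumrB Nsum sub0r opprK.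
  rewrite absN; apply: abs_sum_lt => // l _.
  by rewrite absM absX y1 expr1n mulr1; have [_] := bE l; apply; rewrite -ltnS.
by exists (PadicAbs rootC char0 (prime_gt0 pp) p_lt1 tors).
Qed.

Theorem theorem3p8 (RR : realType) (p : nat) (p_prime : prime p)
    (Cp : fieldType) (abs : Cp -> RR) (CpP : is_Cp p abs)
    (R : {fraction {poly Cp}}) (R_deg : (2 <= ratdeg R)%N)
    (n : nat) (n_ge1 : (1 <= n)%N)
    (D : nat -> set Cp) (rho : nat -> RR)
    (D_disk : forall j, (j < n)%N -> is_diskC abs (rho j) (D j))
    (D_cycle : is_cycle n R (siegel_disk abs R) (fun j => Some @` D j))
    (D_label : forall j, (j < n)%N ->
       Some @` D j = iter j (ratmap R) @` (Some @` D 0%N))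
    (rho_min : forall j, (1 <= j < n)%N -> rho 0%N <= rho j)
    (D_dist : forall j, (1 <= j)%N ->
       set_dist abs (D 0%N) (D (j %% n)%N) =
       set_dist abs (D (1 %% n)%N) (D (j.+1 %% n)%N)) :
  exists Q : {fraction {poly Cp}},
    ratdeg Q = (ratdeg R).+1 /\
    exists C : nat -> set (proj_line Cp),
      is_cycle n Q (herman_ring1 abs Q) C.
Proof.
have [v vE] := is_Cp_padicAbs p_prime CpP.
move: D_disk D_cycle D_dist; rewrite -vE => D_disk' D_cycle' D_dist'.
exact: (siegel_to_herman R_deg n_ge1 D_disk' D_cycle' rho_min D_dist').
Qed.
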